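(* Let $s\in(0,2)$ and let $(M,g)$ be an $n$-dimensional Riemannian manifold satisfying the flatness assumption $\mathrm{FA}_2(M,g,2,p,\varphi)$. Let $U:\widetilde B_2^+(p,0)\to\mathbb{R}$ be any function solving $$\widetilde{\mathrm{div}}(z^{1-s}\widetilde\nabla U)=0\quad\text{in }\widetilde B_2^+(p,0),$$ and let $u$ be its trace on $B_2(p)$. Assume also that $U\in L^\infty(\widetilde B_2^+(p,0))$ and $u=0$ in $B_{3/2}(p)$. Then there exists $C=C(n)>0$ such that $$z^{1-s}|\widetilde\nabla U(q,z)|\le\frac Cs\,\|U\|_{L^\infty(\widetilde B_{6/5}^+(p,0))}$$ for every $(q,z)\in\widetilde B_1^+(p,0)$.
   Context: $\widetilde M=M\times(0,\infty)$ carries the product metric $\widetilde g=g+dz\otimes dz$, with gradient $\widetilde\nabla$ and divergence $\widetilde{\mathrm{div}}$; $B_r(p)$ is the metric ball in $M$ and $\widetilde B_r^+(p,0)=\{(q,z)\in\widetilde M:d_{\widetilde g}((q,z),(p,0))<r\}$. The trace of $U$ is its boundary value at $z=0$. Flatness assumption: $\mathrm{FA}_\ell(M,g,R,p,\varphi)$ holds if $\varphi:\mathcal B_R(0)\to V$ is a diffeomorphism from the Euclidean ball $\mathcal B_R(0)\subset\mathbb{R}^n$ onto an open neighborhood $V$ of $p$ with $\varphi(0)=p$ and, with $g_{ij}(x)=g(\varphi_*\partial_{x^i},\varphi_*\partial_{x^j})$, one has $(1-\tfrac1{100})|v|^2\le g_{ij}(x)v^iv^j\le(1+\tfrac1{100})|v|^2$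 for all $v\in\mathbb{R}^n$, $x\in\mathcal B_R(0)$, and $R^{|\alpha|}\left|\frac{\partial^{|\alpha|}g_{ij}}{\partial x^\alpha}(x)\right|\le\tfrac1{100}$ for all multi-indices with $1\le|\alpha|\le\ell$ and $x\in\mathcal B_R(0)$. *)

(* Defs.v *)
From HB Require Import structures.
From mathcomp Require Export all_boot all_order all_algebra.
From mathcomp Require Export all_classical all_reals all_analysis.

Set Implicit Arguments.
Unset Strict Implicit.
Unset Printing Implicit Defensive.

Import Order.TTheory GRing.Theory Num.Theory.
Export numFieldNormedType.Exports.

Local Open Scope classical_set_scope.
Local Open Scope ring_scope.

Section calculus.
Context {R : realType} {n : nat}.
Implicit Types (f : 'rV[R]_n -> R) (D : set 'rV[R]_n).

Definition partial (i : 'I_n) f : 'rV[R]_n -> R :=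
  fun x => 'D_(delta_mx ord0 i) f x.

Fixpoint Ck (k : nat) D f : Prop :=
  match k with
  | 0 => forall x, D x -> {for x, continuous f}
  | k'.+1 =>
      [/\ forall x, D x -> {for x, continuous f},
          forall x i, D x -> derivable f x (delta_mx ord0 i) &
          forall i, Ck k' D (partial i f)]
  end.

Definition smooth D f : Prop := forall k, Ck k D f.

Definition mpartial (a : 'I_n -> nat) f : 'rV[R]_n -> R :=
  foldr (fun i h => iter (a i) (partial i) h) f (enum 'I_n).

Definition quad (G : 'M[R]_n) (v : 'rV[R]_n) : R :=
  (v *m G *m v^T) ord0 ord0.

(* The library norm on 'rV[R]_n is the sup norm, hence these two. *)
Definition enorm2 (v : 'rV[R]_n) : R := \sum_i v ord0 i ^+ 2.

Definition eball (r : R) : set 'rV[R]_n := [set x | Num.sqrt (enorm2 x) < r].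

(* Null sets of the n-dimensional Lebesgue measure, by countable box covers. *)
Definition lebesgue_null (A : set 'rV[R]_n) : Prop :=
  forall e : R, 0 < e -> exists S : set ('rV[R]_n * 'rV[R]_n),
    [/\ countable S,
        forall b, S b -> forall i, b.1 ord0 i <= b.2 ord0 i,
        A `<=` [set x | exists2 b, S b &
                  forall i, b.1 ord0 i <= x ord0 i <= b.2 ord0 i] &
        (\esum_(b in S) (\prod_i (b.2 ord0 i - b.1 ord0 i))%:E <= e%:E)%E].

End calculus.

(* The raw data of a Riemannian manifold: an atlas, the metric coefficients
   g_ij in each chart, and a choice of a chart around each point. The laws are
   in [riemannian_manifold]; they make every notion below independent of the
   choice made by [chart_at]. *)
Record riemann_data (R : realType) (M : topologicalType) (n : nat) :=
  RiemannData {
    chart : Type;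
    dom : chart -> set M;
    coord : chart -> M -> 'rV[R]_n;
    coordV : chart -> 'rV[R]_n -> M;
    gmat : chart -> 'rV[R]_n -> 'M[R]_n;
    chart_at : M -> chart }.

Section riemannian.
Context {R : realType} {M : topologicalType} {n : nat}.
Variable X : riemann_data R M n.
Implicit Types (c d : chart X) (A : set M).

Definition coord_image c A : set 'rV[R]_n := coord c @` (dom c `&` A).

Definition transition c d (k : 'I_n) : 'rV[R]_n -> R :=
  fun x => coord d (coordV c x) ord0 k.

Record riemannian_manifold : Prop := {
  rm_hausdorff : hausdorff_space M;
  rm_second_countable : @second_countable M;
  rm_chart_at : forall q, dom (chart_at X q) q;
  rm_dom_open : forall c, open (dom c);
  rm_image_open : forall c, open (coord_image c setT);
  rm_coordK : forall c q, dom c q -> coordV c (coord c q) = q;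
  rm_coord_continuous : forall c q, dom c q -> {for q, continuous (coord c)};
  rm_coordV_continuous : forall c x, coord_image c setT x ->
    {for x, continuous (coordV c)};
  rm_transition_smooth : forall c d k,
    smooth (coord_image c (dom d)) (transition c d k);
  rm_metric_smooth : forall c i j,
    smooth (coord_image c setT) (fun x => gmat c x i j);
  rm_metric_sym : forall c x, coord_image c setT x ->
    (gmat c x)^T = gmat c x;
  rm_metric_pos : forall c x v, coord_image c setT x -> v != 0 ->
    0 < quad (gmat c x) v;
  rm_metric_change : forall c d q, dom c q -> dom d q ->
    let J := \matrix_(i, k) partial i (transition c d k) (coord c q) in
    gmat c (coord c q) = J *m gmat d (coord d q) *m J^T }.

Definition Ck_on (k : nat) A (U : M -> R) : Prop :=
  forall c, Ck k (coord_image c A) (U \o coordV c).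

(* Corners can be reparametrized with zero speed, so C^1 curves (which may have
   zero speed) give the same distance as piecewise C^1 ones. *)
Definition C1_curve (gam : R -> M) : Prop :=
  forall t : R, 0 <= t <= 1 ->
    {for t, continuous gam} /\
    forall c, dom c (gam t) ->
      (\forall t' \near t, derivable (coord c \o gam) t' 1) /\
      {for t, continuous (derive1 (coord c \o gam))}.

Definition speed (gam : R -> M) (t : R) : R :=
  let c := chart_at X (gam t) in
  Num.sqrt (quad (gmat c (coord c (gam t))) (derive1 (coord c \o gam) t)).

Definition curve_length (gam : R -> M) : \bar R :=
  (\int[lebesgue_measure]_(t in `[0%R, 1%R]) (speed gam t)%:E)%E.

Definition rdist (p q : M) : \bar R :=
  ereal_inf [set curve_length gam | gam in
    [set gam | [/\ C1_curve gam, gam 0 = p & gam 1 = q]]].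

Definition rball (r : R) (p : M) : set M := [set q | (rdist q p < r%:E)%E].

(* A vector field is given by its components in every chart. *)
Definition vfield := chart X -> 'rV[R]_n -> 'rV[R]_n.

Definition grad (U : M -> R) : vfield := fun c x =>
  (\row_j partial j (U \o coordV c) x) *m invmx (gmat c x).

Definition scale_vf (w : M -> R) (F : vfield) : vfield :=
  fun c x => w (coordV c x) *: F c x.

Definition div_vf (F : vfield) (q : M) : R :=
  let c := chart_at X q in
  let rho := fun x => Num.sqrt (\det (gmat c x)) in
  (rho (coord c q))^-1 *
  \sum_i partial i (fun x => rho x * F c x ord0 i) (coord c q).

Definition vnorm (F : vfield) (q : M) : R :=
  let c := chart_at X q in
  Num.sqrt (quad (gmat c (coord c q)) (F c (coord c q))).

(* Null sets of the Riemannian volume. *)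
Definition null_set A : Prop := forall c, lebesgue_null (coord_image c A).

Definition Linf_norm A (U : M -> R) : \bar R :=
  ereal_inf [set K%:E | K in
    [set K : R | 0 <= K /\ null_set (A `&` [set q | K < `|U q|])]].

Definition smooth_diffeo (D : set 'rV[R]_n) (phi : 'rV[R]_n -> M) : Prop :=
  [/\ open (phi @` D),
      forall x, D x -> {for x, continuous phi},
      forall c k, smooth (D `&` phi @^-1` dom c)
                         (fun x => coord c (phi x) ord0 k) &
      exists psi : M -> 'rV[R]_n,
        (forall x, D x -> psi (phi x) = x) /\
        forall c k, smooth (coord_image c (phi @` D))
                           (fun y => psi (coordV c y) ord0 k)].

Definition pullback_metric (phi : 'rV[R]_n -> M) (x : 'rV[R]_n) : 'M[R]_n :=
  let c := chart_at X (phi x) in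
  let J := \matrix_(i, k) partial i (fun y => coord c (phi y) ord0 k) x in
  J *m gmat c (coord c (phi x)) *m J^T.

Definition flatness (l : nat) (rad : R) (p : M) (phi : 'rV[R]_n -> M) : Prop :=
  [/\ smooth_diffeo (eball rad) phi,
      phi 0 = p,
      forall x v, eball rad x ->
        (1 - 100%:R^-1) * enorm2 v <= quad (pullback_metric phi x) v
          <= (1 + 100%:R^-1) * enorm2 v &
      forall (a : 'I_n -> nat) i j x, (1 <= \sum_k a k <= l)%N ->
        eball rad x ->
        rad ^+ (\sum_k a k)%N *
          `|mpartial a (fun y => pullback_metric phi y i j) x| <= 100%:R^-1].

End riemannian.

Arguments riemannian_manifold {R M n} X.
Arguments grad {R M n} X U c x.

(* The product metric g + dz^2, on M x R rather than M x (0, +oo), so that the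
   boundary point (p, 0) belongs to the space; the reflection z |-> |z| shows
   that the distance between points with z >= 0 is the same as in
   M x [0, +oo). *)
Definition cylinder (R : realType) (M : topologicalType) (n : nat)
    (X : riemann_data R M n) : riemann_data R (M * R)%type (n + 1) :=
  @RiemannData R (M * R)%type (n + 1) (chart X)
    (fun c => [set y | dom c y.1])
    (fun c y => row_mx (coord c y.1) (y.2)%:M)
    (fun c x => (coordV c (lsubmx x), rsubmx x ord0 ord0))
    (fun c x => block_mx (gmat c (lsubmx x)) 0 0 1%:M)
    (fun y => chart_at X y.1).

Definition half_ball (R : realType) (M : topologicalType) (n : nat)
    (X : riemann_data R M n) (r : R) (p : M) : set (M * R) :=
  [set y | 0 < y.2 /\ (rdist (cylinder X) y (p, 0%R) < r%:E)%E].

(* [u] is the boundary value of [U] on [A]: vertical limits at almost every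
   point. Both a continuous boundary value and the trace of a function of a
   weighted Sobolev space are traces in this sense. *)
Definition is_trace (R : realType) (M : topologicalType) (n : nat)
    (X : riemann_data R M n) (A : set M) (U : M * R -> R) (u : M -> R) : Prop :=
  null_set X (A `&` [set q | ~ (U (q, z) @[z --> 0^'+] --> u q)]).

(* Main.v *)
From HB Require Import structures.
Require Import Defs.
From mathcomp Require Import all_boot all_order all_algebra.
From mathcomp Require Import all_classical all_reals all_analysis.
From mathcomp Require Import finmap ring lra zify.

(* In the coordinates [phi], the function [U] solves an elliptic equation
   [a^ij U_ij + b^i U_i + U_zz + (1 - s) / z U_z = 0] whose coefficients are
   controlled by the flatness assumption (change of variables in the
   Laplace-Beltrami operator). Interior gradient bounds for bounded C^2
   solutions come from the doubling-of-variables method of Ishii and Lions,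
   which only needs the Lipschitz continuity of [a]; at height [z] they give
   [|grad U| <= C sup |U| / z]. The missing factor [z^s] comes from a barrier:
   [z^s] is a solution in the model case, and [z^s (2 - z^2)] plus a fifth power
   of the squared distance to a boundary point is a supersolution. The boundary
   values are only attained almost everywhere, vertically: at height
   [1 / (k + 1)], all points outside a union of few balls of that radius have
   [|U|] small (a measure argument on the upper limit of the bad cells), and the
   contribution of these balls is absorbed by Poisson-kernel barriers whose
   total mass is their number times [(k + 1)^-n], hence tends to 0. *)

Set Implicit Arguments.
Unset Strict Implicit.
Unset Printing Implicit Defensive.

Import Order.TTheory GRing.Theory Num.Theory.
Import numFieldNormedType.Exports.

Local Open Scope classical_set_scope.
Local Open Scope ring_scope.


(** * Quadratic forms *)

Section quadratic_forms.
Context {R : realType}.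

(** The solution is only C^2, so the equation cannot be differentiated as in Bernstein's method;
    hence the doubling of variables. The gradient bound is applied on balls of radius z/100, where
    the drift (1 - s)/z has exactly the size allowed by scaling, and every barrier is estimated
    uniformly in s. The estimate is therefore obtained with a constant free of s, and 1/s enters
    only through s < 2. The boundary values give no continuity up to z = 0, so the comparison takes
    place above the height d = 1/(k + 1) and is evaluated at a fixed point before k tends to
    infinity. A Poisson barrier has size at most a multiple of z^-n at height z, which yields the
    product of d^n and the number of balls. The radii are nested with room for a chart distortion
    below one percent: the unit half ball lies in |Y| <= 102/100 in coordinates, and |Y| < 119/100
    lies in the half ball of radius 6/5, on which the norm of the conclusion is taken. *)

Lemma enorm2_ge0 n (v : 'rV[R]_n) : 0 <= enorm2 v.
Proof. by apply: sumr_ge0 => i _; exact: sqr_ge0. Qed.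

Lemma enorm2E n (v : 'rV[R]_n) : enorm2 v = (v *m v^T) 0 0.
Proof. by rewrite mxE; apply: eq_bigr => i _; rewrite mxE expr2. Qed.

Lemma enorm2Z n (c : R) (v : 'rV[R]_n) : enorm2 (c *: v) = c ^+ 2 * enorm2 v.
Proof. by rewrite /enorm2 mulr_sumr; apply: eq_bigr => i _; rewrite mxE exprMn. Qed.

Lemma enorm2N n (v : 'rV[R]_n) : enorm2 (- v) = enorm2 v.
Proof. by rewrite -scaleN1r enorm2Z sqrrN expr1n mul1r. Qed.

Lemma enorm20 n : enorm2 (0 : 'rV[R]_n) = 0.
Proof. by rewrite /enorm2 big1 // => i _; rewrite mxE expr0n. Qed.

Lemma coord_le_enorm2 n (v : 'rV[R]_n) i : v 0 i ^+ 2 <= enorm2 v.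
Proof.
rewrite /enorm2 (bigD1 i)//= lerDl; apply: sumr_ge0 => j _; exact: sqr_ge0.
Qed.

Lemma enorm2_eq0 n (v : 'rV[R]_n) : enorm2 v = 0 -> v = 0.
Proof.
move=> v0; apply/rowP => i; rewrite mxE; apply/eqP; rewrite -sqrf_eq0.
by rewrite eq_le sqr_ge0 andbT -v0 coord_le_enorm2.
Qed.

Lemma enorm2_delta n (i : 'I_n) : enorm2 (delta_mx 0 i : 'rV[R]_n) = 1.
Proof.
rewrite /enorm2 (bigD1 i)//= big1 ?addr0 ?mxE ?eqxx ?expr1n// => j ji.
by rewrite mxE (negPf ji) andbF expr0n.
Qed.

Lemma enorm2_row_mx m n (u : 'rV[R]_m) (v : 'rV[R]_n) :
  enorm2 (row_mx u v) = enorm2 u + enorm2 v.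
Proof.
rewrite /enorm2 big_split_ord/=; congr (_ + _); apply: eq_bigr => i _;
by rewrite ?row_mxEl ?row_mxEr.
Qed.

Definition dot n (u v : 'rV[R]_n) : R := (u *m v^T) 0 0.

Lemma dotE n (u v : 'rV[R]_n) : dot u v = \sum_i u 0 i * v 0 i.
Proof. by rewrite /dot mxE; apply: eq_bigr => i _; rewrite mxE. Qed.

Lemma dotC n (u v : 'rV[R]_n) : dot u v = dot v u.
Proof. by rewrite !dotE; apply: eq_bigr => i _; rewrite mulrC. Qed.

Lemma dotDl n (u u' v : 'rV[R]_n) : dot (u + u') v = dot u v + dot u' v.
Proof. by rewrite /dot mulmxDl mxE. Qed.

Lemma dotZl n c (u v : 'rV[R]_n) : dot (c *: u) v = c * dot u v.
Proof. by rewrite /dot -scalemxAl mxE. Qed.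

Lemma dotZr n c (u v : 'rV[R]_n) : dot u (c *: v) = c * dot u v.
Proof. by rewrite dotC dotZl dotC. Qed.

Lemma dotDr n (u v v' : 'rV[R]_n) : dot u (v + v') = dot u v + dot u v'.
Proof. by rewrite dotC dotDl !(dotC u). Qed.

Lemma dotNl n (u v : 'rV[R]_n) : dot (- u) v = - dot u v.
Proof. by rewrite -scaleN1r dotZl mulN1r. Qed.

Lemma dotNr n (u v : 'rV[R]_n) : dot u (- v) = - dot u v.
Proof. by rewrite -scaleN1r dotZr mulN1r. Qed.

Lemma dotvv n (v : 'rV[R]_n) : dot v v = enorm2 v.
Proof. by rewrite enorm2E. Qed.

Lemma enorm2D n (u v : 'rV[R]_n) :
  enorm2 (u + v) = enorm2 u + 2 * dot u v + enorm2 v.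
Proof. by rewrite -!dotvv dotDl !dotDr (dotC v u); ring. Qed.

Lemma dot_sqr_le n (u v : 'rV[R]_n) : dot u v ^+ 2 <= enorm2 u * enorm2 v.
Proof.
have [/enorm2_eq0->|v0] := eqVneq (enorm2 v) 0.
  by rewrite /dot trmx0 mulmx0 mxE expr0n enorm20 mulr0.
have vp : 0 < enorm2 v by rewrite lt_neqAle eq_sym v0 enorm2_ge0.
have := enorm2_ge0 (u + (- (dot u v / enorm2 v)) *: v).
rewrite enorm2D dotZr enorm2Z => h.
have : 0 <= enorm2 v * (enorm2 u + 2 * (- (dot u v / enorm2 v) * dot u v) +
     (- (dot u v / enorm2 v)) ^+ 2 * enorm2 v) by rewrite mulr_ge0// ltW.
suff -> : enorm2 v * (enorm2 u + 2 * (- (dot u v / enorm2 v) * dot u v) +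
     (- (dot u v / enorm2 v)) ^+ 2 * enorm2 v) = enorm2 u * enorm2 v - dot u v ^+ 2.
  by rewrite subr_ge0.
by field.
Qed.

Definition enorm n (v : 'rV[R]_n) : R := Num.sqrt (enorm2 v).

Lemma enorm_ge0 n (v : 'rV[R]_n) : 0 <= enorm v.
Proof. exact: sqrtr_ge0. Qed.

Lemma sqr_enorm n (v : 'rV[R]_n) : enorm v ^+ 2 = enorm2 v.
Proof. by rewrite sqr_sqrtr// enorm2_ge0. Qed.

Lemma enorm_le n (v : 'rV[R]_n) c : 0 <= c -> (enorm v <= c) = (enorm2 v <= c ^+ 2).
Proof.
by move=> c0; rewrite -sqr_enorm ler_sqr ?nnegrE ?enorm_ge0.
Qed.

Lemma enorm_lt n (v : 'rV[R]_n) c : 0 <= c -> (enorm v < c) = (enorm2 v < c ^+ 2).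
Proof.
by move=> c0; rewrite -sqr_enorm ltr_sqr ?nnegrE ?enorm_ge0.
Qed.

Lemma normr_dot_le n (u v : 'rV[R]_n) : `|dot u v| <= enorm u * enorm v.
Proof.
rewrite -(@ler_pXn2r _ 2)// ?nnegrE ?normr_ge0 ?mulr_ge0 ?enorm_ge0//.
by rewrite real_normK ?num_real// exprMn !sqr_enorm dot_sqr_le.
Qed.

Lemma dot_le n (u v : 'rV[R]_n) : dot u v <= enorm u * enorm v.
Proof. exact: le_trans (ler_norm _) (normr_dot_le _ _). Qed.

Lemma enormD n (u v : 'rV[R]_n) : enorm (u + v) <= enorm u + enorm v.
Proof.
rewrite enorm_le ?addr_ge0 ?enorm_ge0// enorm2D sqrrD !sqr_enorm.
have := dot_le u v; lra.
Qed.

Lemma enormZ n c (v : 'rV[R]_n) : enorm (c *: v) = `|c| * enorm v.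
Proof. by rewrite /enorm enorm2Z sqrtrM ?sqr_ge0// sqrtr_sqr. Qed.

Lemma enormN n (v : 'rV[R]_n) : enorm (- v) = enorm v.
Proof. by rewrite /enorm enorm2N. Qed.

Lemma normr_coord_le n (v : 'rV[R]_n) i : `|v 0 i| <= enorm v.
Proof. by rewrite -sqrtr_sqr ler_wsqrtr// coord_le_enorm2. Qed.

Lemma quadE n (G : 'M[R]_n) (v : 'rV[R]_n) : quad G v = dot (v *m G) v.
Proof. by []. Qed.

Lemma quadD n (G H : 'M[R]_n) v : quad (G + H) v = quad G v + quad H v.
Proof. by rewrite /quad mulmxDr mulmxDl mxE. Qed.

Lemma quadN n (G : 'M[R]_n) v : quad (- G) v = - quad G v.
Proof. by rewrite /quad mulmxN mulNmx mxE. Qed.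

Lemma quadZ n c (G : 'M[R]_n) v : quad (c *: G) v = c * quad G v.
Proof. by rewrite /quad -scalemxAr -scalemxAl mxE. Qed.

Lemma quadZr n c (G : 'M[R]_n) v : quad G (c *: v) = c ^+ 2 * quad G v.
Proof. by rewrite !quadE -scalemxAl dotZl dotZr mulrA expr2. Qed.

Lemma quad_scalar n c (v : 'rV[R]_n) : quad c%:M v = c * enorm2 v.
Proof. by rewrite /quad mul_mx_scalar -scalemxAl mxE enorm2E. Qed.

Lemma quad_dyad n (e v : 'rV[R]_n) : quad (e^T *m e) v = dot v e ^+ 2.
Proof.
have -> : quad (e^T *m e) v = ((v *m e^T) *m (e *m v^T)) 0 0.
  by rewrite /quad !mulmxA.
by rewrite mxE big_ord1 -/(dot v e) -/(dot e v) dotC expr2.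
Qed.

Lemma dot_sym n (G : 'M[R]_n) u v : G^T = G -> dot (u *m G) v = dot (v *m G) u.
Proof.
by move=> Gs; rewrite /dot -[u *m G *m v^T]trmxK mxE 2!trmx_mul trmxK Gs mulmxA.
Qed.

Lemma quadDr n (G : 'M[R]_n) u v : G^T = G ->
  quad G (u + v) = quad G u + 2 * dot (u *m G) v + quad G v.
Proof.
move=> Gs; rewrite !quadE mulmxDl !(dotDl, dotDr) (dot_sym v u Gs); ring.
Qed.

Lemma quad_conj m n (J : 'M[R]_(m, n)) (G : 'M[R]_n) (v : 'rV[R]_m) :
  quad (J *m G *m J^T) v = quad G (v *m J).
Proof. by rewrite /quad trmx_mul !mulmxA. Qed.

Lemma quad_delta n (G : 'M[R]_n) i : quad G (delta_mx 0 i) = G i i.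
Proof.
by rewrite /quad trmx_delta -rowE -colE !mxE.
Qed.

Lemma trace_dyad n (v : 'rV[R]_n) (S : 'M[R]_n) : \tr (v^T *m v *m S) = quad S v.
Proof. by rewrite -mulmxA mxtrace_mulC /mxtrace big_ord1 /quad. Qed.

Lemma quad_row_mx m n (A : 'M[R]_m) (B : 'M[R]_(m, n)) C (D : 'M[R]_n) u v :
  quad (block_mx A B C D) (row_mx u v) =
  quad A u + dot (u *m B) v + dot (v *m C) u + quad D v.
Proof.
rewrite /quad mul_row_block tr_row_mx mul_row_col !mulmxDl !mxE /dot !mxE.
by rewrite !addrA; congr (_ + _); rewrite -!addrA; congr (_ + _); rewrite addrC.
Qed.

(* Cholesky factorization. *)
Lemma psd_sum_dyads n (P : 'M[R]_n) : P^T = P -> (forall v, 0 <= quad P v) ->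
  exists vs : seq 'rV[R]_n, P = \sum_(v <- vs) v^T *m v.
Proof.
elim: n P => [|n IHn] P Ps P0.
  by exists [::]; rewrite big_nil; apply/matrixP => -[].
have [a [b [D PE]]] : exists (a : R) (b : 'rV[R]_n) (D : 'M[R]_n),
    P = block_mx a%:M b b^T D :> 'M[R]_(1 + n).
  exists (ulsubmx (P : 'M[R]_(1 + n)) 0 0), (ursubmx (P : 'M[R]_(1 + n))),
    (drsubmx (P : 'M[R]_(1 + n))).
  rewrite -mx11_scalar trmx_ursub Ps.
  by rewrite submxK.
have Ds : D^T = D.
  have : (P : 'M[R]_(1 + n))^T = P by [].
  by rewrite PE tr_block_mx => /eq_block_mx [].
have qP (t : R) (w : 'rV[R]_n) : quad P (row_mx t%:M w : 'rV[R]_(1 + n)) =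
    a * t ^+ 2 + 2 * t * dot b w + quad D w.
  rewrite PE (@quad_row_mx 1 n) quad_scalar /enorm2 big_ord1 mxE eqxx mulr1n.
  rewrite mul_scalar_mx dotZl.
  have -> : dot (w *m b^T) t%:M = t * dot b w.
    rewrite /dot tr_scalar_mx mul_mx_scalar mxE; congr (_ * _).
    by rewrite -/(dot w b) dotC.
  by ring.
have a0 : 0 <= a.
  have := P0 (row_mx 1%:M 0 : 'rV[R]_(1 + n)).
  by rewrite qP quadE /dot trmx0 !mulmx0 mxE !mulr0 !addr0 expr1n mulr1.
have lift0E (ws : seq 'rV[R]_n) : \sum_(v <- map (fun w : 'rV[R]_n => row_mx (0 : 'rV[R]_1) w) ws) v^T *m v =
    block_mx 0 0 0 (\sum_(v <- ws) v^T *m v) :> 'M[R]_(1 + n).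
  elim: ws => [|w ws IH]; first by rewrite !big_nil; apply/esym/block_mx0.
  rewrite /= !big_cons IH tr_row_mx mul_col_row !trmx0 !mul0mx !mulmx0.
  by rewrite add_block_mx !addr0.
have [a00|an0] := eqVneq a 0.
  have b0 : b = 0.
    apply/rowP => j; rewrite mxE; apply/eqP; apply: contraT => bj.
    (* With a zero corner the form is affine in the first coordinate; this value of it makes the
       form equal to -1. *)
    have := P0 (row_mx (- ((D j j + 1) / (2 * b 0 j)))%:M (delta_mx 0 j) : 'rV[R]_(1 + n)).
    rewrite qP a00 quad_delta.
    have -> : dot b (delta_mx 0 j) = b 0 j.
      by rewrite /dot trmx_delta -colE mxE.
    suff -> : 0 * (- ((D j j + 1) / (2 * b 0 j))) ^+ 2 +
       2 * (- ((D j j + 1) / (2 * b 0 j))) * b 0 j + D j j = - 1 by rewrite oppr_ge0 ler10.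
    by field.
  have [ws Dws] := IHn D Ds (fun w => ltac:(have := P0 (row_mx 0%:M w : 'rV[R]_(1 + n));
     rewrite qP a00 expr0n mulr0n !mulr0 mul0r !add0r; exact)).
  exists (map (fun w : 'rV[R]_n => row_mx (0 : 'rV[R]_1) w) ws); rewrite lift0E -Dws PE a00 b0 trmx0.
  by rewrite raddf0.
have ap : 0 < a by rewrite lt_neqAle eq_sym an0.
(* The Schur complement: its value at [w] is the minimum of the form over the first coordinate,
   hence nonnegative. *)
pose D' := D - a^-1 *: (b^T *m b).
have D's : D'^T = D' by rewrite /D' linearB /= linearZ /= trmx_mul trmxK Ds.
have [w|ws Dws] := IHn D' D's.
  have := P0 (row_mx (- (a^-1 * dot b w))%:M w : 'rV[R]_(1 + n)).
  rewrite qP /D' quadD quadN quadZ quad_dyad (dotC w b).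
  suff -> : a * (- (a^-1 * dot b w)) ^+ 2 + 2 * (- (a^-1 * dot b w)) * dot b w +
   quad D w = quad D w - a^-1 * dot b w ^+ 2 by [].
  by field.
have sa : Num.sqrt a != 0 by rewrite sqrtr_eq0 -ltNge.
have saa : Num.sqrt a * Num.sqrt a = a by rewrite -expr2 sqr_sqrtr.
exists (row_mx (Num.sqrt a)%:M ((Num.sqrt a)^-1 *: b) :: map (fun w : 'rV[R]_n => row_mx (0 : 'rV[R]_1) w) ws).
have dy (t : R) (w : 'rV[R]_n) :
    (row_mx t%:M w : 'rV[R]_(1 + n))^T *m row_mx t%:M w =
    block_mx (t * t)%:M (t *: w) (t *: w^T) (w^T *m w).
  rewrite tr_row_mx mul_col_row tr_scalar_mx -scalar_mxM mul_scalar_mx.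
  by rewrite mul_mx_scalar.
rewrite big_cons lift0E -Dws PE dy (@add_block_mx _ 1 n 1 n) !addr0.
have trZ : ((Num.sqrt a)^-1 *: b)^T = (Num.sqrt a)^-1 *: b^T by rewrite linearZ.
rewrite saa trZ !scalerA mulfV// !scale1r -scalemxAl -scalemxAr scalerA.
by rewrite -invfM saa /D' [a^-1 *: _ + _]addrC subrK.
Qed.

(** Both sides are linear in [P], and against a dyad [v^T v] the trace is the value of the form [S]
    at [v]. This does the work of a diagonalization. *)
Lemma psd_trace_le n (P S : 'M[R]_n) c : P^T = P -> (forall v, 0 <= quad P v) ->
  (forall v, quad S v <= c * enorm2 v) -> \tr (P *m S) <= c * \tr P.
Proof.
move=> Ps P0 Sc; have [vs ->] := psd_sum_dyads Ps P0.
rewrite mulmx_suml !raddf_sum /= mulr_sumr; apply: ler_sum => v _.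
rewrite trace_dyad; apply: le_trans (Sc v) _.
by rewrite -[v^T *m v]mulmx1 trace_dyad quad_scalar mul1r.
Qed.

Lemma quad_trace_bounds n (P : 'M[R]_n) lo hi :
  (forall v, lo * enorm2 v <= quad P v <= hi * enorm2 v) ->
  n%:R * lo <= \tr P <= n%:R * hi.
Proof.
move=> h; have cst c : n%:R * c = \sum_(i < n) c by rewrite sumr_const card_ord mulr_natl.
rewrite /mxtrace !cst; apply/andP; split; apply: ler_sum => i _; have := h (delta_mx 0 i);
by rewrite quad_delta enorm2_delta !mulr1 => /andP[].
Qed.

(** Polarization on the sum of two basis vectors. *)
Lemma quad_entry_le n (P : 'M[R]_n) c : P^T = P ->
  (forall v, `|quad P v| <= c * enorm2 v) -> forall i j, `|P i j| <= 2 * c.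
Proof.
move=> Ps Pc i j.
have c0 : 0 <= c by have := Pc (delta_mx 0 i); rewrite enorm2_delta mulr1; apply: le_trans.
have [<-|ij] := eqVneq i j.
  have := Pc (delta_mx 0 i); rewrite enorm2_delta quad_delta; lra.
have h1 := Pc (delta_mx 0 i + delta_mx 0 j).
have hi := Pc (delta_mx 0 i); have hj := Pc (delta_mx 0 j).
move: h1 hi hj; rewrite quadDr// enorm2D !enorm2_delta !quad_delta.
have -> : dot (delta_mx 0 i *m P) (delta_mx 0 j) = P i j.
  by rewrite /dot trmx_delta -rowE -colE !mxE.
have -> : dot (delta_mx 0 i) (delta_mx 0 j) = (i == j)%:R :> R.
  by rewrite /dot trmx_delta -colE !mxE eqxx /= eq_sym.
rewrite !ler_norml => /andP[a1 a2] /andP[b1 b2] /andP[c1 c2].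
by rewrite (negPf ij) /= in a1 a2; apply/andP; split; lra.
Qed.

Lemma quad_sum n (G : 'M[R]_n) v : quad G v = \sum_i \sum_j v 0 i * G i j * v 0 j.
Proof.
rewrite quadE dotE exchange_big /=; apply: eq_bigr => j _.
by rewrite mxE mulr_suml.
Qed.

Lemma pos_unitmx n (G : 'M[R]_n) : (forall v, v != 0 -> 0 < quad G v) ->
  G \in unitmx.
Proof.
move=> G0; rewrite -row_free_unit -kermx_eq0; apply: contraT => /rowV0Pn [v].
rewrite sub_kermx => /eqP vG v0; have := G0 v v0.
by rewrite /quad vG mul0mx mxE ltxx.
Qed.

Lemma invmx_sym n (G : 'M[R]_n) : G^T = G -> (invmx G)^T = invmx G.
Proof. by move=> Gs; rewrite trmx_inv Gs. Qed.

Lemma quad_invmx n (G : 'M[R]_n) v : G \in unitmx -> G^T = G ->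
  quad (invmx G) v = quad G (v *m invmx G).
Proof.
move=> Gu Gs; rewrite /quad trmx_mul invmx_sym// -!mulmxA.
by rewrite (mulmxA G) mulmxV// mul1mx.
Qed.

(** Squares are completed in place of an eigenvalue argument: for [w = v G^-1], the lower bound
    comes from [quad G (w - v / hi) >= 0] and the upper one from [|w - v / lo|^2 >= 0]. *)
Lemma quad_invmx_bounds n (G : 'M[R]_n) lo hi : G^T = G -> 0 < lo -> 0 < hi ->
  (forall v, lo * enorm2 v <= quad G v <= hi * enorm2 v) ->
  G \in unitmx /\
  (forall v, hi^-1 * enorm2 v <= quad (invmx G) v <= lo^-1 * enorm2 v).
Proof.
move=> Gs lo0 hi0 Gb.
have Gu : G \in unitmx.
  apply: pos_unitmx => v v0; apply: lt_le_trans (proj1 (andP (Gb v))).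
  rewrite mulr_gt0// lt_neqAle enorm2_ge0 andbT eq_sym.
  by apply: contra_neq v0 => /enorm2_eq0.
split=> // v; set w := v *m invmx G.
have cE : quad (invmx G) v = dot w v by rewrite quadE.
have wG : w *m G = v by rewrite /w -mulmxA mulVmx// mulmx1.
have cG : dot w v = quad G w by rewrite quadE wG dotC.
rewrite cE; apply/andP; split.
  have := proj2 (andP (Gb (hi^-1 *: v))); rewrite quadZr enorm2Z => h1.
  have Gp u : 0 <= quad G u.
    by apply: le_trans (proj1 (andP (Gb u))); rewrite mulr_ge0 ?enorm2_ge0// ltW.
  have := Gp (w + (- hi^-1) *: v); rewrite quadDr// wG dotZr dotvv -cG quadZr sqrrN.
  have h3 : hi * (hi^-1 ^+ 2 * enorm2 v) = hi^-1 * enorm2 v.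
    by field; rewrite gt_eqF.
  lra.
have := enorm2_ge0 (w + (- lo^-1) *: v); rewrite enorm2D dotZr enorm2Z sqrrN => h.
have := proj1 (andP (Gb w)); rewrite -cG => h2.
have h3 : 0 <= lo * (enorm2 w + 2 * (- lo^-1 * dot w v) + lo^-1 ^+ 2 * enorm2 v).
  by rewrite mulr_ge0// ltW.
have h4 : lo * (enorm2 w + 2 * (- lo^-1 * dot w v) + lo^-1 ^+ 2 * enorm2 v) =
  lo * enorm2 w - 2 * dot w v + lo^-1 * enorm2 v by field; rewrite gt_eqF.
lra.
Qed.

End quadratic_forms.

(** * Calculus in several variables *)

Lemma cvg_sumr (R : realType) (T : Type) (F : set_system T) (FF : Filter F)
    (I : finType) (f : I -> T -> R) (a : I -> R) :
  (forall i, f i x @[x --> F] --> a i) ->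
  \sum_i f i x @[x --> F] --> \sum_i a i.
Proof.
by move=> fa; apply: cvg_big => //; exact: add_continuous.
Qed.

Section linear_form.
Context {R : realType} {n : nat}.

Definition lform (g : 'cV[R]_n) (h : 'rV[R]_n) : R := (h *m g) 0 0.

Fact lform_is_linear g : linear (lform g).
Proof. by move=> a u v; rewrite /lform mulmxDl -scalemxAl !mxE. Qed.

HB.instance Definition _ g :=
  GRing.isLinear.Build R 'rV[R]_n R _ (lform g) (lform_is_linear g).

Lemma lform_continuous g : continuous (lform g).
Proof.
move=> x; rewrite /lform; under eq_fun do rewrite mxE.
apply: (@cvg_sumr R _ (nbhs x) _) => i; apply: cvgM; last exact: cvg_cst.
exact: coord_continuous.
Qed.

End linear_form.

Section calculus1.
Context {R : realType}.

Lemma normr_coord_le_norm m n (v : 'M[R]_(m, n)) i j : `|v i j| <= `|v|.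
Proof. by rewrite [leRHS]/Num.Def.normr/= mx_normrE; exact: (le_bigmax _ _ (i, j)). Qed.

Lemma mx_norm_le m n (v : 'M[R]_(m, n)) c : 0 <= c ->
  (forall i j, `|v i j| <= c) -> `|v| <= c.
Proof.
move=> c0 h; rewrite [leLHS]/Num.Def.normr/= mx_normrE.
by apply: bigmax_le => // -[i j] _; exact: h.
Qed.

Lemma is_derive_line n (f : 'rV[R]_n -> R) y v t d :
  is_derive (y + t *: v) v f d -> is_derive t 1 (fun t => f (y + t *: v)) d.
Proof.
case=> df dE.
have E : (fun h : R => h^-1 *: (((fun t => f (y + t *: v)) \o shift t) (h *: 1)
     - f (y + t *: v))) =
   (fun h : R => h^-1 *: ((f \o shift (y + t *: v)) (h *: v) - f (y + t *: v))).
  apply/funext => h /=; congr (_ *: (f _ - _)).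
  by rewrite [h *: 1]mulr1 scalerDl addrCA.
by split; rewrite /derivable /derive E.
Qed.

Lemma MVT_centered (f df : R -> R) (c : R) :
  (forall t : R, `|t| <= `|c| -> is_derive t 1 f (df t)) ->
  exists2 t, `|t| <= `|c| & f c - f 0 = df t * c.
Proof.
move=> h.
have cont a b : (forall t : R, t \in `[a, b]%R -> `|t| <= `|c|) ->
    {within `[a, b], continuous f}.
  move=> ab; apply: derivable_within_continuous => t /ab /h dft.
  exact: ex_derive.
have [c0|c0] := leP 0 c.
  have ab t : t \in `[0, c]%R -> `|t| <= `|c|.
    by rewrite in_itv/= => /andP[? ?]; rewrite !ger0_norm.
  have [t tc E] := @MVT_segment R f df 0 c c0 (fun t ht => h t (ab t
    (subset_itv_oo_cc ht))) (cont _ _ ab).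
  by exists t; [exact: ab|rewrite E subr0].
have ab t : t \in `[c, 0]%R -> `|t| <= `|c|.
  by rewrite in_itv/= => /andP[? ?]; rewrite !ler0_norm ?lerN2// ltW.
have [t tc E] := @MVT_segment R f df c 0 (ltW c0) (fun t ht => h t (ab t
    (subset_itv_oo_cc ht))) (cont _ _ ab).
exists t; [exact: ab|].
by rewrite -opprB E sub0r mulrN opprK.
Qed.

Lemma nbhs_norm_ball n (D : set 'rV[R]_n) (x : 'rV[R]_n) : nbhs x D ->
  exists2 r : R, 0 < r & forall y : 'rV[R]_n, `|y - x| < r -> D y.
Proof.
move=> /nbhs_ballP[r r0 h]; exists r => // y yx; apply: h.
by rewrite -ball_normE /= distrC.
Qed.

(** The increment [h] is travelled along the coordinate axes, with the mean value theorem on each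
    edge. The truncations [w k] of [h] stay in the sup-norm ball of radius [|h|], where the partial
    derivatives are close to those at [x]. *)
Lemma C1_differentiable n (D : set 'rV[R]_n) (f : 'rV[R]_n -> R) (x : 'rV[R]_n) :
  nbhs x D -> (forall y i, D y -> derivable f y (delta_mx 0 i)) ->
  (forall i, {for x, continuous (partial i f)}) -> differentiable f x.
Proof.
move=> Dx fd fc.
pose g : 'cV[R]_n := \col_i partial i f x.
suff H : f \o shift x = cst (f x) + (lform g : {linear 'rV[R]_n -> R}) +o_ (0 : 'rV[R]_n) id.
  apply/diff_locallyP; rewrite (diff_unique (@lform_continuous R n g) H).
  by split=> //; exact: lform_continuous.
apply/eqaddoP => e e0.
have [r r0 rD] := nbhs_norm_ball Dx.
pose e' := e / (n.+1)%:R.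
have e'0 : 0 < e' by rewrite divr_gt0.
have /nbhs_norm_ball[s s0 sc] : nbhs x [set y | forall i : 'I_n,
    `|partial i f x - partial i f y| < e'].
  apply: (@filter_forall _ _ (fun (i : 'I_n) y => `|partial i f x - partial i f y| < e') (nbhs x) _) => i.
  by have /cvgrPdist_lt := fc i; exact.
have near0 (c : R) : 0 < c -> nbhs (0 : 'rV[R]_n) [set y | `|y| < c].
  move=> c0; apply/nbhs_ballP; exists c => //= y.
  by rewrite -ball_normE /= sub0r normrN.
near=> h.
have hr : `|h| < r by near: h; exact: near0.
have hs : `|h| < s by near: h; exact: near0.
pose w (k : nat) : 'rV[R]_n := \row_i (if (i < k)%N then h 0 i else 0).
have wh (k : nat) : (k <= n)%N -> forall t : R, forall i : 'I_n, `|t| <= `|h 0 i| ->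
    i = k :> nat -> `|w k + t *: delta_mx 0 i| <= `|h|.
  move=> kn t i ti ik; apply: mx_norm_le => // a j; rewrite ord1 !mxE.
  have [->|ji] := eqVneq j i.
    by rewrite ik ltnn add0r mulr1 (le_trans ti)// normr_coord_le_norm.
  by rewrite mulr0 addr0; case: ifP => _; rewrite ?normr0// normr_coord_le_norm.
have wS (i : 'I_n) : w i.+1 = w i + h 0 i *: delta_mx 0 i.
  apply/rowP => j; rewrite !mxE ltnS leq_eqVlt.
  have [->|ji] := eqVneq j i; first by rewrite eqxx ltnn add0r mulr1.
  by rewrite mulr0 addr0; move: ji; rewrite -val_eqE => /negPf ->.
have step (i : 'I_n) : `|f (x + w i.+1) - f (x + w i) - h 0 i * partial i f x|
    <= e' * `|h|.
  have [|t th E] := @MVT_centered (fun t => f (x + w i + t *: delta_mx 0 i))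
     (fun t => partial i f (x + w i + t *: delta_mx 0 i)) (h 0 i).
    move=> t th; apply: is_derive_line; apply: derivableP; apply: fd.
    apply: rD; rewrite addrC !addrA addNr add0r.
    by apply: le_lt_trans hr; apply: wh => //; exact: ltnW.
  rewrite wS addrA; move: E; rewrite scale0r addr0 => ->.
  rewrite mulrC -mulrBr normrM mulrC ler_pM// ?normr_coord_le_norm//.
  rewrite distrC ltW//; apply: sc; rewrite addrC !addrA addNr add0r.
  by apply: le_lt_trans hs; apply: wh => //; exact: ltnW.
have wn : w n = h by apply/rowP => j; rewrite mxE ltn_ord.
have w0 : w 0 = 0 by apply/rowP => j; rewrite !mxE.
have tel : f (x + h) - f x = \sum_(i < n) (f (x + w i.+1) - f (x + w i)).
  by rewrite -(big_mkord xpredT (fun i => f (x + w i.+1) - f (x + w i)))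
    telescope_sumr// wn w0 addr0.
have -> : (f \o shift x - (cst (f x) + lform g)) h =
   \sum_(i < n) (f (x + w i.+1) - f (x + w i) - h 0 i * partial i f x).
  have lE : lform g h = \sum_i h 0 i * partial i f x.
    by rewrite /lform mxE; apply: eq_bigr => i _; rewrite mxE.
  by rewrite big_split /= -tel sumrN -lE [x + h]addrC !fctE /= opprD addrA.
apply: le_trans (ler_norm_sum _ _ _) _.
apply: (@le_trans _ _ (\sum_(i < n) e' * `|h|)); first by apply: ler_sum => i _.
rewrite sumr_const card_ord -mulr_natl mulrA ler_wpM2r// /e' mulrCA ger_pMr//.
by rewrite ler_pdivrMr ?mul1r ?ler_nat// ltr0n.
Unshelve. all: by end_near. Qed.

End calculus1.

Section C1_functions.
Context {R : realType}.

(** Full differentiability is included so that the chain rule applies directly; on open sets it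
    follows from the continuous partial derivatives of [Ck]. *)
Definition C1on n (D : set 'rV[R]_n) (f : 'rV[R]_n -> R) : Prop :=
  forall x, D x -> differentiable f x /\
    forall i, {for x, continuous (partial i f)}.

Definition C2on n (D : set 'rV[R]_n) (f : 'rV[R]_n -> R) : Prop :=
  C1on D f /\ forall i, C1on D (partial i f).

Definition hess n (f : 'rV[R]_n -> R) (x : 'rV[R]_n) : 'M[R]_n :=
  \matrix_(i, j) partial j (partial i f) x.

Lemma Ck_C1on n k (D E : set 'rV[R]_n) (f : 'rV[R]_n -> R) :
  open E -> E `<=` D -> Ck k.+1 D f -> C1on E f.
Proof.
move=> oE ED [fc fd fp] x Ex.
have fpc i : {for x, continuous (partial i f)}.
  by have := fp i; case: (k) => [|k']; [|case]; move=> /(_ x (ED _ Ex)).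
split=> //; apply: (@C1_differentiable R n E) => //.
  by apply: open_nbhs_nbhs; split.
by move=> y i Ey; apply: fd; exact: ED.
Qed.

Lemma Ck_partial n k (D : set 'rV[R]_n) (f : 'rV[R]_n -> R) i :
  Ck k.+1 D f -> Ck k D (partial i f).
Proof. by move=> [_ _]; exact. Qed.

Lemma Ck_C2on n (D E : set 'rV[R]_n) (f : 'rV[R]_n -> R) :
  open E -> E `<=` D -> Ck 2 D f -> C2on E f.
Proof.
move=> oE ED f2; split; first exact: Ck_C1on f2.
by move=> i; apply: (Ck_C1on oE ED); exact: Ck_partial f2.
Qed.

Lemma smooth_C2on n (D E : set 'rV[R]_n) (f : 'rV[R]_n -> R) :
  open E -> E `<=` D -> smooth D f -> C2on E f.
Proof. by move=> oE ED /(_ 2%N); exact: Ck_C2on. Qed.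

Lemma C1on_sub n (D E : set 'rV[R]_n) (f : 'rV[R]_n -> R) :
  E `<=` D -> C1on D f -> C1on E f.
Proof. by move=> ED f1 x /ED; exact: f1. Qed.

Lemma C2on_sub n (D E : set 'rV[R]_n) (f : 'rV[R]_n -> R) :
  E `<=` D -> C2on D f -> C2on E f.
Proof. by move=> ED [f1 f2]; split=> [|i]; apply: C1on_sub ED _. Qed.

Lemma derive_partials n (f : 'rV[R]_n -> R) x v : differentiable f x ->
  'D_v f x = \sum_i v 0 i * partial i f x.
Proof.
move=> df; rewrite deriveE// {1}[v]row_sum_delta linear_sum /=.
by apply: eq_bigr => i _; rewrite linearZ /= /partial deriveE.
Qed.

Lemma is_derive_partials n (f : 'rV[R]_n -> R) y v t : differentiable f (y + t *: v) ->
  is_derive t 1 (fun t => f (y + t *: v)) (\sum_i v 0 i * partial i f (y + t *: v)).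
Proof.
move=> df; apply: is_derive_line; rewrite -derive_partials//.
by apply: derivableP; exact: diff_derivable.
Qed.

Lemma is_derive_sumr (I : finType) (h : I -> R -> R) (x : R) (dh : I -> R) :
  (forall i, is_derive x 1 (h i) (dh i)) ->
  is_derive x 1 (fun t => \sum_i h i t) (\sum_i dh i).
Proof.
move=> hd; rewrite -fct_sumE.
elim/big_ind2: _ => [|f df g dg ? ?|i _] //; first exact: is_derive_cst.
by apply: is_deriveD.
Qed.

Lemma is_derive_hess n (D : set 'rV[R]_n) (f : 'rV[R]_n -> R) y v t :
  C2on D f -> D (y + t *: v) ->
  is_derive t 1 (fun t => \sum_i v 0 i * partial i f (y + t *: v))
    (quad (hess f (y + t *: v)) v).
Proof.
move=> [f1 f2] Dy; rewrite quad_sum.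
apply: is_derive_sumr => i.
have /(_ _ Dy)[d _] := f2 i.
have H : is_derive t 1 (fun t => v 0 i * partial i f (y + t *: v))
    (v 0 i * \sum_j v 0 j * partial j (partial i f) (y + t *: v)).
  exact: (@is_deriveZ _ _ _ _ (v 0 i) _ _ _ (is_derive_partials d)).
apply: (is_derive_eq H); rewrite mulr_sumr.
by apply: eq_bigr => j _; rewrite mxE; ring.
Qed.

Lemma partial_ext n (D : set 'rV[R]_n) (f g : 'rV[R]_n -> R) i x :
  open D -> (forall y, D y -> f y = g y) -> D x -> partial i f x = partial i g x.
Proof.
move=> oD fg Dx; apply: near_eq_derive.
by near=> y; apply: fg; near: y; apply: open_nbhs_nbhs.
Unshelve. all: by end_near. Qed.

Lemma differentiable_ext n (D : set 'rV[R]_n) (f g : 'rV[R]_n -> R) x :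
  open D -> (forall y, D y -> f y = g y) -> D x ->
  differentiable f x -> differentiable g x.
Proof.
move=> oD fg Dx df.
have H : g \o shift x = cst (g x) + 'd f x +o_ (0 : 'rV[R]_n) id.
  apply/eqaddoP => e e0.
  have nD : \forall h \near (0 : 'rV[R]_n), D (h + x).
    have : \forall y \near x, D y by apply: open_nbhs_nbhs.
    by rewrite (near_shift 0 x) subr0.
  have /eqaddoP/(_ e e0) := diff_locally df.
  apply: filterS2 nD => h Dh; rewrite !fctE /= fg//.
  by rewrite fg.
apply/diff_locallyP; rewrite (diff_unique (diff_continuous df) H).
by split=> //; exact: diff_continuous.
Qed.

Lemma continuous_ext n (D : set 'rV[R]_n) (f g : 'rV[R]_n -> R) x :
  open D -> (forall y, D y -> f y = g y) -> D x ->
  {for x, continuous f} -> {for x, continuous g}.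
Proof.
move=> oD fg Dx; rewrite /prop_for /continuous_at -(fg x)// => fc.
apply: cvg_trans fc; apply: (@near_eq_cvg _ _ (nbhs x) (nbhs_filter x)).
have nD : \forall y \near x, D y by apply: open_nbhs_nbhs.
by apply: filterS nD => y /fg.
Qed.

Lemma C1on_ext n (D : set 'rV[R]_n) (f g : 'rV[R]_n -> R) :
  open D -> (forall y, D y -> f y = g y) -> C1on D f -> C1on D g.
Proof.
move=> oD fg f1 x Dx; have [df cf] := f1 x Dx; split.
  exact: differentiable_ext fg Dx df.
move=> i; apply: (continuous_ext oD _ Dx (cf i)) => y Dy.
exact: partial_ext fg Dy.
Qed.

Lemma C1on_cst n (D : set 'rV[R]_n) c : C1on D (fun _ => c).
Proof.
move=> x Dx; split; first exact: differentiable_cst.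
move=> i; rewrite (_ : partial i _ = cst 0); first exact: cst_continuous.
by apply/funext => y; rewrite /partial derive_cst.
Qed.

Lemma C1on_continuous n (D : set 'rV[R]_n) f x : C1on D f -> D x ->
  {for x, continuous f}.
Proof. by move=> /[apply] -[/differentiable_continuous]. Qed.

Lemma C1on_add n (D : set 'rV[R]_n) (f g : 'rV[R]_n -> R) : open D -> C1on D f -> C1on D g ->
  C1on D (fun x => f x + g x).
Proof.
move=> oD f1 g1 x Dx.
have pE i y : D y -> partial i f y + partial i g y = partial i (f \+ g) y.
  move=> Dy; rewrite /partial deriveD//; apply: diff_derivable.
    by have [] := f1 _ Dy.
  by have [] := g1 _ Dy.
have [df cf] := f1 _ Dx; have [dg cg] := g1 _ Dx.
split; first exact: differentiableD.
move=> i; apply: (continuous_ext oD (pE i) Dx).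
by apply: continuousD; [exact: cf|exact: cg].
Qed.

Lemma C1on_mul n (D : set 'rV[R]_n) (f g : 'rV[R]_n -> R) : open D -> C1on D f -> C1on D g ->
  C1on D (fun x => f x * g x).
Proof.
move=> oD f1 g1 x Dx.
have pE i y : D y -> f y * partial i g y + g y * partial i f y =
    partial i (f * g) y.
  move=> Dy; rewrite /partial deriveM//; apply: diff_derivable.
    by have [] := f1 _ Dy.
  by have [] := g1 _ Dy.
have [df cf] := f1 _ Dx; have [dg cg] := g1 _ Dx.
split; first exact: differentiableM.
move=> i; apply: (continuous_ext oD (pE i) Dx).
apply: continuousD; apply: continuousM => //;
  solve [exact: cf|exact: cg|exact: differentiable_continuous].
Qed.

Lemma partialM n (f g : 'rV[R]_n -> R) (x : 'rV[R]_n) i : differentiable f x -> differentiable g x ->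
  partial i (fun x => f x * g x) x = f x * partial i g x + g x * partial i f x.
Proof. by move=> df dg; rewrite /partial deriveM//; exact: diff_derivable. Qed.

Lemma partialD n (f g : 'rV[R]_n -> R) (x : 'rV[R]_n) i : differentiable f x -> differentiable g x ->
  partial i (fun x => f x + g x) x = partial i f x + partial i g x.
Proof. by move=> df dg; rewrite /partial deriveD//; exact: diff_derivable. Qed.

Lemma differentiable_sumr n (I : finType) (f : I -> 'rV[R]_n -> R) (x : 'rV[R]_n) :
  (forall k, differentiable (f k) x) -> differentiable (fun x => \sum_k f k x) x.
Proof.
move=> fd; rewrite -fct_sumE.
apply: (big_ind (fun h : 'rV[R]_n -> R => differentiable h x)) => //.
by move=> *; apply: differentiableD.
Qed.

Lemma partial_sum n (I : finType) (f : I -> 'rV[R]_n -> R) (x : 'rV[R]_n) i :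
  (forall k, differentiable (f k) x) ->
  partial i (fun x => \sum_k f k x) x = \sum_k partial i (f k) x.
Proof.
move=> fd; rewrite -fct_sumE.
suff [] : differentiable (\sum_k f k) x /\
    partial i (\sum_k f k) x = \sum_k partial i (f k) x by [].
apply: (big_ind2 (fun (h : 'rV[R]_n -> R) dh => differentiable h x /\
    partial i h x = dh)) => [|g dg h dh [? <-] [? <-]|k _] //.
  by split; [exact: (@differentiable_cst R 'rV[R]_n R 0 x)|exact: derive_cst].
by split; [exact: differentiableD|exact: partialD].
Qed.

Lemma C1on_sum n (I : finType) (D : set 'rV[R]_n) (f : I -> 'rV[R]_n -> R) :
  open D -> (forall k, C1on D (f k)) -> C1on D (fun x => \sum_k f k x).
Proof.
move=> oD f1; rewrite -fct_sumE.
apply: (big_ind (C1on D)) => //; first exact: C1on_cst.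
by move=> *; apply: C1on_add.
Qed.

End C1_functions.

(** * Chain rule, symmetry of second derivatives, conditions at a maximum *)

Section chain_rule.
Context {R : realType}.

Lemma differentiable_rV n m (h : 'rV[R]_n -> 'rV[R]_m) (x : 'rV[R]_n) :
  (forall k, differentiable (fun y => h y 0 k) x) -> differentiable h x.
Proof.
move=> hd.
have -> : h = (fun y => \sum_k h y 0 k *: (delta_mx 0 k : 'rV[R]_m)).
  by apply/funext => y; exact: row_sum_delta.
rewrite -fct_sumE; apply: (big_ind (fun h => differentiable h x)).
- exact: (@differentiable_cst R 'rV[R]_n 'rV[R]_m 0 x).
- by move=> *; apply: differentiableD.
- by move=> k _; apply: differentiableZl.
Qed.

Lemma derive_coord n m (h : 'rV[R]_n -> 'rV[R]_m) (x v : 'rV[R]_n) k :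
  differentiable h x -> ('D_v h x) 0 k = 'D_v (fun y => h y 0 k) x.
Proof. by move=> hd; rewrite derive_mx ?mxE//; exact: diff_derivable. Qed.

Lemma derive_comp_partials n m (h : 'rV[R]_n -> 'rV[R]_m) (f : 'rV[R]_m -> R)
    (x v : 'rV[R]_n) :
  (forall k, differentiable (fun y => h y 0 k) x) -> differentiable f (h x) ->
  'D_v (f \o h) x = \sum_k 'D_v (fun y => h y 0 k) x * partial k f (h x).
Proof.
move=> hd fd; have hd' := differentiable_rV hd.
rewrite deriveE; last exact: differentiable_comp.
rewrite diff_comp//= -!deriveE// derive_partials//.
by apply: eq_bigr => k _; rewrite derive_coord.
Qed.

Lemma partial_comp n m (h : 'rV[R]_n -> 'rV[R]_m) (f : 'rV[R]_m -> R)
    (x : 'rV[R]_n) i :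
  (forall k, differentiable (fun y => h y 0 k) x) -> differentiable f (h x) ->
  partial i (f \o h) x = \sum_k partial i (fun y => h y 0 k) x * partial k f (h x).
Proof. exact: derive_comp_partials. Qed.

Lemma continuous_rV (T : topologicalType) m (h : T -> 'rV[R]_m) (x : T) :
  (forall k, {for x, continuous (fun y => h y 0 k)}) -> {for x, continuous h}.
Proof.
move=> hc; apply/cvgrPdist_lt => e e0.
have : \forall y \near x, forall k : 'I_m, `|h x 0 k - h y 0 k| < e / 2.
  apply: (@filter_forall _ _ (fun (k : 'I_m) y => `|h x 0 k - h y 0 k| < e / 2)
    (nbhs x) _) => k.
  by have /cvgrPdist_lt := hc k; apply; rewrite divr_gt0.
apply: filterS => y hy; apply: (@le_lt_trans _ _ (e / 2)); last lra.
apply: mx_norm_le => [|i j]; first lra.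
by rewrite ord1 !mxE ltW.
Qed.

Lemma continuous_sumr (T : topologicalType) (I : finType) (f : I -> T -> R) (x : T) :
  (forall k, {for x, continuous (f k)}) ->
  {for x, continuous (fun y => \sum_k f k y)}.
Proof. by move=> fc; apply: (@cvg_sumr R _ (nbhs x) _) => k; exact: fc. Qed.

Lemma C1on_comp n m (D : set 'rV[R]_n) (E : set 'rV[R]_m)
    (h : 'rV[R]_n -> 'rV[R]_m) (f : 'rV[R]_m -> R) :
  open D -> (forall x, D x -> E (h x)) -> (forall k, C1on D (fun y => h y 0 k)) ->
  C1on E f -> C1on D (f \o h).
Proof.
move=> oD DE h1 f1 x Dx.
have hd y : D y -> forall k, differentiable (fun y => h y 0 k) y.
  by move=> Dy k; have [] := h1 k y Dy.
have fd y : D y -> differentiable f (h y) by move=> /DE/f1[].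
split; first by apply: differentiable_comp; [exact/differentiable_rV/hd|exact: fd].
move=> i; have pE y (Dy : D y) := esym (partial_comp i (hd y Dy) (fd y Dy)).
apply: (continuous_ext oD pE Dx); apply: continuous_sumr => k.
apply: continuousM; first by have [_] := h1 k x Dx; apply.
apply: continuous_comp; first exact/differentiable_continuous/differentiable_rV/hd.
by have [_] := f1 _ (DE _ Dx); apply.
Qed.

Lemma C2on_comp n m (D : set 'rV[R]_n) (E : set 'rV[R]_m)
    (h : 'rV[R]_n -> 'rV[R]_m) (f : 'rV[R]_m -> R) :
  open D -> (forall x, D x -> E (h x)) -> (forall k, C2on D (fun y => h y 0 k)) ->
  C2on E f -> C2on D (f \o h).
Proof.
move=> oD DE h2 [f1 f2].
have h1 k : C1on D (fun y => h y 0 k) by have [] := h2 k.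
split; first exact: C1on_comp f1.
move=> i; apply: (@C1on_ext R n D (fun x => \sum_k partial i (fun y => h y 0 k) x *
   (partial k f \o h) x)) => // [y Dy|].
  rewrite partial_comp//; last by have [] := f1 _ (DE _ Dy).
  by move=> k; have [] := h1 k y Dy.
apply: C1on_sum => // k; apply: C1on_mul => //; first by have [_] := h2 k.
exact: C1on_comp (f2 k).
Qed.

(** Two mean value theorems, in the direction [i] for the increment in the direction [j], then in
    the direction [j]: the second difference is [s ^+ 2] times a mixed derivative at a nearby
    point. *)
Lemma mixed_partials n (D : set 'rV[R]_n) (f : 'rV[R]_n -> R) (x : 'rV[R]_n) (i j : 'I_n) :
  nbhs x D -> C2on D f ->
  forall e : R, 0 < e -> exists2 d : R, 0 < d & forall s : R, 0 < s < d ->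
   `|(f (x + s *: delta_mx 0 i + s *: delta_mx 0 j) - f (x + s *: delta_mx 0 i)
     - f (x + s *: delta_mx 0 j) + f x) - s ^+ 2 * partial j (partial i f) x|
     <= e * s ^+ 2.
Proof.
move=> Dx [f1 f2] e e0.
have Dx' := nbhs_singleton Dx.
have [r r0 rD] := nbhs_norm_ball Dx.
have [c0 c0p cc] : exists2 c, 0 < c & forall y : 'rV[R]_n, `|y - x| < c ->
    `|partial j (partial i f) x - partial j (partial i f) y| < e.
  apply: nbhs_norm_ball; have [_ /(_ j)/cvgrPdist_lt] := f2 i x Dx'; exact.
have dn : forall (k : 'I_n) (a : R), `|a *: (delta_mx 0 k : 'rV[R]_n)| <= `|a|.
  move=> k a; apply: mx_norm_le => // ? l; rewrite !mxE normrM ler_piMr//.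
  by case: (_ && _); rewrite /= ?normr1 ?normr0.
exists (Num.min r c0 / 2); first by rewrite divr_gt0// lt_min r0.
move=> s /andP[s0 ss].
have sr : 2 * s < r by move: ss; rewrite ltr_pdivlMr// lt_min; lra.
have sc : 2 * s < c0 by move: ss; rewrite ltr_pdivlMr// lt_min; lra.
have near2 (a b : R) : `|a| <= `|s| -> `|b| <= `|s| ->
    `|x + a *: delta_mx 0 i + b *: delta_mx 0 j - x| <= 2 * s.
  move=> ha hb; rewrite addrC !addrA addNr add0r.
  rewrite (le_trans (ler_normD _ _))//.
  have := dn i a; have := dn j b; rewrite (gtr0_norm s0) in ha hb; lra.
have ds : `|s| <= `|s| by [].
have z0 : `|0 : R| <= `|s| by rewrite normr0.
have inD (a b : R) : `|a| <= `|s| -> `|b| <= `|s| ->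
    D (x + a *: delta_mx 0 i + b *: delta_mx 0 j).
  by move=> ha hb; apply: rD; apply: le_lt_trans sr; exact: near2.
pose F1 (b t : R) := f (x + b *: delta_mx 0 j + t *: delta_mx 0 i).
pose G1 (b t : R) := partial i f (x + b *: delta_mx 0 j + t *: delta_mx 0 i).
have dF1 (b t : R) : `|t| <= `|s| -> `|b| <= `|s| -> is_derive t 1 (F1 b) (G1 b t).
  move=> ht hb; apply: is_derive_line; apply: derivableP.
  apply: diff_derivable; rewrite addrAC.
  by have [] := f1 _ (inD _ _ ht hb).
have [|t ts E1] := @MVT_centered R (F1 s - F1 0) (fun t => G1 s t - G1 0 t) s.
  move=> t ht; have h1 := dF1 s t ht ds; have h2 := dF1 0 t ht z0.
  exact: (@is_deriveB _ _ _ _ _ _ _ _ _ h1 h2).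
have [|u us E2] := @MVT_centered R
   (fun u => partial i f (x + t *: delta_mx 0 i + u *: delta_mx 0 j))
   (fun u => partial j (partial i f) (x + t *: delta_mx 0 i + u *: delta_mx 0 j)) s.
  move=> u hu; apply: is_derive_line; apply: derivableP; apply: diff_derivable.
  by have [] := f2 i _ (inD _ _ ts hu).
rewrite !fctE /F1 /G1 in E1.
move: E1 E2; rewrite !scale0r !addr0 => E1 E2.
set P := partial j (partial i f) (x + t *: delta_mx 0 i + u *: delta_mx 0 j) in E2.
have -> : f (x + s *: delta_mx 0 i + s *: delta_mx 0 j) - f (x + s *: delta_mx 0 i)
     - f (x + s *: delta_mx 0 j) + f x = P * s * s.
  rewrite -E2 [in X in _ = X]addrAC -E1 [x + _ + _]addrAC; ring.
have -> : P * s * s - s ^+ 2 * partial j (partial i f) x =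
   (P - partial j (partial i f) x) * s ^+ 2 by ring.
rewrite normrM (ger0_norm (sqr_ge0 s)) ler_wpM2r ?sqr_ge0//.
rewrite distrC ltW//; apply: cc; apply: le_lt_trans sc; exact: near2.
Qed.

(** The second difference is symmetric in [i] and [j], and both mixed derivatives approximate its
    quotient by [s ^+ 2]. *)
Lemma partialC n (D : set 'rV[R]_n) (f : 'rV[R]_n -> R) (x : 'rV[R]_n) (i j : 'I_n) :
  nbhs x D -> C2on D f -> partial i (partial j f) x = partial j (partial i f) x.
Proof.
move=> Dx f2; apply/eqP; rewrite -subr_eq0 -normr_eq0 eq_le normr_ge0 andbT.
apply/ler_addgt0Pl => e e0; rewrite addr0.
have e2 : 0 < e / 2 by rewrite divr_gt0.
have [d d0 hd] := mixed_partials i j Dx f2 e2.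
have [d' d'0 hd'] := mixed_partials j i Dx f2 e2.
pose s := Num.min d d' / 2.
have m0 : 0 < Num.min d d' by rewrite lt_min d0.
have s0 : 0 < s by rewrite divr_gt0.
have sm : s < Num.min d d' by rewrite /s; lra.
have /andP[sd sd'] : (s < d) && (s < d') by rewrite -lt_min.
have := hd s; rewrite s0 sd => /(_ isT); have := hd' s; rewrite s0 sd' => /(_ isT).
rewrite [x + _ + _]addrAC.
set a := f _; set b := f _; set c := f _; set p := partial _ _ _; set q := partial j _ _.
move: (f x) a b c p q => y a b c p q h1 h2.
have s20 : 0 < s ^+ 2 by rewrite exprn_gt0.
rewrite -(ler_pM2r s20) -[X in _ * X <= _]ger0_norm ?sqr_ge0// -normrM.
rewrite (_ : (p - q) * s ^+ 2 =
  (a - c - b + y - s ^+ 2 * q) - (a - b - c + y - s ^+ 2 * p)); last by ring.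
rewrite [e in leRHS]splitr mulrDl.
exact: le_trans (ler_normB _ _) (lerD h2 h1).
Qed.

(** If [d2 > 0], then [df] is positive just after 0, and the mean value theorem makes [f] exceed
    [f 0] there. *)
Lemma second_derivative_max (f df : R -> R) (d2 e : R) : 0 < e ->
  (forall t : R, `|t| < e -> is_derive t 1 f (df t)) -> is_derive (0 : R) 1 df d2 ->
  (forall t : R, `|t| < e -> f t <= f 0) -> df 0 = 0 /\ d2 <= 0.
Proof.
move=> e0 fd dfd fmax.
have itvE t : (t \in `]- e, e[%R) = (`|t| < e) by rewrite in_itv /= ltr_norml.
have df0 : df 0 = 0.
  have f0 : is_derive (0 : R) 1 f 0.
    apply: (@derive1_at_max R f (- e) e) => //.
    - by lra.
    - by move=> t; rewrite itvE => /fd ?.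
    - by rewrite itvE normr0.
    - by move=> t; rewrite itvE; exact: fmax.
  have := fd 0; rewrite normr0 => /(_ e0) h.
  by rewrite -(@derive_val _ _ _ _ _ _ _ h) (@derive_val _ _ _ _ _ _ _ f0).
split=> //; rewrite leNgt; apply/negP => d20.
have : \forall h \near (0 : R)^', `|d2 - h^-1 * df h| < d2.
  case: dfd => dv dE.
  have : (fun h : R => h^-1 *: ((df \o shift 0) (h *: 1) - df 0)) @ 0^' --> d2.
    by rewrite -dE; exact: dv.
  move=> /cvgrPdist_lt/(_ _ d20); apply: filterS => h.
  by rewrite /= df0 subr0 addr0 [h *: 1]mulr1.
move=> [r /= r0 hr].
pose s := Num.min r e / 2.
have m0 : 0 < Num.min r e by rewrite lt_min r0.
have s0 : 0 < s by rewrite divr_gt0.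
have sm : s < Num.min r e by rewrite /s; lra.
have /andP[sd se] : (s < r) && (s < e) by rewrite -lt_min.
have [||t ts E] := @MVT R f df 0 s s0.
- by move=> t; rewrite in_itv /= => /andP[t0 ts]; apply: fd; rewrite gtr0_norm; lra.
- apply: derivable_within_continuous => t; rewrite in_itv /= => /andP[t0 ts].
  by have := fd t; rewrite ger0_norm// => /(_ (le_lt_trans ts se)) ?.
move: ts; rewrite in_itv /= => /andP[t0 ts].
have := hr t; rewrite /ball_ /= sub0r normrN gtr0_norm// => /(_ (lt_trans ts sd)).
rewrite gt_eqF// => /(_ isT).
rewrite ltr_norml => /andP[_]; rewrite ltrBlDr ltrDl => dp.
have : 0 < df t by rewrite -(pmulr_rgt0 _ (_ : 0 < t^-1)) ?invr_gt0.
have := fmax s; rewrite gtr0_norm// => /(_ se).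
move: E; rewrite subr0 => E fs dft.
have : 0 < df t * s by rewrite mulr_gt0.
lra.
Qed.

End chain_rule.

(** * Interior gradient estimate *)

Section euclidean_topology.
Context {R : realType}.

Lemma dot_continuous n (T : topologicalType) (f g : T -> 'rV[R]_n) x :
  {for x, continuous f} -> {for x, continuous g} ->
  {for x, continuous (fun y => dot (f y) (g y))}.
Proof.
move=> fc gc; rewrite (_ : (fun y => _) = (fun y => \sum_i f y 0 i * g y 0 i)); last first.
  by apply/funext => y; rewrite dotE.
have h (m : T -> 'rV[R]_n) k : {for x, continuous m} ->
    {for x, continuous (fun y => m y 0 k)}.
  by move=> mc; exact: (continuous_comp mc (@coord_continuous R 1 n 0 k _)).
by apply: continuous_sumr => k; apply: continuousM; exact: h.
Qed.

Lemma enorm2_continuous n : continuous (@enorm2 R n).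
Proof.
move=> x; rewrite (_ : enorm2 = fun y => dot y y); last first.
  by apply/funext => y; rewrite dotvv.
exact: dot_continuous.
Qed.

Lemma enorm_continuous n : continuous (@enorm R n).
Proof.
by move=> x; apply: continuous_comp; [exact: enorm2_continuous|exact: sqrt_continuous].
Qed.

Lemma norm_le_enorm n (v : 'rV[R]_n) : `|v| <= enorm v.
Proof.
by apply: mx_norm_le => [|i j]; rewrite ?enorm_ge0// ord1 normr_coord_le.
Qed.

Lemma compact_eball_closed n (Y0 : 'rV[R]_n) rho :
  compact [set X : 'rV[R]_n | enorm (X - Y0) <= rho].
Proof.
apply: bounded_closed_compact.
  exists (rho + `|Y0|); split; first exact: num_real.
  move=> c hc X /= h; rewrite -(subrK Y0 X); apply: le_trans (ler_normD _ _) _.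
  by apply: le_trans (ltW hc); rewrite lerD2r (le_trans (norm_le_enorm _)).
rewrite (_ : mkset _ = (fun X => enorm (X - Y0)) @^-1` [set x | x <= rho])//.
apply: preimage_closed; last exact: closed_le.
move=> x _; apply: continuous_comp; last exact: enorm_continuous.
by apply: continuousB => //; exact: cst_continuous.
Qed.

Lemma open_eball n (Y0 : 'rV[R]_n) rho :
  open [set X : 'rV[R]_n | enorm (X - Y0) < rho].
Proof.
rewrite (_ : mkset _ = (fun X => enorm (X - Y0)) @^-1` [set x | x < rho])//.
apply: open_comp; last exact: open_lt.
move=> x _; apply: continuous_comp; last exact: enorm_continuous.
by apply: continuousB => //; exact: cst_continuous.
Qed.

End euclidean_topology.

(** * Optimality conditions for the doubled function *)

Section doubling.
Context {R : realType}.

Definition grd n (f : 'rV[R]_n -> R) x : 'rV[R]_n := \row_i partial i f x.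

Lemma dot_grd n (f : 'rV[R]_n -> R) (x v : 'rV[R]_n) : \sum_i v 0 i * partial i f x = dot v (grd f x).
Proof. by rewrite dotE; apply: eq_bigr => i _; rewrite mxE. Qed.

Lemma derive_grd n (f : 'rV[R]_n -> R) (x v : 'rV[R]_n) : differentiable f x ->
  'D_v f x = dot v (grd f x).
Proof. by move=> df; rewrite derive_partials// dot_grd. Qed.

Lemma is_derive_quadratic (a b c t : R) :
  is_derive t 1 (fun t : R => a + b * t + c * t ^+ 2) (b + 2 * c * t).
Proof.
by apply: is_derive_eq; rewrite /GRing.scale /= ; ring.
Qed.

Lemma is_derive_affine (b c t : R) : is_derive t 1 (fun t : R => b + c * t) c.
Proof.
by apply: is_derive_eq; rewrite /GRing.scale /= ; ring.
Qed.

Lemma is_derive_sqrt_quadratic (a b c t : R) : 0 < a + 2 * b * t + c * t ^+ 2 ->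
  is_derive t 1 (fun t => Num.sqrt (a + 2 * b * t + c * t ^+ 2))
    ((b + c * t) / Num.sqrt (a + 2 * b * t + c * t ^+ 2)).
Proof.
move=> h; have d1 := is_derive_quadratic a (2 * b) c t.
have d2 := @is_derive1_comp R (@Num.sqrt R)
  (fun t => a + 2 * b * t + c * t ^+ 2) t _ _ (is_derive1_sqrt h) d1.
apply: (is_derive_eq d2).
by field; rewrite gt_eqF// sqrtr_gt0.
Qed.

Lemma is_derive_sqrt_quadratic2 (a b c : R) : 0 < a ->
  is_derive (0 : R) 1 (fun t => (b + c * t) / Num.sqrt (a + 2 * b * t + c * t ^+ 2))
    (c / Num.sqrt a - b ^+ 2 / Num.sqrt a ^+ 3).
Proof.
move=> a0.
have h : 0 < a + 2 * b * 0 + c * 0 ^+ 2 by rewrite expr0n !mulr0 !addr0.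
have d1 := is_derive_sqrt_quadratic h.
have sn : Num.sqrt (a + 2 * b * 0 + c * 0 ^+ 2) != 0 by rewrite gt_eqF// sqrtr_gt0.
have d2 := @is_deriveV R (fun t => Num.sqrt (a + 2 * b * t + c * t ^+ 2)) 0 _ 1 sn d1.
have d3 := is_derive_affine b c 0.
have d4 := @is_deriveM _ _ _ _ _ _ _ _ d3 d2.
apply: (is_derive_eq d4); rewrite /GRing.scale /= !mulr0 expr0n /= !mulr0 !addr0.
by field; rewrite gt_eqF// sqrtr_gt0.
Qed.

(* The penalization of the doubling method, with the optimality conditions at
   an interior maximum: [ (xi, eta) ] is a direction in the doubled space. *)
Lemma doubling_max n (D : set 'rV[R]_n) (U : 'rV[R]_n -> R) (Y0 X Y : 'rV[R]_n)
    (l M k e : R) :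
  let Phi (X Y : 'rV[R]_n) := U X - U Y - (l * (enorm (X - Y) - M / 2 * enorm2 (X - Y))
     + k * (enorm2 (X - Y0) + enorm2 (Y - Y0))) in
  open D -> C2on D U -> D X -> D Y -> X != Y -> 0 < e ->
  (forall X' Y', enorm (X' - X) < e -> enorm (Y' - Y) < e -> Phi X' Y' <= Phi X Y) ->
  let d := X - Y in let r := enorm d in
  forall xi eta : 'rV[R]_n, let w := xi - eta in
   dot xi (grd U X) - dot eta (grd U Y) =
     l * (dot d w / r - M * dot d w) + 2 * k * (dot (X - Y0) xi + dot (Y - Y0) eta) /\
   quad (hess U X) xi - quad (hess U Y) eta <=
     l * (enorm2 w / r - dot d w ^+ 2 / r ^+ 3 - M * enorm2 w)
      + 2 * k * (enorm2 xi + enorm2 eta).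
Proof.
move=> Phi oD U2 DX DY XY e0 Pmax d r xi eta w.
have U1 : C1on D U by case: U2.
set a := enorm2 d; set b := dot d w; set c := enorm2 w.
have a0 : 0 < a.
  rewrite lt_neqAle enorm2_ge0 andbT eq_sym; apply: contra_neq XY => /enorm2_eq0 /eqP.
  by rewrite subr_eq0 => /eqP.
(* On the line through [(X, Y)] in the direction [(xi, eta)] all squared distances are quadratic
   polynomials in [t]. Since [X != Y], [q] stays positive near 0 and its square root is smooth. *)
pose q (t : R) := a + 2 * b * t + c * t ^+ 2.
have qE t : enorm2 (X + t *: xi - (Y + t *: eta)) = q t.
  rewrite opprD addrACA -scalerBr enorm2D dotZr enorm2Z -/d -/w -/a -/b -/c /q; ring.
pose p0 := enorm2 (X - Y0) + enorm2 (Y - Y0).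
pose p1 := dot (X - Y0) xi + dot (Y - Y0) eta.
pose p2 := enorm2 xi + enorm2 eta.
have pE t : enorm2 (X + t *: xi - Y0) + enorm2 (Y + t *: eta - Y0) =
    p0 + 2 * p1 * t + p2 * t ^+ 2.
  rewrite [X + _ - _]addrAC [Y + _ - _]addrAC (enorm2D (X - Y0)) (enorm2D (Y - Y0)) !dotZr !enorm2Z /p0 /p1 /p2; ring.
pose f (t : R) := U (X + t *: xi) - U (Y + t *: eta) -
  (l * (Num.sqrt (q t) - M / 2 * q t) + k * (p0 + 2 * p1 * t + p2 * t ^+ 2)).
have fE t : f t = Phi (X + t *: xi) (Y + t *: eta).
  by rewrite /f /Phi /enorm qE pE.
pose df (t : R) := \sum_i xi 0 i * partial i U (X + t *: xi)
   - \sum_i eta 0 i * partial i U (Y + t *: eta)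
   - (l * ((b + c * t) / Num.sqrt (q t) - M / 2 * (2 * b + 2 * c * t))
      + k * (2 * p1 + 2 * p2 * t)).
have line (Z z : 'rV[R]_n) (A : set 'rV[R]_n) : open A -> A Z ->
    \forall t \near (0 : R), A (Z + t *: z).
  move=> oA AZ; have : continuous (fun t : R => Z + t *: z).
    by move=> t; apply: cvgD; [exact: cvg_cst|apply: cvgZr_tmp; exact: cvg_id].
  move=> /(_ 0)/=; rewrite /continuous_at scale0r addr0; apply.
  by apply: open_nbhs_nbhs; split.
have qpos : \forall t \near (0 : R), 0 < q t.
  have : {for (0 : R), continuous q}.
    apply: differentiable_continuous; apply/derivable1_diffP.
    by have := is_derive_quadratic a (2 * b) c 0.
  move=> qc; have q0 : 0 < q 0 by rewrite /q expr0n !mulr0 !addr0.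
  exact: (cvgr_gt (q 0) qc 0 q0).
have [e1 /= e10 H1] : \forall t \near (0 : R), [/\ D (X + t *: xi), D (Y + t *: eta),
    0 < q t & enorm (X + t *: xi - X) < e /\ enorm (Y + t *: eta - Y) < e].
  have n1 := line X xi _ oD DX; have n2 := line Y eta _ oD DY.
  have n3 := line X xi _ (@open_eball R n X e); have n4 := line Y eta _ (@open_eball R n Y e).
  rewrite /= !subrr /enorm enorm20 sqrtr0 in n3 n4.
  near=> t; split; [near: t; exact: n1|near: t; exact: n2|near: t; exact: qpos|].
  by split; near: t; [exact: n3|exact: n4].
have H2 (t : R) : `|t| < e1 -> [/\ D (X + t *: xi), D (Y + t *: eta),
    0 < q t & enorm (X + t *: xi - X) < e /\ enorm (Y + t *: eta - Y) < e].
  by move=> te; apply: H1; rewrite /ball_ /= sub0r normrN.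
have d1 (t : R) : `|t| < e1 -> is_derive t 1 f (df t).
  move=> /H2[D1 D2 q0 _].
  have i1 := is_derive_partials (U1 _ D1).1.
  have i2 := is_derive_partials (U1 _ D2).1.
  have i3 := is_derive_sqrt_quadratic q0.
  have i4 := is_deriveZ (M / 2) (is_derive_quadratic a (2 * b) c t).
  have i5 := is_deriveZ k (is_derive_quadratic p0 (2 * p1) p2 t).
  have i6 := is_deriveZ l (is_deriveB i3 i4).
  have := is_deriveB (is_deriveB i1 i2) (is_deriveD i6 i5).
  by move/is_derive_eq; apply; rewrite /df /GRing.scale /=; ring.
have d2 : is_derive (0 : R) 1 df (quad (hess U X) xi - quad (hess U Y) eta
   - (l * (c / Num.sqrt a - b ^+ 2 / Num.sqrt a ^+ 3 - M * c) + k * (2 * p2))).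
  have [D1 D2 q0 _] := H2 0 ltac:(by rewrite normr0).
  have i1 := is_derive_hess U2 D1; rewrite scale0r addr0 in i1.
  have i2 := is_derive_hess U2 D2; rewrite scale0r addr0 in i2.
  have i3 := is_derive_sqrt_quadratic2 b c a0.
  have i4 := is_deriveZ (M / 2) (is_derive_affine (2 * b) (2 * c) 0).
  have i5 := is_deriveZ k (is_derive_affine (2 * p1) (2 * p2) 0).
  have i6 := is_deriveZ l (is_deriveB i3 i4).
  have := is_deriveB (is_deriveB i1 i2) (is_deriveD i6 i5).
  move/is_derive_eq; apply; rewrite /GRing.scale /=; field.
  by rewrite gt_eqF// sqrtr_gt0.
have [t te|h1 h2] := second_derivative_max e10 d1 d2.
  rewrite !fE !scale0r !addr0; have [_ _ _ [? ?]] := H2 _ te; exact: Pmax.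
split.
  move: h1; rewrite /df !scale0r !addr0 !dot_grd !mulr0 !addr0 /q expr0n /=.
  rewrite !mulr0 !addr0 -/(enorm d) -/r -/b -/p1 => /eqP; rewrite subr_eq0 => /eqP ->.
  field; by rewrite gt_eqF// sqrtr_gt0.
by rewrite -subr_le0; move: h2; rewrite (_ : Num.sqrt a = r)// /p2; congr (_ <= _); ring.
Unshelve. all: by end_near. Qed.

End doubling.

Section gradient_bound.
Context {R : realType}.

Lemma enorm0 n : enorm (0 : 'rV[R]_n) = 0.
Proof. by rewrite /enorm enorm20 sqrtr0. Qed.

Lemma quadNr n (G : 'M[R]_n) v : quad G (- v) = quad G v.
Proof. by rewrite -scaleN1r quadZr sqrrN expr1n mul1r. Qed.

Lemma normr_drift_le (l r b c x : R) : 0 < l -> 0 < r -> 0 <= c <= 1 -> `|x| <= r * b ->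
  `|l * c / r * x| <= b * l.
Proof.
move=> l0 r0 /andP[c0 c1] xb.
have h : 0 <= l * c / r by rewrite divr_ge0 ?mulr_ge0 ?(ltW l0) ?(ltW r0).
rewrite normrM (ger0_norm h); apply: le_trans (ler_wpM2l h xb) _.
have -> : l * c / r * (r * b) = b * l * c by field; rewrite gt_eqF.
have bl : 0 <= b * l.
  by rewrite mulr_ge0 ?(ltW l0)// -(pmulr_rge0 _ r0); exact: le_trans xb.
by have := ler_wpM2l bl c1; rewrite mulr1.
Qed.

Lemma dot0r n (u : 'rV[R]_n) : dot u 0 = 0.
Proof. by rewrite /dot trmx0 mulmx0 mxE. Qed.

Lemma quad0r n (G : 'M[R]_n) : quad G 0 = 0.
Proof. by rewrite /quad !mul0mx mxE. Qed.

(* The matrices [A X] and [A Y] share the part [P0 + lam/2 e^T e], whose last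
   term is reflected in the direction [e] of [X - Y]; this produces the
   strongly negative term [- 2 lam l M]. *)
Lemma coupled_trace n (AX AY HX HY : 'M[R]_n) (e : 'rV[R]_n) (lam Lam K r l M k : R) :
  0 < lam -> 0 <= K -> 0 < r -> 0 <= k -> 0 <= l -> K * r <= lam / 2 -> enorm2 e = 1 ->
  AX^T = AX -> AY^T = AY ->
  (forall v, lam * enorm2 v <= quad AX v <= Lam * enorm2 v) ->
  (forall v, `|quad (AY - AX) v| <= K * r * enorm2 v) ->
  (forall v, quad HX v - quad HY v <= 4 * k * enorm2 v) ->
  (forall v, quad HX v <= (l / r + 2 * k) * enorm2 v) ->
  (forall v, - quad HY v <= (l / r + 2 * k) * enorm2 v) ->
  quad HX e - quad HY e <= - 4 * l * M + 4 * k ->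
  \tr (AX *m HX) - \tr (AY *m HY) <=
   - 2 * lam * l * M + 2 * k * lam + 4 * k * (n%:R * Lam) + 3 * n%:R * K * l
   + 3 * n%:R * k * lam.
Proof.
move=> lam0 K0 r0 k0 l0 Kr e1 AXs AYs AXb dA hd hX hY he.
have Kr0 : 0 <= K * r by rewrite mulr_ge0// ltW.
(* Taking [K r] out of [AX] and adding it to [AY - AX] makes both [P0] and [Q] nonnegative, so that
   one-sided bounds on the Hessians suffice. For [P0] this uses [K r <= lam / 2] together with the
   [lam / 2] spent on [E]. *)
pose E := (lam / 2) *: (e^T *m e).
pose P0 := AX - E - (K * r)%:M.
pose Q := AY - AX + (K * r)%:M.
have Es : E^T = E by rewrite /E linearZ /= trmx_mul trmxK.
have P0s : P0^T = P0 by rewrite /P0 !linearB /= tr_scalar_mx Es AXs.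
have Qs : Q^T = Q by rewrite /Q linearD linearB /= tr_scalar_mx AXs AYs.
have qE v : quad E v <= lam / 2 * enorm2 v.
  rewrite quadZ quad_dyad ler_wpM2l//; first lra.
  by apply: le_trans (dot_sqr_le _ _) _; rewrite e1 mulr1.
have qE0 v : 0 <= quad E v.
  by rewrite quadZ quad_dyad mulr_ge0// ?sqr_ge0//; lra.
have qP0 v : 0 <= quad P0 v.
  rewrite /P0 quadD quadD !quadN quad_scalar.
  have /andP[h1 _] := AXb v; have := qE v.
  have : K * r * enorm2 v <= lam / 2 * enorm2 v by rewrite ler_wpM2r// enorm2_ge0.
  by move: h1; lra.
have trP0 : \tr P0 <= n%:R * Lam.
  suff qb v : 0 * enorm2 v <= quad P0 v <= Lam * enorm2 v.
    by have /andP[] := quad_trace_bounds qb.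
  rewrite mul0r qP0 /=; have /andP[_ h1] := AXb v.
  rewrite /P0 quadD quadD !quadN quad_scalar; have := qE0 v.
  have : 0 <= K * r * enorm2 v by rewrite mulr_ge0// enorm2_ge0.
  by move: h1; lra.
have qQ v : 0 <= quad Q v.
  rewrite /Q quadD quad_scalar; have := dA v; rewrite ler_norml => /andP[h _].
  by move: h; lra.
have trQ : \tr Q <= n%:R * (2 * (K * r)).
  suff qb v : 0 * enorm2 v <= quad Q v <= 2 * (K * r) * enorm2 v.
    by have /andP[] := quad_trace_bounds qb.
  rewrite mul0r qQ /= /Q quadD quad_scalar.
  by have := dA v; rewrite ler_norml => /andP[_ h]; move: h; lra.
have AXE : AX = E + P0 + (K * r)%:M by rewrite /P0 addrA; apply/matrixP => i j; rewrite !mxE; ring.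
have AYE : AY = E + P0 + Q by rewrite /P0 /Q; apply/matrixP => i j; rewrite !mxE; ring.
have -> : \tr (AX *m HX) - \tr (AY *m HY) = \tr (E *m (HX - HY)) +
   \tr (P0 *m (HX - HY)) + \tr ((K * r)%:M *m HX) + \tr (Q *m (- HY)).
  rewrite {1}AXE {1}AYE !mulmxDl !mulmxDr !mulmxN !raddfD !raddfN /=; ring.
have t1 : \tr (E *m (HX - HY)) <= lam / 2 * (- 4 * l * M + 4 * k).
  rewrite -scalemxAl mxtraceZ trace_dyad quadD quadN ler_wpM2l//; lra.
have t2 : \tr (P0 *m (HX - HY)) <= 4 * k * (n%:R * Lam).
  apply: le_trans (psd_trace_le P0s qP0 (c := 4 * k) _) _.
    by move=> v; rewrite quadD quadN.
  by rewrite ler_wpM2l// mulr_ge0.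
have Krr : K * r * (l / r + 2 * k) <= K * l + k * lam.
  have -> : K * r * (l / r + 2 * k) = K * l + 2 * k * (K * r) by field; rewrite gt_eqF.
  by have := ler_wpM2l k0 Kr; lra.
have t3 : \tr ((K * r)%:M *m HX) <= n%:R * (K * l + k * lam).
  apply: le_trans (psd_trace_le (c := l / r + 2 * k) _ _ hX) _.
  - by rewrite tr_scalar_mx.
  - by move=> v; rewrite quad_scalar mulr_ge0// enorm2_ge0.
  - by rewrite mxtrace_scalar -[K * r *+ n]mulr_natl mulrCA ler_wpM2l// mulrC.
have t4 : \tr (Q *m (- HY)) <= 2 * n%:R * (K * l + k * lam).
  apply: le_trans (psd_trace_le Qs qQ (c := l / r + 2 * k) _) _.
    by move=> v; rewrite quadN.
  have c0 : 0 <= l / r + 2 * k by rewrite addr_ge0 ?divr_ge0 ?mulr_ge0 ?(ltW r0).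
  have := ler_wpM2l c0 trQ.
  have := ler_wpM2l (ler0n R n) Krr.
  by move: (n%:R) (\tr Q) (l / r + 2 * k) (K * r) => N T a b; lra.
move: t1 t2 t3 t4; lra.
Qed.

Section ishii_lions.
Variables (n : nat) (D : set 'rV[R]_n) (U : 'rV[R]_n -> R).
Variables (A : 'rV[R]_n -> 'M[R]_n) (B : 'rV[R]_n -> 'rV[R]_n).
Variables (Y0 : 'rV[R]_n) (rho m lam Lam K b l M k : R).
Let Bal : set 'rV[R]_n := [set X | enorm (X - Y0) <= rho].
Hypotheses (oD : open D) (U2 : C2on D U) (BD : Bal `<=` D).
Hypotheses (Um : forall X, Bal X -> `|U X| <= m).
Hypotheses (As : forall X, Bal X -> (A X)^T = A X).
Hypotheses (Ab : forall X, Bal X ->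
  forall v, lam * enorm2 v <= quad (A X) v <= Lam * enorm2 v).
Hypotheses (AL : forall X Y, Bal X -> Bal Y ->
  forall v, `|quad (A Y - A X) v| <= K * enorm (X - Y) * enorm2 v).
Hypotheses (Bb : forall X, Bal X -> enorm (B X) <= b).
Hypotheses (eqU : forall X, Bal X -> \tr (A X *m hess U X) + dot (B X) (grd U X) = 0).
Hypotheses (lam0 : 0 < lam) (K0 : 0 <= K) (l0 : 0 < l) (M0 : 0 < M)
  (k0 : 0 < k).
Hypotheses (c1 : 2 * m <= k * rho ^+ 2) (c2 : 4 * m * M <= l)
  (c3 : K <= lam / 2 * M)
  (c4 : 2 * k * lam + 4 * k * (n%:R * Lam) + 3 * n%:R * K * l
   + 3 * n%:R * k * lam + 2 * b * (l + 2 * k * rho) < 2 * lam * l * M).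

(** The modulus [r - M r^2 / 2] is nonnegative on the range [M r <= 1] imposed by [S]; its concavity
    is the source of the decisive negative term, and the terms in [k] localize near [Y0]. *)
Let Phi (X Y : 'rV[R]_n) := U X - U Y - (l * (enorm (X - Y) - M / 2 * enorm2 (X - Y))
     + k * (enorm2 (X - Y0) + enorm2 (Y - Y0))).
Let S : set ('rV[R]_n * 'rV[R]_n) :=
  [set Z | [/\ Bal Z.1, Bal Z.2 & M * enorm (Z.1 - Z.2) <= 1]].

Lemma ishii_domain_compact : compact S.
Proof.
have cc := @compact_eball_closed R n Y0 rho.
rewrite (_ : S = (Bal `*` Bal) `&` [set Z | M * enorm (Z.1 - Z.2) <= 1]); last first.
  by apply/seteqP; split => [[X Y] []|[X Y] [[]]].
apply: compact_closedI; first exact: compact_setX.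
rewrite (_ : mkset _ =
  (fun Z : 'rV[R]_n * 'rV[R]_n => M * enorm (Z.1 - Z.2)) @^-1` [set x | x <= 1])//.
apply: preimage_closed; last exact: closed_le.
move=> Z _; apply: cvgM; first exact: cvg_cst.
apply: (@continuous_comp _ _ _ (fun Z : 'rV[R]_n * 'rV[R]_n => Z.1 - Z.2));
  last exact: enorm_continuous.
by apply: cvgB; [exact: cvg_fst|exact: cvg_snd].
Qed.

Lemma ishii_continuous : {within S, continuous (fun Z => Phi Z.1 Z.2)}.
Proof.
apply: continuous_in_subspaceT => -[X Y] /set_mem[/= bX bY _].
have U1 : C1on D U by case: U2.
have f1 : {for (X, Y), continuous (fun Z : 'rV[R]_n * 'rV[R]_n => Z.1)} by exact: cvg_fst.
have f2 : {for (X, Y), continuous (fun Z : 'rV[R]_n * 'rV[R]_n => Z.2)} by exact: cvg_snd.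
have d (g h : 'rV[R]_n * 'rV[R]_n -> 'rV[R]_n) : {for (X, Y), continuous g} ->
    {for (X, Y), continuous h} -> {for (X, Y), continuous (fun Z => enorm2 (g Z - h Z))}.
  move=> gc hc; apply: continuous_comp; last exact: enorm2_continuous.
  exact: continuousB.
have cY : {for (X, Y), continuous (fun Z : 'rV[R]_n * 'rV[R]_n => Y0)} by exact: cvg_cst.
have dXY := d _ _ f1 f2.
have eXY : {for (X, Y), continuous (fun Z : 'rV[R]_n * 'rV[R]_n => enorm (Z.1 - Z.2))}.
  exact: (continuous_comp dXY (@sqrt_continuous R _)).
rewrite /continuous_at; apply: cvgB.
  apply: cvgB.
    exact: (continuous_comp f1 (C1on_continuous U1 (BD bX))).
  exact: (continuous_comp f2 (C1on_continuous U1 (BD bY))).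
apply: cvgD.
  apply: cvgM; first exact: cvg_cst.
  by apply: cvgB => //; apply: cvgM => //; exact: cvg_cst.
apply: cvgM; first exact: cvg_cst.
by apply: cvgD; [exact: (d _ _ f1 cY)|exact: (d _ _ f2 cY)].
Qed.

(** A positive maximum is impossible. It cannot lie on the diagonal; [c1] keeps both points inside
    the ball, [c2] excludes [M r = 1]; at an interior maximum the optimality conditions and the two
    equations contradict [c4], with [c3] making [coupled_trace] applicable. *)
Lemma ishii_Phi_le0 X Y : S (X, Y) -> Phi X Y <= 0.
Proof.
move=> SXY.
have [|[X1 Y1] S1 Hmax] := compact_EVT_max (_ : S !=set0) ishii_domain_compact
  ishii_continuous; first by exists (X, Y).
apply: le_trans (Hmax _ (mem_set SXY)) _ => /=; rewrite leNgt; apply/negP => Phi0.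
have {}Hmax X' Y' : S (X', Y') -> Phi X' Y' <= Phi X1 Y1.
  by move=> /mem_set/Hmax.
move: S1 => /set_mem[/= bX bY Mr].
set d := X1 - Y1; set r := enorm d.
have r_ge0 : 0 <= r by exact: enorm_ge0.
have r2 : enorm2 d = r ^+ 2 by rewrite sqr_enorm.
have psi0 : 0 <= l * (r - M / 2 * r ^+ 2).
  rewrite (mulr_ge0 (ltW l0))//.
  have : r * (M * r) <= r by rewrite -[leRHS]mulr1 ler_wpM2l.
  by rewrite expr2; lra.
have PhiE : Phi X1 Y1 = U X1 - U Y1 - (l * (r - M / 2 * r ^+ 2) +
   k * (enorm (X1 - Y0) ^+ 2 + enorm (Y1 - Y0) ^+ 2)).
  by rewrite /Phi -/d r2 !sqr_enorm.
have U12 : U X1 - U Y1 <= 2 * m.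
  have := Um bX; have := Um bY; rewrite !ler_norml => /andP[? ?] /andP[? ?]; lra.
have kX : 0 <= k * enorm (X1 - Y0) ^+ 2 by rewrite mulr_ge0 ?sqr_ge0// ltW.
have kY : 0 <= k * enorm (Y1 - Y0) ^+ 2 by rewrite mulr_ge0 ?sqr_ge0// ltW.
have XY : X1 != Y1.
  apply/eqP => E; move: Phi0; rewrite PhiE E subrr; move: psi0 kX kY; rewrite E; lra.
have r0 : 0 < r.
  rewrite lt_neqAle r_ge0 andbT eq_sym; apply: contra_neq XY => rz.
  apply/eqP; rewrite -subr_eq0; apply/eqP/enorm2_eq0.
  by rewrite -/d r2 rz expr0n.
have Xin : enorm (X1 - Y0) < rho.
  rewrite lt_neqAle bX andbT; apply/negP => /eqP E.
  by move: Phi0; rewrite PhiE E; move: c1 psi0 kY U12; lra.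
have Yin : enorm (Y1 - Y0) < rho.
  rewrite lt_neqAle bY andbT; apply/negP => /eqP E.
  by move: Phi0; rewrite PhiE E; move: c1 psi0 kX U12; lra.
have rin : M * r < 1.
  rewrite lt_neqAle Mr andbT; apply/negP => /eqP E.
  have h : l * (r - M / 2 * r ^+ 2) = l * r / 2.
    have -> : M / 2 * r ^+ 2 = (M * r) * r / 2 by field.
    by rewrite E; field.
  have h2 : 4 * m <= l * r.
    by have := ler_wpM2r r_ge0 c2; rewrite -(mulrA (4 * m)) E mulr1.
  by move: Phi0; rewrite PhiE h; move: h2 kX kY U12; lra.
pose e := Num.min (rho - enorm (X1 - Y0)) (Num.min (rho - enorm (Y1 - Y0)) ((M^-1 - r) / 2)).
have e0 : 0 < e.
  rewrite !lt_min !subr_gt0 Xin Yin /= divr_gt0// subr_gt0.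
  by rewrite -(ltr_pM2l M0) mulfV// gt_eqF.
have [e1 e2 e3] : [/\ e <= rho - enorm (X1 - Y0), e <= rho - enorm (Y1 - Y0) &
    e <= (M^-1 - r) / 2].
  by rewrite /e !ge_min !lexx !orbT.
have Pmax X' Y' : enorm (X' - X1) < e -> enorm (Y' - Y1) < e -> Phi X' Y' <= Phi X1 Y1.
  move=> hX hY; apply: Hmax; split => /=.
  - rewrite /Bal /= -(subrK X1 X') -addrA; apply: le_trans (enormD _ _) _.
    by move: hX e1; lra.
  - rewrite /Bal /= -(subrK Y1 Y') -addrA; apply: le_trans (enormD _ _) _.
    by move: hY e2; lra.
  - rewrite -(@mulfV _ M) ?gt_eqF// ler_pM2l//.
    have -> : X' - Y' = (X' - X1) + d + (Y1 - Y').
      by rewrite /d; apply/matrixP => i j; rewrite !mxE; ring.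
    apply: le_trans (enormD _ _) _.
    rewrite -(opprB Y' Y1) enormN.
    by have := enormD (X' - X1) d; rewrite -/r; move: hX hY e3; lra.
have H := @doubling_max R n D U Y0 X1 Y1 l M k e oD U2 (BD bX) (BD bY) XY e0 Pmax.
have H1 xi eta : dot xi (grd U X1) - dot eta (grd U Y1) =
     l * (dot d (xi - eta) / r - M * dot d (xi - eta)) +
     2 * k * (dot (X1 - Y0) xi + dot (Y1 - Y0) eta) by exact: (H xi eta).1.
have H2 xi eta : quad (hess U X1) xi - quad (hess U Y1) eta <=
     l * (enorm2 (xi - eta) / r - dot d (xi - eta) ^+ 2 / r ^+ 3 - M * enorm2 (xi - eta))
      + 2 * k * (enorm2 xi + enorm2 eta) by exact: (H xi eta).2.
have eX := eqU bX; have eY := eqU bY; clear H.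
move: (hess U X1) (hess U Y1) (grd U X1) (grd U Y1) H1 H2 eX eY =>
  HX HY GX GY H1 H2 eX eY.
have rn0 : r != 0 by rewrite gt_eqF.
pose ev := r^-1 *: d.
have ev1 : enorm2 ev = 1 by rewrite enorm2Z r2 exprVn mulVf// sqrf_eq0.
have Mr0 : 0 < M * r by rewrite mulr_gt0.
have trb := @coupled_trace n (A X1) (A Y1) HX HY ev lam Lam K r l M k
   lam0 K0 r0 (ltW k0) (ltW l0).
have {}trb : \tr (A X1 *m HX) - \tr (A Y1 *m HY) <=
   - 2 * lam * l * M + 2 * k * lam + 4 * k * (n%:R * Lam) + 3 * n%:R * K * l
   + 3 * n%:R * k * lam.
  (* Directions for the second-order condition: [(v, v)] leaves the difference unchanged and costs
     only [4 k]; [(v, 0)] and [(0, v)] bound the Hessians separately; [(ev, - ev)] cancels the terms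
     in [1 / r] and leaves [- 4 l M]. *)
  apply: trb => //; [|exact: As|exact: As|exact: Ab|..].
  - have := ler_wpM2r r_ge0 c3; have := ler_wpM2l (ltW lam0) (ltW rin).
    by lra.
  - by move=> v; exact: AL.
  - move=> v; have := H2 v v; rewrite (subrr v) enorm20 dot0r expr0n !mul0r mulr0 !subr0 mulr0 => h.
    by lra.
  - move=> v; have := H2 v 0; rewrite (subr0 v) enorm20 quad0r => h.
    apply: le_trans (_ : _ <= quad HX v - 0) _; first by rewrite subr0.
    have h3 : 0 <= dot d v ^+ 2 / r ^+ 3 by rewrite divr_ge0 ?sqr_ge0 ?exprn_ge0.
    have h4 : 0 <= M * enorm2 v by rewrite mulr_ge0 ?enorm2_ge0// ltW.
    apply: le_trans h _; rewrite -subr_ge0.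
    have -> : forall a b N : R, (l / r + 2 * k) * N -
      (l * (N / r - a - b) + 2 * k * (N + 0)) = l * (a + b) by move=> *; ring.
    by rewrite (mulr_ge0 (ltW l0))// addr_ge0.
  - move=> v; have := H2 0 v; rewrite (sub0r v) enorm20 enorm2N quad0r => h.
    apply: le_trans (_ : _ <= 0 - quad HY v) _; first by rewrite sub0r.
    have h3 : 0 <= dot d (- v) ^+ 2 / r ^+ 3 by rewrite divr_ge0 ?sqr_ge0 ?exprn_ge0.
    have h4 : 0 <= M * enorm2 v by rewrite mulr_ge0 ?enorm2_ge0// ltW.
    apply: le_trans h _; rewrite -subr_ge0.
    have -> : forall a b N : R, (l / r + 2 * k) * N -
      (l * (N / r - a - b) + 2 * k * (0 + N)) = l * (a + b) by move=> *; ring.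
    by rewrite (mulr_ge0 (ltW l0))// addr_ge0.
  - have := H2 ev (- ev); rewrite opprK quadNr enorm2N ev1.
    have -> : enorm2 (ev + ev) = 4.
      by rewrite enorm2D dotvv ev1; ring.
    have -> : dot d (ev + ev) = 2 * r.
      by rewrite dotDr dotZr dotvv r2; field.
    have -> : l * (4 / r - (2 * r) ^+ 2 / r ^+ 3 - M * 4) + 2 * k * (1 + 1) =
      - 4 * l * M + 4 * k by field.
    by [].
(* The first-order condition in the direction [(B X1, 0)] expresses the drift term through [X1 - Y1]
   and [X1 - Y0] alone. *)
have gX : `|dot (B X1) GX| <= b * (l + 2 * k * rho).
  have := H1 (B X1) 0; rewrite [dot 0 _]dotC !dot0r !subr0 addr0 => ->.
  have h1 := normr_dot_le d (B X1); have h2 := normr_dot_le (X1 - Y0) (B X1).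
  have hB := Bb bX.
  have -> : l * (dot d (B X1) / r - M * dot d (B X1)) = l * (1 - M * r) / r * dot d (B X1).
    by field.
  apply: le_trans (ler_normD _ _) _; rewrite [b * _]mulrDr.
  have q1 : `|l * (1 - M * r) / r * dot d (B X1)| <= b * l.
    apply: normr_drift_le => //; first by lra.
    by apply: le_trans h1 _; rewrite ler_wpM2l.
  apply: lerD => //; rewrite !normrM (ger0_norm (ltW k0)) normr_nat.
  rewrite (mulrC b) -!mulrA ler_wpM2l// (ler_wpM2l (ltW k0))//.
  apply: le_trans h2 _; rewrite ler_pM ?enorm_ge0//.
have gY : `|dot (B Y1) GY| <= b * (l + 2 * k * rho).
  have := H1 0 (B Y1); rewrite [dot 0 _]dotC !dot0r !sub0r add0r => h.
  rewrite -normrN h dotNr.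
  have h1 := normr_dot_le d (B Y1); have h2 := normr_dot_le (Y1 - Y0) (B Y1).
  have hB := Bb bY.
  have -> : l * (- dot d (B Y1) / r - M * - dot d (B Y1)) =
    - (l * (1 - M * r) / r * dot d (B Y1)) by field.
  apply: le_trans (ler_normD _ _) _; rewrite normrN [b * _]mulrDr.
  have q1 : `|l * (1 - M * r) / r * dot d (B Y1)| <= b * l.
    apply: normr_drift_le => //; first by lra.
    by apply: le_trans h1 _; rewrite ler_wpM2l.
  apply: lerD => //; rewrite !normrM (ger0_norm (ltW k0)) normr_nat.
  rewrite (mulrC b) -!mulrA ler_wpM2l// (ler_wpM2l (ltW k0))//.
  apply: le_trans h2 _; rewrite ler_pM ?enorm_ge0//.
move: gX gY; rewrite !ler_norml => /andP[_ gX] /andP[gY _].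
by move: trb gX gY eX eY c4; lra.
Qed.

End ishii_lions.
End gradient_bound.

Section interior_gradient.
Context {R : realType}.

Lemma derive_le_slope n (U : 'rV[R]_n -> R) (Y0 v : 'rV[R]_n) (a b e : R) :
  differentiable U Y0 -> 0 < e ->
  (forall t, 0 < t < e -> U (Y0 + t *: v) - U Y0 <= a * t + b * t ^+ 2) ->
  dot v (grd U Y0) <= a.
Proof.
move=> dU e0 hU; rewrite -derive_grd// leNgt; apply/negP => aD.
set g := 'D_v U Y0 - a; have g0 : 0 < g / 2 by rewrite divr_gt0// subr_gt0.
have : (fun h : R => h^-1 *: ((U \o shift Y0) (h *: v) - U Y0)) @ 0^' --> 'D_v U Y0.
  exact: diff_derivable.
move=> /cvgrPdist_lt/(_ _ g0)[r /= r0 hr].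
pose t := Num.min e (Num.min r (g / 2 / (`|b| + 1))) / 2.
have b1 : 0 < `|b| + 1 by rewrite ltr_wpDl.
have m0 : 0 < Num.min e (Num.min r (g / 2 / (`|b| + 1))).
  by rewrite !lt_min e0 r0 divr_gt0.
have t0 : 0 < t by rewrite divr_gt0.
have tm : t < Num.min e (Num.min r (g / 2 / (`|b| + 1))).
  by rewrite /t ltr_pdivrMr// ltr_pMr// ltr1n.
move: (tm); rewrite !lt_min => /and3P[te tr tb].
have := hr t; rewrite /ball_ /= sub0r normrN gtr0_norm// => /(_ tr).
rewrite gt_eqF// => /(_ isT).
rewrite ltr_norml => /andP[_].
have := hU t; rewrite t0 te => /(_ isT); rewrite [Y0 + _]addrC => h.
have : t^-1 *: (U (t *: v + Y0) - U Y0) <= a + b * t.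
  rewrite /GRing.scale /= mulrC ler_pdivrMr// mulrDl -mulrA -expr2.
  exact: h.
have : b * t < g / 2.
  apply: le_lt_trans (ler_norm _) _; rewrite normrM (gtr0_norm t0).
  move: tb; rewrite ltr_pdivlMr// => h1.
  apply: le_lt_trans h1; rewrite mulrC ler_wpM2l ?(ltW t0)// lerDl.
  exact: ler01.
rewrite /g; move: (_ *: _) ('D_v U Y0) (b * t) => x y z; lra.
Qed.

(** The bounds [K / rho] are the ones invariant under dilation. With [Y = Y0], nonpositivity of the
    doubled function bounds the increments of [U] from [Y0] by a linear term of slope [4 M m / rho]
    plus a quadratic one; the derivative at [Y0] follows, in the directions [v] and [- v]. *)
Lemma interior_gradient n (lam Lam K : R) : 0 < lam -> 0 <= Lam -> 0 <= K ->
  exists2 C : R, 0 < C & forall (D : set 'rV[R]_n) (U : 'rV[R]_n -> R)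
    (A : 'rV[R]_n -> 'M[R]_n) (B : 'rV[R]_n -> 'rV[R]_n) (Y0 : 'rV[R]_n) (rho m : R),
  let Bal := [set X | enorm (X - Y0) <= rho] in
  open D -> C2on D U -> Bal `<=` D -> (forall X, Bal X -> `|U X| <= m) ->
  (forall X, Bal X -> (A X)^T = A X) ->
  (forall X, Bal X -> forall v, lam * enorm2 v <= quad (A X) v <= Lam * enorm2 v) ->
  (forall X Y, Bal X -> Bal Y ->
    forall v, `|quad (A Y - A X) v| <= K / rho * enorm (X - Y) * enorm2 v) ->
  (forall X, Bal X -> enorm (B X) <= K / rho) ->
  (forall X, Bal X -> \tr (A X *m hess U X) + dot (B X) (grd U X) = 0) ->
  0 < rho -> 0 < m ->
  forall v, `|dot v (grd U Y0)| <= C * m / rho * enorm v.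
Proof.
move=> lam0 Lam0 K0.
(* After division by [m / rho ^+ 2], the left side of the condition [c4] is at most [T * M] because
   [M >= 1], while the right side is [8 lam M^2]. So [M] is chosen with [8 lam M > T]; its term in
   [K] provides [c3]. *)
pose T := 4 * lam + 8 * n%:R * Lam + 12 * n%:R * K + 6 * n%:R * lam + 16 * K.
have n0 : 0 <= n%:R :> R by rewrite ler0n.
have T0 : 0 <= T by rewrite !addr_ge0 ?mulr_ge0// ltW.
pose M := 1 + 2 * K / lam + T / (8 * lam).
have M1 : 1 <= M.
  by rewrite /M -addrA lerDl addr_ge0// divr_ge0 ?mulr_ge0 ?(ltW lam0).
have lamM : 8 * lam * M = 8 * lam + 16 * K + T by rewrite /M; field; rewrite gt_eqF.
have M0 : 0 < M by apply: lt_le_trans M1.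
exists (4 * M); first by rewrite mulr_gt0.
move=> D U A B Y0 rho m Bal oD U2 BD Um As Ab AL Bb eqU rho0 m0.
have rn : rho != 0 by rewrite gt_eqF.
have k0 : 0 < 2 * m / rho ^+ 2 by rewrite divr_gt0 ?mulr_gt0 ?exprn_gt0.
have l0 : 0 < 4 * M * m / rho by rewrite divr_gt0 ?mulr_gt0.
have Mp0 : 0 < M / rho by rewrite divr_gt0.
have Kr0 : 0 <= K / rho by rewrite divr_ge0// ltW.
have P := @ishii_Phi_le0 R n D U A B Y0 rho m lam Lam (K / rho) (K / rho)
   (4 * M * m / rho) (M / rho) (2 * m / rho ^+ 2) oD U2 BD Um As Ab AL Bb eqU
   lam0 Kr0 l0 Mp0 k0.
have q1 : 2 * m <= 2 * m / rho ^+ 2 * rho ^+ 2 by rewrite divfK// expf_eq0.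
have q2 : 4 * m * (M / rho) <= 4 * M * m / rho by rewrite le_eqVlt; apply/orP; left; apply/eqP; field.
have q3 : K / rho <= lam / 2 * (M / rho).
  rewrite mulrA ler_pM2r ?invr_gt0//; move: lamM T0 lam0; lra.
have q4 : 2 * (2 * m / rho ^+ 2) * lam + 4 * (2 * m / rho ^+ 2) * (n%:R * Lam) +
  3 * n%:R * (K / rho) * (4 * M * m / rho) + 3 * n%:R * (2 * m / rho ^+ 2) * lam +
  2 * (K / rho) * (4 * M * m / rho + 2 * (2 * m / rho ^+ 2) * rho) <
  2 * lam * (4 * M * m / rho) * (M / rho).
  have c0 : 0 < m / rho ^+ 2 by rewrite divr_gt0// exprn_gt0.
  rewrite -subr_gt0.
  rewrite (_ : _ - _ = (8 * lam * M * M - (4 * lam + 8 * n%:R * Lam + 12 * n%:R * K * M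
     + 6 * n%:R * lam + 8 * K * (M + 1))) * (m / rho ^+ 2)); last by field.
  rewrite mulr_gt0// subr_gt0.
  have h1 : 4 * lam + 8 * n%:R * Lam + 12 * n%:R * K * M + 6 * n%:R * lam + 8 * K * (M + 1)
     <= T * M.
    have e1 := ler_wpM2l (ltW lam0) M1.
    have e2 := ler_wpM2l (mulr_ge0 n0 Lam0) M1.
    have e3 := ler_wpM2l (mulr_ge0 n0 (ltW lam0)) M1.
    have e4 := ler_wpM2l K0 M1.
    by rewrite /T; move: e1 e2 e3 e4; lra.
  apply: le_lt_trans h1 _; rewrite lamM ltr_pM2r// -subr_gt0 addrK.
  by rewrite ltr_wpDr ?mulr_ge0// mulr_gt0.
have {}P X : Bal X -> M / rho * enorm (X - Y0) <= 1 ->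
    U X - U Y0 <= 4 * M * m / rho * enorm (X - Y0) + 2 * m / rho ^+ 2 * enorm2 (X - Y0).
  move=> bX hX.
  have := P q1 q2 q3 q4 X Y0; rewrite /Bal /= subrr enorm0 enorm20.
  move=> /(_ (And3 bX (ltW rho0) hX)).
  have : 0 <= 4 * M * m / rho * (M / rho / 2 * enorm2 (X - Y0)).
    by rewrite !mulr_ge0 ?enorm2_ge0 ?invr_ge0 ?ltW.
  rewrite addr0 mulrBr; move: (_ * (_ / 2 * _)) => z; lra.
have dU : differentiable U Y0.
  by have [/(_ Y0)[] //] := U2; apply: BD; rewrite /Bal /= subrr enorm0 ltW.
have main v : dot v (grd U Y0) <= 4 * M * m / rho * enorm v.
  have v1 : 0 < enorm v + 1 by rewrite ltr_wpDl// enorm_ge0.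
  apply: (@derive_le_slope n U Y0 v _ (2 * m / rho ^+ 2 * enorm2 v)
    (Num.min (rho / (enorm v + 1)) (rho / M / (enorm v + 1)))) => //.
    by rewrite lt_min !divr_gt0.
  move=> t /andP[t0]; rewrite lt_min !ltr_pdivlMr// => /andP[h1 h2].
  have E : Y0 + t *: v - Y0 = t *: v by rewrite addrC addKr.
  have nE : enorm (t *: v) = t * enorm v by rewrite enormZ gtr0_norm.
  have := P (Y0 + t *: v); rewrite /Bal /= !E nE enorm2Z => H.
  have {}H := H _ _.
  apply: le_trans (H _ _) _.
  - by move: h1; rewrite mulrDr mulr1; lra.
  - rewrite -(ler_pM2l (_ : 0 < rho / M)) ?divr_gt0// mulr1.
    rewrite (_ : rho / M * (M / rho * (t * enorm v)) = t * enorm v); last first.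
      by field; rewrite rn gt_eqF.
    rewrite ler_pdivlMr//; move: h2; rewrite (mulrDr t) mulr1 mulrDl.
    by have := mulr_gt0 t0 M0; lra.
  - by rewrite le_eqVlt; apply/orP; left; apply/eqP; ring.
move=> v; rewrite ler_norml main andbT lerNl -dotNl.
by rewrite -(enormN v) main.
Qed.

End interior_gradient.

(** * Barriers *)

Section jets.
Context {R : realType}.

(** The second-order jet of [h] at 0. The derivative is an explicit function near 0, so that jets of
    sums, products and compositions follow by rules. *)
Definition jetline (h : R -> R) (d1 d2 : R) : Prop := exists dh : R -> R,
  [/\ \forall t \near (0 : R), is_derive (t : R) 1 h (dh t), dh 0 = d1 &
      is_derive (0 : R) 1 dh d2].

Lemma near0W (P : R -> Prop) : (forall t, P t) -> \forall t \near (0 : R), P t.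
Proof. by move=> PT; exists 1 => /=. Qed.

Lemma jetlineD h1 h2 a1 a2 b1 b2 : jetline h1 a1 b1 -> jetline h2 a2 b2 ->
  jetline (fun t => h1 t + h2 t) (a1 + a2) (b1 + b2).
Proof.
move=> [g1 [n1 e1 d1]] [g2 [n2 e2 d2]]; exists (fun t => g1 t + g2 t); split.
- by apply: filterS2 n1 n2 => t i1 i2; exact: (@is_deriveD _ _ _ _ _ _ _ _ _ i1 i2).
- by rewrite e1 e2.
- exact: (@is_deriveD _ _ _ _ _ _ _ _ _ d1 d2).
Qed.

Lemma jetlineZ c h a b : jetline h a b -> jetline (fun t => c * h t) (c * a) (c * b).
Proof.
move=> [g [n e d]]; exists (fun t => c * g t); split.
- by apply: filterS n => t i; exact: (@is_deriveZ _ _ _ _ c _ _ _ i).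
- by rewrite e.
- exact: (@is_deriveZ _ _ _ _ c _ _ _ d).
Qed.

Lemma jetline_cst c : jetline (fun=> c) 0 0.
Proof.
by exists (fun=> 0); split => //; [apply: near0W => t|]; exact: is_derive_cst.
Qed.

Lemma jetline_id z : jetline (fun t => z + t) 1 0.
Proof.
exists (fun=> 1); split => //; last exact: is_derive_cst.
apply: near0W => t; apply: is_derive_eq; ring.
Qed.

Lemma jetlineM h1 h2 a1 a2 b1 b2 : jetline h1 a1 b1 -> jetline h2 a2 b2 ->
  jetline (fun t => h1 t * h2 t) (h1 0 * a2 + a1 * h2 0)
   (h1 0 * b2 + 2 * (a1 * a2) + b1 * h2 0).
Proof.
move=> [g1 [n1 e1 d1]] [g2 [n2 e2 d2]]; exists (fun t => h1 t * g2 t + g1 t * h2 t).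
split.
- apply: filterS2 n1 n2 => t i1 i2.
  apply: (is_derive_eq (@is_deriveM _ _ _ _ _ _ _ _ i1 i2)).
  by rewrite /GRing.scale /=; ring.
- by rewrite e1 e2.
- have i1 := nbhs_singleton n1; have i2 := nbhs_singleton n2.
  have := @is_deriveD _ _ _ _ _ _ _ _ _ (@is_deriveM _ _ _ _ _ _ _ _ i1 d2)
    (@is_deriveM _ _ _ _ _ _ _ _ d1 i2).
  by move/is_derive_eq; apply; rewrite /GRing.scale /= e1 e2; ring.
Qed.

Lemma jetline_comp (f f1 : R -> R) f2 (h : R -> R) a b :
  (\forall y \near h 0, is_derive (y : R) 1 f (f1 y)) -> is_derive (h 0) 1 f1 f2 ->
  jetline h a b -> jetline (f \o h) (f1 (h 0) * a) (f2 * a ^+ 2 + f1 (h 0) * b).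
Proof.
move=> fn df1 [g [n e d]]; exists (fun t => f1 (h t) * g t).
have i0 := nbhs_singleton n.
have hc : {for 0, continuous h}.
  by apply: differentiable_continuous; apply/derivable1_diffP.
have nf : \forall t \near (0 : R), is_derive (h t) 1 f (f1 (h t)) by exact: (hc _ fn).
split.
- by apply: filterS2 nf n => t i1 i2; exact: (is_derive1_comp i1 i2).
- by rewrite e.
- have c := @is_derive1_comp R f1 h 0 _ _ df1 i0.
  have := @is_deriveM _ _ _ _ _ _ _ _ c d.
  by move/is_derive_eq; apply; rewrite /GRing.scale /= e; ring.
Qed.

Lemma jetline_quadratic a b c : jetline (fun t => a + b * t + c * t ^+ 2) b (2 * c).
Proof.
exists (fun t => b + 2 * c * t); split.
- by apply: near0W => t; exact: is_derive_quadratic.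
- by rewrite mulr0 addr0.
- exact: is_derive_affine.
Qed.

Lemma jetline_eq h a b a' b' : jetline h a b -> a = a' -> b = b' -> jetline h a' b'.
Proof. by move=> ? <- <-. Qed.

Lemma jetline_ext h h' a b a' b' : jetline h a b -> h =1 h' -> a = a' -> b = b' ->
  jetline h' a' b'.
Proof. by move=> hj /funext <- <- <-. Qed.

Lemma jetline_max h a b : jetline h a b -> (\forall t \near (0 : R), h t <= h 0) ->
  a = 0 /\ b <= 0.
Proof.
move=> [g [n e d]] hm.
have [r /= r0 H] := filterI n hm.
have H' (t : R) : `|t| < r -> is_derive t 1 h (g t) /\ h t <= h 0.
  by move=> tr; apply: H; rewrite /ball_ /= sub0r normrN.
rewrite -e; apply: (@second_derivative_max R h g b r) => // t /H' [] //.
Qed.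

Lemma jetline_powR (z c : R) : 0 < z ->
  jetline (fun t => (z + t) `^ c) (c * z `^ (c - 1)) (c * (c - 1) * z `^ (c - 2)).
Proof.
move=> z0.
have n1 : \forall y \near z, is_derive (y : R) 1 (fun y => y `^ c) (c * y `^ (c - 1)).
  have : \forall y \near z, 0 < y.
    by exists z => //= y; rewrite /ball_ /= ltr_norml => /andP[_]; rewrite ltrBlDr ltrDl.
  by apply: filterS => y y0; exact: is_derive1_powR.
have d1 : is_derive z 1 (fun y => c * y `^ (c - 1)) (c * ((c - 1) * z `^ (c - 1 - 1))).
  exact: (@is_deriveZ _ _ _ _ c _ _ _ (is_derive1_powR (c - 1) z0)).
have H := @jetline_comp (fun y => y `^ c) (fun y => c * y `^ (c - 1))
  (c * ((c - 1) * z `^ (c - 1 - 1))) (fun t => z + t) 1 0.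
rewrite /= addr0 in H; apply: (jetline_eq (H n1 d1 (jetline_id z))); first by ring.
by rewrite (_ : c - 1 - 1 = c - 2); ring.
Qed.

End jets.

Section operator.
Context {R : realType} {n : nat}.
Variables (a : 'M[R]_n) (b : 'rV[R]_n) (s : R).
Implicit Types (W V : 'rV[R]_n -> R -> R).

(* [Lval W x z v]: at [(x, z)] the operator
   a^ij d_ij + b^i d_i + d_zz + (1 - s) / z d_z maps [W] to [v]. *)
Definition Lval W x z v : Prop := exists p P pz pzz,
  [/\ forall xi, jetline (fun t => W (x + t *: xi) z) (dot xi p) (quad P xi),
      jetline (fun t => W x (z + t)) pz pzz &
      v = \tr (a *m P) + dot b p + pzz + (1 - s) / z * pz].

Lemma LvalD W V x z v w : Lval W x z v -> Lval V x z w ->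
  Lval (fun x z => W x z + V x z) x z (v + w).
Proof.
move=> [p [P [pz [pzz [h1 h2 ->]]]]] [q [Q [qz [qzz [k1 k2 ->]]]]].
exists (p + q), (P + Q), (pz + qz), (pzz + qzz); split.
- by move=> xi; rewrite dotDr quadD; apply: jetlineD.
- exact: jetlineD.
- by rewrite mulmxDr mxtraceD dotDr; ring.
Qed.

Lemma LvalZ c W x z v : Lval W x z v -> Lval (fun x z => c * W x z) x z (c * v).
Proof.
move=> [p [P [pz [pzz [h1 h2 ->]]]]].
exists (c *: p), (c *: P), (c * pz), (c * pzz); split.
- by move=> xi; rewrite dotZr quadZ; apply: jetlineZ.
- exact: jetlineZ.
- by rewrite -scalemxAr mxtraceZ dotZr; ring.
Qed.

Lemma LvalB W V x z v w : Lval W x z v -> Lval V x z w ->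
  Lval (fun x z => W x z - V x z) x z (v - w).
Proof.
move=> h1 h2; rewrite -mulN1r.
rewrite (_ : (fun x z => _) = (fun x z => W x z + -1 * V x z)).
  by apply: LvalD => //; exact: LvalZ.
by apply/funext => x'; apply/funext => z'; rewrite mulN1r.
Qed.

Lemma Lval_cst c x z : Lval (fun _ _ => c) x z 0.
Proof.
exists 0, 0, 0, 0; split.
- move=> xi; rewrite dot0r /quad mulmx0 mul0mx mxE; exact: jetline_cst.
- exact: jetline_cst.
- by rewrite mulmx0 mxtrace0 dot0r mulr0 !addr0.
Qed.

Lemma Lval_sum_le (I : eqType) (r : seq I) (W : I -> 'rV[R]_n -> R -> R) x z :
  (forall i, i \in r -> exists2 v, v <= 0 & Lval (W i) x z v) ->
  exists2 v, v <= 0 & Lval (fun x z => \sum_(i <- r) W i x z) x z v.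
Proof.
elim: r => [|i r IH] h.
  exists 0 => //; under eq_fun do under eq_fun do rewrite big_nil; exact: Lval_cst.
have [v v0 Lv] := h i (mem_head _ _).
have [w w0 Lw] := IH (fun j jr => h j ltac:(by rewrite inE jr orbT)).
exists (v + w); first by rewrite -[0]addr0 lerD.
under eq_fun do under eq_fun do rewrite big_cons; exact: LvalD.
Qed.

(** Maxima along lines are enough: they give a vanishing gradient and a nonpositive Hessian form,
    whose trace against the nonnegative [a] is nonpositive. *)
Lemma Lval_max V x z v : a^T = a -> (forall u, 0 <= quad a u) -> Lval V x z v ->
  (forall xi, \forall t \near (0 : R), V (x + t *: xi) z <= V x z) ->
  (\forall t \near (0 : R), V x (z + t) <= V x z) -> v <= 0.
Proof.
move=> As a0 [p [P [pz [pzz [h1 h2 ->]]]]] m1 m2.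
have {}m1 xi : dot xi p = 0 /\ quad P xi <= 0.
  by apply: jetline_max (h1 xi) _; rewrite scale0r addr0.
have [-> pzz0] : pz = 0 /\ pzz <= 0 by apply: jetline_max h2 _; rewrite addr0.
rewrite (m1 b).1 mulr0 !addr0.
have : \tr (a *m P) <= 0 * \tr a by apply: psd_trace_le => // u; rewrite mul0r; apply: (m1 u).2.
by rewrite mul0r => h; rewrite -[0]addr0 lerD.
Qed.

(** For a function [f] of the form [tau], the gradient is [2 f' g] and the Hessian
    [4 f'' g^T g + 2 f' G]. Only the dependence on [x] at the given height is assumed radial; the
    vertical jet is left free. *)
Lemma Lval_radial W (G : 'M[R]_n) (y x : 'rV[R]_n) z (f f1 : R -> R) f2 pz pzz :
  let tau := quad G (x - y) in let g := (x - y) *m G in G^T = G ->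
  (forall x, W x z = f (quad G (x - y))) ->
  (\forall t \near tau, is_derive (t : R) 1 f (f1 t)) -> is_derive tau 1 f1 f2 ->
  jetline (fun t => W x (z + t)) pz pzz ->
  Lval W x z (4 * f2 * quad a g + 2 * f1 tau * (\tr (a *m G) + dot b g) + pzz
     + (1 - s) / z * pz).
Proof.
move=> tau g Gs Wf fn df1 jz.
exists ((2 * f1 tau) *: g), ((4 * f2) *: (g^T *m g) + (2 * f1 tau) *: G), pz, pzz.
split=> //; last first.
  rewrite mulmxDr -!scalemxAr !raddfD /= !mxtraceZ [\tr (a *m (g^T *m g))]mxtrace_mulC.
  by rewrite trace_dyad dotZr; ring.
move=> xi; pose be := dot g xi; pose ga := quad G xi.
have E t : quad G (x + t *: xi - y) = tau + 2 * be * t + ga * t ^+ 2.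
  rewrite addrAC quadDr// dotZr quadZr /tau /be /ga /g; ring.
have -> : (fun t => W (x + t *: xi) z) =
    f \o (fun t => tau + 2 * be * t + ga * t ^+ 2).
  by apply/funext => t; rewrite Wf E.
have q0 : tau + 2 * be * 0 + ga * 0 ^+ 2 = tau by rewrite expr0n !mulr0 !addr0.
have H := @jetline_comp R f f1 f2 (fun t => tau + 2 * be * t + ga * t ^+ 2)
  (2 * be) (2 * ga).
rewrite /= q0 in H.
apply: (jetline_eq (H fn df1 (jetline_quadratic tau (2 * be) ga))).
  by rewrite dotZr dotC -/be; ring.
by rewrite quadD !quadZ quad_dyad dotC -/be -/ga; ring.
Qed.

End operator.

Section operator_C2.
Context {R : realType} {n : nat}.

Definition pt (x : 'rV[R]_n) (z : R) : 'rV[R]_(n + 1) := row_mx x z%:M.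

Lemma pt_line x z (xi : 'rV[R]_n) t : pt (x + t *: xi) z = pt x z + t *: row_mx xi 0.
Proof. by rewrite /pt scale_row_mx add_row_mx scaler0 addr0. Qed.

Lemma pt_vert x z t : pt x (z + t) = pt x z + t *: row_mx 0 1%:M.
Proof. by rewrite /pt scale_row_mx add_row_mx scaler0 addr0 scale_scalar_mx mulr1 raddfD. Qed.

Lemma dot_row_mx (u : 'rV[R]_n) (c : 'rV[R]_1) (w : 'rV[R]_(n + 1)) :
  dot (row_mx u c) w = dot u (lsubmx w) + dot c (rsubmx w).
Proof. by rewrite -{1}[w]hsubmxK /dot tr_row_mx mul_row_col mxE. Qed.

Lemma dot1 (c d : 'rV[R]_1) : dot c d = c 0 0 * d 0 0.
Proof. by rewrite dotE big_ord1. Qed.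

Lemma Lval_C2 (a : 'M[R]_n) b s (D : set 'rV[R]_(n + 1)) U x z :
  open D -> C2on D U -> D (pt x z) ->
  Lval a b s (fun x z => U (pt x z)) x z
    (\tr (block_mx a 0 0 1%:M *m hess U (pt x z)) +
     dot (row_mx b ((1 - s) / z)%:M) (grd U (pt x z))).
Proof.
move=> oD U2 DY; set Y := pt x z; set H := hess U Y; set g := grd U Y.
have jet v : jetline (fun t => U (Y + t *: v)) (dot v g) (quad H v).
  exists (fun t => \sum_i v 0 i * partial i U (Y + t *: v)); split.
  - have : \forall t \near (0 : R), D (Y + t *: v).
      have : continuous (fun t : R => Y + t *: v).
        by move=> t; apply: cvgD; [exact: cvg_cst|apply: cvgZr_tmp; exact: cvg_id].
      move=> /(_ 0)/=; rewrite /continuous_at scale0r addr0; apply.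
      by apply: open_nbhs_nbhs; split.
    by apply: filterS => t Dt; apply: is_derive_partials; have [] := U2.1 _ Dt.
  - by rewrite scale0r addr0 dot_grd.
  - by have := @is_derive_hess R _ D U Y v 0 U2; rewrite scale0r addr0; apply.
exists (lsubmx g), (ulsubmx H), (rsubmx g 0 0), (drsubmx H 0 0); split.
- move=> xi.
  have := jet (row_mx xi 0).
  rewrite -{1}[H]submxK quad_row_mx dot_row_mx (mul0mx _ (dlsubmx H)).
  rewrite ![dot 0 _]dotC !dot0r quad0r !addr0.
  by under eq_fun do rewrite -pt_line.
- have := jet (row_mx 0 1%:M).
  rewrite -{1}[H]submxK quad_row_mx dot_row_mx (mul0mx _ (ursubmx H)).
  rewrite ![dot 0 _]dotC !dot0r quad0r !add0r.
  have e1 : (1%:M : 'rV[R]_1) 0 0 = 1 by rewrite mxE.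
  rewrite dot1 quad_sum !big_ord1 e1 !mul1r mulr1.
  by under eq_fun do rewrite -pt_vert.
- rewrite -{1}[H]submxK mulmx_block (mul0mx _ (dlsubmx H)).
  rewrite (mul0mx _ (ursubmx H)) addr0 add0r (mul1mx (drsubmx H)) mxtrace_block.
  have tr1 (M : 'M[R]_1) : \tr M = M 0 0 by rewrite /mxtrace big_ord1.
  have e1 (c : R) : (c%:M : 'rV[R]_1) 0 0 = c by rewrite mxE.
  by rewrite dot_row_mx dot1 e1 tr1; ring.
Qed.

End operator_C2.

Section barriers.
Context {R : realType}.

Lemma powRB1 (z c : R) : 0 < z -> z `^ (c - 1) = z `^ c / z.
Proof.
move=> z0; have zn : z != 0 by rewrite gt_eqF.
apply: (mulIf zn); rewrite divfK// -{2}(powRr1 (ltW z0)) -powRD ?subrK//.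
by apply/implyP.
Qed.

Lemma powRB2 (z c : R) : 0 < z -> z `^ (c - 2) = z `^ c / z ^+ 2.
Proof.
move=> z0; rewrite (_ : c - 2 = c - 1 - 1); last by ring.
by rewrite !powRB1//; field; rewrite gt_eqF.
Qed.

Lemma Lval_eq n (a : 'M[R]_n) b s W (x : 'rV[R]_n) z v w :
  Lval a b s W x z v -> v = w -> Lval a b s W x z w.
Proof. by move=> ? <-. Qed.

Lemma Lval_vertical n (a : 'M[R]_n) b s (h : R -> R) (x : 'rV[R]_n) z pz pzz :
  jetline (fun t => h (z + t)) pz pzz ->
  Lval a b s (fun _ z => h z) x z (pzz + (1 - s) / z * pz).
Proof.
move=> hj; exists 0, 0, pz, pzz; split => //.
  by move=> xi; rewrite dot0r /quad mulmx0 mul0mx mxE; exact: jetline_cst.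
by rewrite mulmx0 mxtrace0 dot0r !add0r.
Qed.

(** [z^s] is annihilated, and [z^(s + 2)] is mapped to [(s + 2) ((s + 1) + (1 - s)) z^s]. *)
Lemma Lval_height n (a : 'M[R]_n) b s (x : 'rV[R]_n) z : 0 < z ->
  Lval a b s (fun _ z => z `^ s * (2 - z ^+ 2)) x z (- (2 * (2 + s)) * z `^ s).
Proof.
move=> z0; have j1 := jetline_powR s z0.
have j2 : jetline (fun t => 2 - (z + t) ^+ 2) (- 2 * z) (- 2).
  by apply: (jetline_ext (jetline_quadratic (2 - z ^+ 2) (- 2 * z) (- 1))) => [t||] /=; ring.
have := @Lval_vertical n a b s (fun z => z `^ s * (2 - z ^+ 2)) x z _ _ (jetlineM j1 j2).
rewrite !addr0 powRB1// powRB2// => /Lval_eq; apply.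
by field; rewrite gt_eqF.
Qed.

Section vertical_profile.
Variable s : R.

(** The vertical operator maps [z^c] to [c (c - s) z^(c - 2)], which changes sign at [s = c]; hence
    the two cases. The exponent 3/2 with a minus sign for [s <= 1], and 1/2 for [s > 1], both give a
    value at most [- z^(- 1/2) / 4] on (0, 1]. *)
Definition profile (z : R) : R := if s <= 1 then 1 - z `^ (3 / 2) else z `^ (1 / 2).

Lemma profile01 z : 0 < z <= 1 -> 0 <= profile z <= 1.
Proof.
move=> /andP[z0 z1]; rewrite /profile.
have p (c : R) : 0 <= c -> 0 <= z `^ c <= 1.
  move=> c0; rewrite powR_ge0 /= (_ : 1 = 1 `^ c); last by rewrite powR1.
  by apply: ge0_ler_powR => //; rewrite nnegrE ltW.
have /andP[a1 a2] : 0 <= z `^ (3 / 2) <= 1 by apply: p; lra.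
have /andP[b1 b2] : 0 <= z `^ (1 / 2) <= 1 by apply: p; lra.
by case: ifP => _; apply/andP; split; lra.
Qed.

Lemma jet_profile z : 0 < z <= 1 -> exists pz pzz,
  jetline (fun t => profile (z + t)) pz pzz /\
  pzz + (1 - s) / z * pz <= - (1 / 4) * z `^ (- (1 / 2)).
Proof.
move=> /andP[z0 z1]; rewrite /profile; case: (leP s 1) => s1.
  exists (0 + (-1) * (3 / 2 * z `^ (3 / 2 - 1))),
    (0 + (-1) * (3 / 2 * (3 / 2 - 1) * z `^ (3 / 2 - 2))); split.
    apply: (jetline_ext (jetlineD (jetline_cst 1) (jetlineZ (-1)
      (jetline_powR (3 / 2) z0)))) => // t /=.
    by rewrite mulN1r.
  rewrite (_ : - (1 / 2) = 3 / 2 - 2 :> R); last by field.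
  rewrite powRB1// powRB2//.
  have P : 0 < z `^ (3 / 2) / z ^+ 2 by rewrite divr_gt0 ?powR_gt0 ?exprn_gt0.
  rewrite (_ : _ + _ = - (3 / 2 * (3 / 2 - s)) * (z `^ (3 / 2) / z ^+ 2)).
    by rewrite ler_pM2r//; lra.
  by field; rewrite gt_eqF.
exists (1 / 2 * z `^ (1 / 2 - 1)), (1 / 2 * (1 / 2 - 1) * z `^ (1 / 2 - 2)); split.
  exact: jetline_powR.
have h1 : z `^ (- (1 / 2)) <= z `^ (1 / 2 - 2).
  rewrite (_ : - (1 / 2) = 1 / 2 - 1 :> R); last by field.
  rewrite powRB1// powRB2// ler_wpM2l ?powR_ge0// lef_pV2 ?posrE ?exprn_gt0//.
  by rewrite expr2 ger_pMr.
have P : 0 < z `^ (1 / 2) / z ^+ 2 by rewrite divr_gt0 ?powR_gt0 ?exprn_gt0.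
apply: (@le_trans _ _ (- (1 / 4) * z `^ (1 / 2 - 2))); last by move: h1; lra.
rewrite powRB1// powRB2//.
rewrite (_ : _ + _ = - (1 / 2 * (s - 1 / 2)) * (z `^ (1 / 2) / z ^+ 2)).
  by rewrite ler_pM2r//; lra.
by field; rewrite gt_eqF.
Qed.

(** With [t] the squared distance, the horizontal part of the operator costs a multiple of [t^4],
    while the profile gains [z^(- 1/2) t^5 / 4]. The gain wins once [t] exceeds a multiple of
    [z^(1/2)]; below that, [t^4] is at most a multiple of [z^2 <= z^s], which the height barrier
    absorbs. This dictates the exponent 5. *)
Lemma Lval_bowl n (a : 'M[R]_n) (b : 'rV[R]_n) (hi K : R) (y x : 'rV[R]_n) z :
  a^T = a -> (forall v, 0 <= quad a v <= hi * enorm2 v) -> enorm b <= K -> 0 <= K ->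
  0 < z <= 1 -> enorm (x - y) <= 1 ->
  exists2 v, v <= 2 * (80 * hi + 10 * (n%:R * hi + K)) * enorm2 (x - y) ^+ 4
       - 1 / 4 * z `^ (- (1 / 2)) * enorm2 (x - y) ^+ 5 &
   Lval a b s (fun x z => enorm2 (x - y) ^+ 5 * (1 + profile z)) x z v.
Proof.
move=> As ab bK K0 z01 xy1.
have [pz [pzz [jp Lp]]] := jet_profile z01.
have /andP[p0 p1] := profile01 z01.
set t := enorm2 (x - y); have t0 : 0 <= t by exact: enorm2_ge0.
have jz := jetlineZ (t ^+ 5) (jetlineD (jetline_cst 1) jp).
have tE : t = quad 1%:M (x - y) by rewrite quad_scalar mul1r.
pose c := 1 + profile z.
have fn : \forall u \near quad 1%:M (x - y),
    is_derive (u : R) 1 (fun u => u ^+ 5 * c) (5 * u ^+ 4 * c).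
  near=> u; apply: is_derive_eq; rewrite /GRing.scale /=; ring.
have fd : is_derive (quad 1%:M (x - y)) 1 (fun u => 5 * u ^+ 4 * c) (20 * t ^+ 3 * c).
  rewrite -tE; apply: is_derive_eq; rewrite /GRing.scale /=; ring.
have Wf x' : enorm2 (x' - y) ^+ 5 * (1 + profile z) = quad 1%:M (x' - y) ^+ 5 * c.
  by rewrite quad_scalar mul1r.
have H := @Lval_radial R n a b s (fun x z => enorm2 (x - y) ^+ 5 * (1 + profile z))
  1%:M y x z (fun u => u ^+ 5 * c) _ _ _ _ (trmx1 _ _) Wf fn fd jz.
rewrite -tE !mulmx1 in H; eexists; last exact: H.
have /andP[q0 q1] := ab (x - y).
have trb : 0 * enorm2 (0 : 'rV[R]_n) <= \tr a <= n%:R * hi.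
  rewrite mul0r; have ab' v : 0 * enorm2 v <= quad a v <= hi * enorm2 v by rewrite mul0r ab.
  by have := quad_trace_bounds ab'; rewrite mulr0.
have db : `|dot b (x - y)| <= K.
  apply: le_trans (normr_dot_le _ _) _; rewrite -[leRHS]mulr1 ler_pM ?enorm_ge0//.
have c2 : 0 <= c <= 2 by rewrite /c; apply/andP; split; lra.
rewrite -/t in q1 *.
have t3 : 0 <= t ^+ 3 by rewrite exprn_ge0.
have t4 : 0 <= t ^+ 4 by rewrite exprn_ge0.
have t5 : 0 <= t ^+ 5 by rewrite exprn_ge0.
have h1 : 4 * (20 * t ^+ 3 * c) * quad a (x - y) <= 2 * (80 * hi) * t ^+ 4.
  have e1 : t ^+ 3 * quad a (x - y) <= hi * t ^+ 4.
    by apply: le_trans (ler_wpM2l t3 q1) _; rewrite !exprS; lra.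
  have e0 : 0 <= t ^+ 3 * quad a (x - y) by rewrite mulr_ge0.
  have /andP[c0 c1] := c2.
  have := ler_pM c0 e0 c1 e1; lra.
have h2 : 2 * (5 * t ^+ 4 * c) * (\tr a + dot b (x - y)) <=
   2 * (10 * (n%:R * hi + K)) * t ^+ 4.
  have e1 : \tr a + dot b (x - y) <= n%:R * hi + K.
    by move: db trb; rewrite ler_norml => /andP[_ ?] /andP[_ ?]; lra.
  have e2 : 0 <= n%:R * hi + K.
    by move: trb => /andP[]; rewrite mul0r => ? ?; lra.
  have /andP[c0 c1] := c2.
  have e3 : 0 <= t ^+ 4 * c by rewrite mulr_ge0.
  have := ler_wpM2l e3 e1; have := ler_wpM2r (mulr_ge0 t4 e2) c1.
  lra.
have h3 : t ^+ 5 * (0 + pzz) + (1 - s) / z * (t ^+ 5 * (0 + pz)) <=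
   - (1 / 4 * z `^ (- (1 / 2)) * t ^+ 5).
  by have := ler_wpM2l t5 Lp; lra.
move: h1 h2 h3; lra.
Unshelve. all: by end_near. Qed.

End vertical_profile.
End barriers.

(** * Poisson kernels for coefficients frozen at a boundary point *)

Section poisson.
Context {R : realType}.

Section kernel.
Variables (n : nat) (ax ay : 'M[R]_n) (b : 'rV[R]_n) (s K : R) (x y : 'rV[R]_n) (z : R).
Hypotheses (s02 : 0 < s < 2) (K0 : 0 <= K) (z0 : 0 < z).
Hypotheses (ays : ay^T = ay)
  (ayb : forall v, 9 / 10 * enorm2 v <= quad ay v <= 11 / 10 * enorm2 v)
  (axy : forall v, `|quad (ax - ay) v| <= K * enorm (x - y) * enorm2 v)
  (bK : enorm b <= K).
Let G := invmx ay.
Let mu := (n%:R + s) / 2.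
Let tau := quad G (x - y).
Let q := tau + z ^+ 2.

Fact ay_unit : ay \in unitmx /\
  (forall v, (11 / 10)^-1 * enorm2 v <= quad G v <= (9 / 10)^-1 * enorm2 v).
Proof. by apply: quad_invmx_bounds => //; lra. Qed.

Fact poisson_tau_ge0 : 0 <= tau.
Proof.
have [_ /(_ (x - y)) /andP[h _]] := ay_unit; apply: le_trans h.
by rewrite mulr_ge0 ?enorm2_ge0// invr_ge0; lra.
Qed.

Fact poisson_q_gt0 : 0 < q.
Proof. by rewrite ltr_wpDl ?poisson_tau_ge0 ?exprn_gt0. Qed.

(** For the matrix frozen at [y] and no drift the value is exactly
    [4 nu (nu - mu) z^s q^(- nu - 1)], which vanishes for the Poisson kernel [nu = mu]. The
    variation of the matrix and the drift add a relative error of order [K sqrt q]. *)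
Lemma Lval_poisson_power nu : 0 <= nu -> nu <= mu ->
  exists2 v, v <= z `^ s * (q `^ (- nu) / q) *
     (nu * (4 * (nu - mu) + K * (5 * n%:R + 12) * Num.sqrt q)) &
   Lval ax b s (fun x z => z `^ s * (quad G (x - y) + z ^+ 2) `^ (- nu)) x z v.
Proof.
move=> nu0 numu.
have q0 := poisson_q_gt0; have tau0 := poisson_tau_ge0; have [ayu Gb] := ay_unit.
have Gs : G^T = G by exact: invmx_sym.
set Z := z `^ s; set Q := q `^ (- nu).
have Z0 : 0 < Z by exact: powR_gt0.
have Q0 : 0 < Q by exact: powR_gt0.
have dpow (c : R) (u : R) : 0 < u + z ^+ 2 ->
    is_derive u 1 (fun u => (u + z ^+ 2) `^ c) (c * (u + z ^+ 2) `^ (c - 1)).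
  move=> u0; have i1 : is_derive u 1 (fun u : R => u + z ^+ 2) 1.
    by apply: is_derive_eq; rewrite addr0.
  have := @is_derive1_comp R (fun y => y `^ c) (fun u => u + z ^+ 2) u _ _
    (is_derive1_powR c u0) i1.
  by rewrite mulr1.
pose f u := Z * (u + z ^+ 2) `^ (- nu).
pose f1 u := - nu * Z * (u + z ^+ 2) `^ (- nu - 1).
pose f2 := - nu * Z * ((- nu - 1) * q `^ (- nu - 1 - 1)).
have fn : \forall u \near tau, is_derive (u : R) 1 f (f1 u).
  have : \forall u \near tau, 0 < u + z ^+ 2.
    exists q => //= u; rewrite /ball_ /= ltr_norml => /andP[_]; rewrite /q.
    by move: (z ^+ 2) => zz; lra.
  apply: filterS => u u0; apply: (is_derive_eq (@is_deriveZ _ _ _ _ Z _ _ _ (dpow (- nu) u u0))).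
  by rewrite /f1 /GRing.scale /=; ring.
have fd : is_derive tau 1 f1 f2.
  exact: (@is_deriveZ _ _ _ _ (- nu * Z) _ _ _ (dpow (- nu - 1) tau q0)).
have j2 : jetline (fun t => tau + (z + t) ^+ 2) (2 * z) 2.
  by apply: (jetline_ext (jetline_quadratic q (2 * z) 1)) => [t||] /=; rewrite /q; ring.
have j3 : jetline (fun t => (tau + (z + t) ^+ 2) `^ (- nu))
    (- nu * q `^ (- nu - 1) * (2 * z))
    (- nu * ((- nu - 1) * q `^ (- nu - 1 - 1)) * (2 * z) ^+ 2 + - nu * q `^ (- nu - 1) * 2).
  have H := @jetline_comp R (fun y => y `^ (- nu)) (fun y => - nu * y `^ (- nu - 1))
    (- nu * ((- nu - 1) * q `^ (- nu - 1 - 1))) (fun t => tau + (z + t) ^+ 2) (2 * z) 2.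
  rewrite /= addr0 -/q in H; apply: H => //.
    have : \forall y \near q, 0 < y.
      by exists q => //= u; rewrite /ball_ /= ltr_norml => /andP[_]; rewrite ltrBlDr ltrDl.
    by apply: filterS => u u0; exact: is_derive1_powR.
  exact: (@is_deriveZ _ _ _ _ (- nu) _ _ _ (is_derive1_powR (- nu - 1) q0)).
have jz := jetlineM (jetline_powR s z0) j3.
have H := @Lval_radial R n ax b s (fun x z => z `^ s * (quad G (x - y) + z ^+ 2) `^ (- nu))
  G y x z f f1 f2 _ _ Gs (fun _ => erefl) fn fd jz.
eexists; last exact: H.
rewrite !addr0 -/tau -/q /f1 /f2 !powRB1// powRB2// -/q -/Z -/Q.
set g := (x - y) *m G.
have gE : quad ay g = tau.
  by rewrite /g /tau /G quad_invmx.
have g2 : enorm2 g <= 10 / 9 * q.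
  have /andP[h _] := ayb g; rewrite gE in h.
  have : tau <= q by rewrite lerDl sqr_ge0.
  move: h; lra.
have d2 : enorm2 (x - y) <= 11 / 10 * q.
  have /andP[h _] := Gb (x - y); rewrite -/tau in h.
  have : tau <= q by rewrite lerDl sqr_ge0.
  have e : (11 / 10 : R)^-1 = 10 / 11 by field.
  move: h; rewrite e; lra.
set r := Num.sqrt q; have r0 : 0 <= r by exact: sqrtr_ge0.
have r2 : r ^+ 2 = q by rewrite sqr_sqrtr// ltW.
have r11 : 0 <= 11 / 10 * r by rewrite mulr_ge0//; lra.
have gr : enorm g <= 11 / 10 * r.
  by rewrite (enorm_le _ r11) exprMn r2; apply: le_trans g2 _; rewrite ler_pM2r//; lra.
have dr : enorm (x - y) <= 11 / 10 * r.
  by rewrite (enorm_le _ r11) exprMn r2; apply: le_trans d2 _; rewrite ler_pM2r//; lra.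
have Kd : K * enorm (x - y) <= K * (11 / 10 * r) by rewrite ler_wpM2l.
have Kr : 0 <= K * (11 / 10 * r) by rewrite mulr_ge0// mulr_ge0//; lra.
have e1 : `|quad (ax - ay) g| <= K * (11 / 10 * r) * (10 / 9 * q).
  by apply: le_trans (axy g) _; rewrite ler_pM ?mulr_ge0 ?enorm_ge0 ?enorm2_ge0.
have trG : 0 <= \tr G <= n%:R * (10 / 9).
  have Gb' v : 0 * enorm2 v <= quad G v <= 10 / 9 * enorm2 v.
    have /andP[h1 h2] := Gb v; rewrite mul0r.
    have e : (9 / 10 : R)^-1 = 10 / 9 by field.
    rewrite e in h2; rewrite h2 andbT; apply: le_trans h1.
    by rewrite mulr_ge0 ?enorm2_ge0// invr_ge0; lra.
  by have := quad_trace_bounds Gb'; rewrite mulr0.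
have GP v : 0 <= quad G v.
  have /andP[h1 _] := Gb v; apply: le_trans h1.
  by rewrite mulr_ge0 ?enorm2_ge0// invr_ge0; lra.
have e2 : `|\tr ((ax - ay) *m G)| <= K * (11 / 10 * r) * (n%:R * (10 / 9)).
  have /andP[t0 t1] := trG.
  have bd S : (forall v, quad S v <= K * enorm (x - y) * enorm2 v) ->
      \tr (S *m G) <= K * (11 / 10 * r) * (n%:R * (10 / 9)).
    move=> hS; rewrite mxtrace_mulC; apply: le_trans (psd_trace_le Gs GP hS) _.
    by rewrite ler_pM ?mulr_ge0 ?enorm_ge0.
  rewrite ler_norml bd ?andbT; last first.
    by move=> v; apply: le_trans (ler_norm _) (axy v).
  rewrite lerNl -raddfN -mulNmx bd// => v; rewrite quadN.
  by apply: le_trans (axy v); rewrite -normrN ler_norm.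
have e3 : `|dot b g| <= K * (11 / 10 * r).
  by apply: le_trans (normr_dot_le _ _) _; rewrite ler_pM ?enorm_ge0.
have trE : \tr (ax *m G) = n%:R + \tr ((ax - ay) *m G).
  by rewrite mulmxBl mulmxV// raddfB /= mxtrace1 addrC subrK.
have qaE : quad ax g = tau + quad (ax - ay) g by rewrite quadD quadN gE; ring.
rewrite trE qaE.
have tauE : tau = q - z ^+ 2 by rewrite /q addrK.
rewrite tauE.
move: (quad (ax - ay) g) (\tr ((ax - ay) *m G)) (dot b g) e1 e2 e3 => E1 E2 E3 e1 e2 e3.
have qn : q != 0 by rewrite gt_eqF.
have zn : z != 0 by rewrite gt_eqF.
set X := (X in X <= _).
have -> : X = Z * (Q / q) * (nu * (4 * (nu - mu)
    + (4 * (nu + 1) * (E1 / q) - 2 * (E2 + E3)))).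
  rewrite /X /mu; field; by rewrite qn zn.
rewrite ler_wpM2l ?mulr_ge0 ?invr_ge0 ?(ltW Z0) ?(ltW Q0) ?(ltW q0)//.
rewrite ler_wpM2l// lerD2l.
have E1q : E1 / q <= K * (11 / 10 * r) * (10 / 9).
  rewrite ler_pdivrMr//.
  rewrite (_ : _ * q = K * (11 / 10 * r) * (10 / 9 * q)); last by ring.
  exact: le_trans (ler_norm _) e1.
have nub : nu + 1 <= n%:R / 2 + 2.
  by apply: le_trans (_ : mu + 1 <= _); rewrite ?lerD2r// /mu; move: s02 => /andP[]; lra.
have t1 : 4 * (nu + 1) * (E1 / q) <= 4 * (n%:R / 2 + 2) * (K * (11 / 10 * r) * (10 / 9)).
  apply: (@le_trans _ _ (4 * (nu + 1) * (K * (11 / 10 * r) * (10 / 9)))).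
    by rewrite ler_wpM2l// mulr_ge0// addr_ge0.
  have k1 : 0 <= K * (11 / 10 * r) * (10 / 9) by rewrite mulr_ge0//; lra.
  by rewrite (ler_wpM2r k1)//; lra.
move: e2 e3; rewrite !ler_norml => /andP[e2 _] /andP[e3 _].
have Kr' : 0 <= K * r by rewrite mulr_ge0.
have nKr : 0 <= n%:R * (K * r) by rewrite mulr_ge0.
(* The three errors add up to at most [(44 n / 9 + 539 / 45) K r], rounded up to
   [(5 n + 12) K r]. *)
by move: t1 e2 e3 Kr' nKr; lra.
Qed.

(** The second term is a corrector. Its exponent, lower by 1/4, makes its main term negative and of
    relative order [q^(1/4)], which dominates the error of order [q^(1/2)] of the kernel. The
    smallness of [sqrt q] keeps the corrector's own error below half of its main term, and [n > 0]
    gives [mu - 1/4 >= mu / 2]. *)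
Lemma Lval_poisson : (0 < n)%N -> q <= 1 ->
  K * (5 * n%:R + 12) * Num.sqrt q <= 1 / 2 ->
  exists2 v, v <= 0 &
   Lval ax b s (fun x z => z `^ s * (quad G (x - y) + z ^+ 2) `^ (- mu) +
    4 * (K * (5 * n%:R + 12)) *
     (z `^ s * (quad G (x - y) + z ^+ 2) `^ (- (mu - 1 / 4)))) x z v.
Proof.
move=> n0 q1 Cq; set C := K * (5 * n%:R + 12).
have q0 := poisson_q_gt0.
have n1 : 1 <= n%:R :> R by rewrite ler1n.
have /andP[s0 s2] := s02.
have mu2 : 1 / 2 <= mu by rewrite /mu; lra.
have [||v1 hv1 L1] := Lval_poisson_power (nu := mu); rewrite ?lexx//; first lra.
have [||v2 hv2 L2] := Lval_poisson_power (nu := mu - 1 / 4); [lra|lra|].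
exists (v1 + 4 * C * v2); last by apply: LvalD => //; exact: LvalZ.
have C0 : 0 <= C by rewrite mulr_ge0// addr_ge0// mulr_ge0.
set w := q `^ (1 / 4).
have w0 : 0 < w by exact: powR_gt0.
have w1 : w <= 1.
  have e : 1 `^ (1 / 4) = 1 :> R by rewrite powR1.
  rewrite -[leRHS]e.
  by apply: ge0_ler_powR => //; rewrite ?nnegrE ?(ltW q0)//; lra.
have w2 : w ^+ 2 = Num.sqrt q.
  rewrite expr2 -powRD; last by rewrite (gt_eqF q0) implybT.
  by rewrite (_ : 1 / 4 + 1 / 4 = 2^-1) ?powR12_sqrt ?(ltW q0)//; field.
have qE : q `^ (- (mu - 1 / 4)) = q `^ (- mu) * w.
  rewrite -powRD; last by rewrite (gt_eqF q0) implybT.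
  by congr powR; ring.
rewrite qE in hv2; set P := z `^ s * (q `^ (- mu) / q).
have P0 : 0 <= P by rewrite mulr_ge0 ?divr_ge0 ?powR_ge0// ltW.
rewrite -/C -w2 -/P in hv1 hv2 Cq.
apply: le_trans (lerD hv1 (ler_wpM2l _ hv2)) _; first by rewrite mulr_ge0.
set X := (X in X <= _).
have -> : X = P * (w * (mu * C * w + 4 * C * ((mu - 1 / 4) * (C * w ^+ 2 - 1)))).
  by rewrite /X /P; field; rewrite gt_eqF.
rewrite (mulr_ge0_le0 P0)// (mulr_ge0_le0 (ltW w0))//.
have m0 : 0 <= C * mu by rewrite mulr_ge0//; lra.
have h1 := ler_wpM2l m0 w1.
have h2 : (mu - 1 / 4) * (C * w ^+ 2 - 1) <= (mu / 2) * (- (1 / 2)).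
  have a1 : 0 <= mu - 1 / 4 by lra.
  apply: le_trans (_ : (mu - 1 / 4) * (- (1 / 2)) <= _); last by lra.
  by rewrite ler_wpM2l//; move: Cq; lra.
have h3 := ler_wpM2l C0 h2.
by move: h1 h3; lra.
Qed.

End kernel.
End poisson.

(** * Comparison with the barrier on a small cylinder *)

Section comparison.
Context {R : realType}.

Lemma continuous_eq (T T' : topologicalType) (f g : T -> T') (x : T) : f =1 g ->
  {for x, continuous f} -> {for x, continuous g}.
Proof. by move=> /funext ->. Qed.

Lemma powR_continuous_pos (c z : R) : 0 < z -> {for z, continuous (fun y => y `^ c)}.
Proof.
move=> z0; apply: differentiable_continuous; apply/derivable1_diffP.
by have := is_derive1_powR c z0.
Qed.

Lemma continuous_powR_comp (T : topologicalType) (f : T -> R) (c : R) (x : T) :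
  0 < f x -> {for x, continuous f} -> {for x, continuous (fun y => f y `^ c)}.
Proof.
move=> fx fc; apply: (@continuous_comp _ _ _ f (fun y => y `^ c)) => //.
exact: powR_continuous_pos. Qed.

Lemma quad_continuous (T : topologicalType) n (G : 'M[R]_n) (f : T -> 'rV[R]_n) (x : T) :
  {for x, continuous f} -> {for x, continuous (fun y => quad G (f y))}.
Proof.
move=> fc; rewrite (_ : (fun y => _) =
  (fun y => \sum_i \sum_j f y 0 i * G i j * f y 0 j)); last first.
  by apply/funext => y; rewrite quad_sum.
have h k : {for x, continuous (fun y => f y 0 k)}.
  exact: (continuous_comp fc (@coord_continuous R 1 n 0 k _)).
apply: continuous_sumr => i; apply: continuous_sumr => j.
by apply: continuousM => //; apply: continuousM => //; exact: cvg_cst.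
Qed.

(** The Poisson kernel with its corrector. In use, [G] is the inverse of the coefficient matrix at
    the centre [c]. *)
Definition poisson_barrier n (G : 'M[R]_n) (c : 'rV[R]_n) (s A : R) (x : 'rV[R]_n) (z : R) :=
  z `^ s * (quad G (x - c) + z ^+ 2) `^ (- ((n%:R + s) / 2)) +
  A * (z `^ s * (quad G (x - c) + z ^+ 2) `^ (- ((n%:R + s) / 2 - 1 / 4))).

Lemma poisson_barrier_ge0 n (G : 'M[R]_n) c s A x z : 0 <= A ->
  0 <= poisson_barrier G c s A x z.
Proof. by move=> A0; rewrite addr_ge0 ?mulr_ge0 ?powR_ge0. Qed.

Lemma powR_sqr_neg n (s z : R) : 0 < z ->
  z `^ s * (z ^+ 2) `^ (- ((n%:R + s) / 2)) = (z ^+ n)^-1.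
Proof.
move=> z0; rewrite -powR_mulrn ?ltW// -powRrM -powRD; last by rewrite (gt_eqF z0) implybT.
rewrite (_ : s + 2 * - ((n%:R + s) / 2) = - n%:R); last by field.
by rewrite powRN powR_mulrn ?ltW.
Qed.

Lemma poisson_barrier_low n (G : 'M[R]_n) c s A x (d : R) : 0 < s < 2 -> 0 <= A -> 0 < d ->
  0 <= quad G (x - c) <= d ^+ 2 ->
  1 <= 2 ^+ (n + 2) * d ^+ n * poisson_barrier G c s A x d.
Proof.
move=> /andP[s0 s2] A0 d0 /andP[q0 q1].
set mu := (n%:R + s) / 2.
have n0 : 0 <= n%:R :> R by [].
have mu0 : 0 <= mu by rewrite /mu; lra.
have d20 : 0 < d ^+ 2 by rewrite exprn_gt0.
have h1 : (d ^+ 2) `^ (- mu) <= 2 ^+ (n + 2) * (quad G (x - c) + d ^+ 2) `^ (- mu).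
  rewrite !powRN -ler_pdivrMl ?exprn_gt0// -invfM lef_pV2 ?posrE ?mulr_gt0 ?powR_gt0 ?exprn_gt0//;
    last by rewrite ltr_wpDl.
  apply: (@le_trans _ _ ((2 * d ^+ 2) `^ mu)).
    by apply: ge0_ler_powR => //; rewrite ?nnegrE ?addr_ge0 ?mulr_ge0 ?(ltW d20)//; lra.
  rewrite powRM ?(ltW d20)//.
  rewrite ler_pM2r ?powR_gt0//.
  rewrite -powR_mulrn// ler_powR ?ler1n// natrD /mu; lra.
rewrite /poisson_barrier -/mu mulrDr.
have h2 : 0 <= 2 ^+ (n + 2) * d ^+ n * (A *
   (d `^ s * (quad G (x - c) + d ^+ 2) `^ (- (mu - 1 / 4)))).
  by rewrite !mulr_ge0 ?powR_ge0 ?exprn_ge0// ltW.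
have dn : 0 < d ^+ n by rewrite exprn_gt0.
have ds : 0 < d `^ s by rewrite powR_gt0.
suff : 1 <= 2 ^+ (n + 2) * d ^+ n * (d `^ s * (quad G (x - c) + d ^+ 2) `^ (- mu)).
  by move: h2; lra.
have e : d ^+ n * (d `^ s * (d ^+ 2) `^ (- mu)) = 1.
  by rewrite powR_sqr_neg// mulfV// gt_eqF.
rewrite -[leLHS]e.
rewrite [leRHS](_ : _ = d ^+ n * (d `^ s * (2 ^+ (n + 2) * (quad G (x - c) + d ^+ 2) `^ (- mu))));
  last by ring.
by rewrite !ler_pM2l.
Qed.

Lemma poisson_barrier_high n (G : 'M[R]_n) c s A x (z : R) : (0 < n)%N -> 0 < s < 2 ->
  0 <= A -> 0 < z ->
  0 <= quad G (x - c) -> quad G (x - c) + z ^+ 2 <= 1 ->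
  poisson_barrier G c s A x z <= (1 + A) * (z ^+ n)^-1.
Proof.
move=> n0 /andP[s0 s2] A0 z0 q0; rewrite /poisson_barrier.
set q := quad G (x - c) + z ^+ 2 => q1.
set mu := (n%:R + s) / 2.
have n1 : 1 <= n%:R :> R by rewrite ler1n.
have z20 : 0 < z ^+ 2 by rewrite exprn_gt0.
have qp : 0 < q by rewrite ltr_wpDl.
have h1 : q `^ (- mu) <= (z ^+ 2) `^ (- mu).
  rewrite !powRN lef_pV2 ?posrE ?powR_gt0//.
  by apply: ge0_ler_powR; rewrite ?nnegrE ?(ltW z20) ?(ltW qp)//; rewrite /mu ?lerDr//; lra.
have h2 : q `^ (- (mu - 1 / 4)) <= q `^ (- mu).
  rewrite (_ : - (mu - 1 / 4) = - mu + 1 / 4); last by ring.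
  rewrite powRD; last by rewrite (gt_eqF qp) implybT.
  rewrite -[leRHS]mulr1 ler_wpM2l ?powR_ge0//.
  have e : 1 `^ (1 / 4) = 1 :> R by rewrite powR1.
  by rewrite -[leRHS]e ge0_ler_powR// ?nnegrE ?(ltW qp)//; lra.
rewrite -(powR_sqr_neg n s z0) -/mu mulrDl [X in _ <= X + _]mul1r.
have zs : 0 <= z `^ s by exact: powR_ge0.
apply: lerD; first exact: (ler_wpM2l zs).
by apply: (ler_wpM2l A0); apply: (ler_wpM2l zs); exact: le_trans h1.
Qed.

Section cylinder_comparison.
Variables (n : nat) (K : R).
Hypothesis K0 : 0 < K.

(** For a point within [r] and a centre within [2 r] of the axis, [sqrt q <= 4 r]; the radius makes
    this small enough for [Lval_poisson], including [q <= 1]. *)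
Definition cmp_radius : R := (10 + 8 * (K * (5 * n%:R + 12)))^-1.

Lemma cmp_radius_bounds : [/\ 0 < cmp_radius, cmp_radius <= 1 / 10 &
  4 * cmp_radius * (K * (5 * n%:R + 12)) <= 1 / 2].
Proof.
set c := K * (5 * n%:R + 12).
have c0 : 0 < c by rewrite mulr_gt0// ltr_wpDl ?mulr_ge0.
have d0 : 0 < 10 + 8 * c by lra.
have r0 : 0 < cmp_radius by rewrite /cmp_radius -/c invr_gt0.
have e : cmp_radius * (10 + 8 * c) = 1 by rewrite /cmp_radius -/c mulVf// gt_eqF.
have rc : 0 <= cmp_radius * c by rewrite mulr_ge0 ?(ltW r0) ?(ltW c0).
by split=> //; move: r0 e rc; move: (cmp_radius) => r; lra.
Qed.

Let r := cmp_radius.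
(** [C1] is the constant of [Lval_bowl] for a matrix bounded by 11/10, [A] that of the corrector in
    [Lval_poisson]. [alp] makes the bowl at least 1 on the lateral boundary; in [B], the first
    summand makes the height term at least 1 on the top, and the second absorbs the positive part of
    the bowl. *)
Let C1 : R := 2 * (80 * (11 / 10) + 10 * (n%:R * (11 / 10) + K)).
Let alp : R := (r ^+ 10)^-1.
Let B : R := (r ^+ 2)^-1 + alp * C1 * (4 * C1) ^+ 4.
Let A : R := 4 * (K * (5 * n%:R + 12)).

Definition cmp_const : R := 2 * B + 2 ^+ (n + 2) * (1 + A).

Fact C1_ge0 : 0 <= C1.
Proof. by rewrite /C1; have : 0 <= n%:R :> R by []; move: K0; lra. Qed.

Fact A_ge0 : 0 <= A.
Proof. by rewrite /A !mulr_ge0 ?(ltW K0)// addr_ge0// mulr_ge0. Qed.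

Fact alp_gt0 : 0 < alp.
Proof. by have [r0 _ _] := cmp_radius_bounds; rewrite invr_gt0 exprn_gt0. Qed.

Fact B_low : (r ^+ 2)^-1 <= B.
Proof.
have h := C1_ge0; have a0 := ltW alp_gt0.
rewrite /B lerDl; apply: (mulr_ge0 (mulr_ge0 a0 h)); apply: exprn_ge0.
exact: (mulr_ge0 _ h).
Qed.

Fact B_gt0 : 0 < B.
Proof.
have [r0 _ _] := cmp_radius_bounds.
by apply: lt_le_trans B_low; rewrite invr_gt0 exprn_gt0.
Qed.

Lemma cmp_const_gt0 : 0 < cmp_const.
Proof.
rewrite /cmp_const ltr_wpDr// ?mulr_gt0 ?B_gt0// mulr_ge0 ?exprn_ge0//.
by rewrite addr_ge0 ?A_ge0.
Qed.

Section maximum_principle.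
Variables (s : R) (a : 'rV[R]_n -> 'M[R]_n) (b : 'rV[R]_n -> 'rV[R]_n).
Variables (D : set 'rV[R]_(n + 1)) (U : 'rV[R]_(n + 1) -> R) (x0 : 'rV[R]_n).
Variables (d e m : R) (S : seq 'rV[R]_n).
Hypotheses (s02 : 0 < s < 2) (oD : open D) (U2 : C2on D U).
Hypothesis DD : forall x z, enorm (x - x0) <= r -> 0 < z <= r -> D (pt x z).
Hypothesis as_ : forall x, enorm (x - x0) <= 2 * r -> (a x)^T = a x.
Hypothesis ab : forall x, enorm (x - x0) <= 2 * r -> forall v,
  9 / 10 * enorm2 v <= quad (a x) v <= 11 / 10 * enorm2 v.
Hypothesis aL : forall x y, enorm (x - x0) <= 2 * r -> enorm (y - x0) <= 2 * r ->
  forall v, `|quad (a x - a y) v| <= K * enorm (x - y) * enorm2 v.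
Hypothesis bb : forall x, enorm (x - x0) <= 2 * r -> enorm (b x) <= K.
Hypothesis eqU : forall x z, enorm (x - x0) <= r -> 0 < z <= r ->
  \tr (block_mx (a x) 0 0 1%:M *m hess U (pt x z)) +
     dot (row_mx (b x) ((1 - s) / z)%:M) (grd U (pt x z)) = 0.
Hypothesis Um : forall x z, enorm (x - x0) <= r -> 0 < z <= r -> U (pt x z) <= m.
Hypotheses (m0 : 0 < m) (e0 : 0 <= e) (d0 : 0 < d).
Hypothesis Sr : forall c, c \in S -> enorm (c - x0) <= 2 * r.
Hypothesis Sn : (0 < n)%N \/ S = [::].
Hypothesis bottom : forall x, enorm (x - x0) <= r ->
  U (pt x d) <= e \/ exists2 c, c \in S & enorm (x - c) <= d / 2.

(** The bowl controls the side, the height term the top and [e] the good part of the bottom. The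
    weight of the Poisson barriers makes each of them at least [m] at height [d] over the ball
    around its centre, by [poisson_barrier_low]. *)
Let W x z := m * (alp * (enorm2 (x - x0) ^+ 5 * (1 + profile s z)) + B * (z `^ s * (2 - z ^+ 2)))
   + e + m * (2 ^+ (n + 2) * d ^+ n) *
   \sum_(c <- S) poisson_barrier (invmx (a c)) c s A x z.

Fact quad_inv_center c x : enorm (c - x0) <= 2 * r ->
  0 <= quad (invmx (a c)) (x - c) <= 10 / 9 * enorm2 (x - c).
Proof.
move=> cr; have [||_ /(_ (x - c)) /andP[h1 h2]] := quad_invmx_bounds (as_ cr) _ _ (ab cr);
  [lra|lra|].
have e1 : (9 / 10 : R)^-1 = 10 / 9 by field.
rewrite e1 in h2; rewrite h2 andbT; apply: le_trans h1.
by rewrite mulr_ge0 ?enorm2_ge0// invr_ge0; lra.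
Qed.

Fact center_q_le c x z : enorm (c - x0) <= 2 * r -> enorm (x - x0) <= r -> 0 < z <= r ->
  quad (invmx (a c)) (x - c) + z ^+ 2 <= 16 * r ^+ 2 /\
  quad (invmx (a c)) (x - c) + z ^+ 2 <= 1.
Proof.
move=> cr xr /andP[z0 zr]; have [r0 r1 _] := cmp_radius_bounds; rewrite -/r in r0 r1.
have /andP[_ h] := quad_inv_center x cr.
have xc : enorm (x - c) <= 3 * r.
  rewrite -(subrKA x0); apply: le_trans (enormD _ _) _.
  by rewrite -(opprB c x0) enormN; lra.
have xc2 : enorm2 (x - c) <= (3 * r) ^+ 2 by rewrite -enorm_le//; lra.
have z2 : z ^+ 2 <= r ^+ 2 by rewrite ler_sqr ?nnegrE ?(ltW z0) ?(ltW r0).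
have r2 : r ^+ 2 <= (1 / 10) ^+ 2 by rewrite ler_sqr ?nnegrE ?(ltW r0)//; lra.
by have := sqr_ge0 r; move: h xc2 z2 r2; rewrite exprMn; split; lra.
Qed.

(** The height term contributes at most [- 4 B z^s]. One [B z^s] pays for the bowl, the Poisson
    barriers contribute nothing positive, and the surplus gives strictness. *)
Lemma barrier_supersolution x z : enorm (x - x0) <= r -> 0 < z <= r ->
  exists2 v, v < 0 & Lval (a x) (b x) s W x z v.
Proof.
move=> xr zr; have [r0 r1 rK] := cmp_radius_bounds; rewrite -/r in r0 r1 rK.
have /andP[z0 zr'] := zr.
have xr2 : enorm (x - x0) <= 2 * r by lra.
have z01 : 0 < z <= 1 by rewrite z0; lra.
have ab0 v : 0 <= quad (a x) v <= 11 / 10 * enorm2 v.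
  have /andP[h ->] := ab xr2 v; rewrite andbT (le_trans _ h)// mulr_ge0 ?enorm2_ge0//; lra.
have [|v1 v1le L1] := @Lval_bowl R s n (a x) (b x) (11 / 10) K x0 x z (as_ xr2) ab0
  (bb xr2) (ltW K0) z01; first by lra.
have L2 := @Lval_height R n (a x) (b x) s x z z0.
have [v3 v30 L3] : exists2 v, v <= 0 & Lval (a x) (b x) s
    (fun x z => \sum_(c <- S) poisson_barrier (invmx (a c)) c s A x z) x z v.
  apply: Lval_sum_le => c cS; have cr := Sr cS.
  have n0 : (0 < n)%N by case: Sn => // S0; rewrite S0 in cS.
  have [q16 q1] := center_q_le cr xr zr.
  apply: (@Lval_poisson R n (a x) (a c) (b x) s K x c z s02 (ltW K0) z0 (as_ cr) (ab cr)
     (aL xr2 cr) (bb xr2) n0 q1).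
  apply: le_trans rK; rewrite mulrC ler_pM2r; last by rewrite mulr_gt0// ltr_wpDl ?mulr_ge0.
  rewrite -[leRHS]ger0_norm ?mulr_ge0 ?(ltW r0)// -sqrtr_sqr ler_wsqrtr// exprMn.
  by apply: le_trans q16 _; rewrite -natrX.
have c0 : 0 <= m * (2 ^+ (n + 2) * d ^+ n) by rewrite !mulr_ge0 ?exprn_ge0 ?ltW.
eexists; last first.
  apply: LvalD; [apply: LvalD; [apply: LvalZ; apply: LvalD;
    [exact: (LvalZ alp L1)|exact: (LvalZ B L2)]|exact: Lval_cst]|exact: (LvalZ _ L3)].
rewrite addr0.
have h3 : m * (2 ^+ (n + 2) * d ^+ n) * v3 <= 0 by rewrite mulr_ge0_le0.
suff h : alp * v1 + B * (- (2 * (2 + s)) * z `^ s) < 0.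
  have : m * (alp * v1 + B * (- (2 * (2 + s)) * z `^ s)) < 0 by rewrite pmulr_rlt0.
  by move: h3; lra.
set t := enorm2 (x - x0) in v1le; have t0 : 0 <= t by exact: enorm2_ge0.
have zs2 : z ^+ 2 <= z `^ s.
  by rewrite -powR_mulrn ?(ltW z0)//; apply: ger_powR => //; move: s02 => /andP[]; lra.
have zs0 : 0 < z `^ s by exact: powR_gt0.
pose w := z `^ (1 / 2); have w0 : 0 < w by exact: powR_gt0.
have w4 : w ^+ 4 = z ^+ 2.
  rewrite -[LHS]powR_mulrn ?(ltW w0)// /w -powRrM -powR_mulrn ?(ltW z0)//.
  by congr powR; field.
have wV : z `^ (- (1 / 2)) = w^-1 by rewrite powRN.
rewrite wV -/C1 in v1le.
have C10 := C1_ge0; have a0 := alp_gt0.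
have t4 : 0 <= t ^+ 4 by rewrite exprn_ge0.
have C4 : 0 <= C1 * (4 * C1) ^+ 4.
  by apply: (mulr_ge0 C10); apply: exprn_ge0; exact: (mulr_ge0 _ C10).
have v1z : v1 <= C1 * (4 * C1) ^+ 4 * z `^ s.
  apply: le_trans v1le _; apply: (@le_trans _ _ (C1 * (4 * C1) ^+ 4 * z ^+ 2)); last first.
    exact: (ler_wpM2l C4).
  (* The threshold [4 C1 z^(1/2)] is where the gain [z^(- 1/2) t^5 / 4] overtakes the cost
     [C1 t^4]. *)
  have [tw|tw] := leP t (4 * C1 * w).
    have h5 : t ^+ 4 <= (4 * C1) ^+ 4 * z ^+ 2.
      rewrite -w4 -exprMn lerXn2r// nnegrE; exact: le_trans tw.
    have h6 : 0 <= 1 / 4 * w^-1 * t ^+ 5.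
      by rewrite mulr_ge0 ?exprn_ge0// mulr_ge0 ?invr_ge0 ?(ltW w0)//; lra.
    have := ler_wpM2l C10 h5.
    by rewrite mulrA; move: h6; lra.
  have h5 : C1 * t ^+ 4 <= 1 / 4 * w^-1 * t ^+ 5.
    rewrite (_ : 1 / 4 * w^-1 * t ^+ 5 = (1 / 4 * w^-1 * t) * t ^+ 4); last by ring.
    apply: (ler_wpM2r t4).
    have := ler_wpM2l (_ : 0 <= 1 / 4 * w^-1) (ltW tw).
    have -> : 1 / 4 * w^-1 * (4 * C1 * w) = C1 by field; rewrite gt_eqF.
    by apply; rewrite mulr_ge0 ?invr_ge0 ?(ltW w0)//; lra.
  have : 0 <= C1 * (4 * C1) ^+ 4 * z ^+ 2 by rewrite (mulr_ge0 C4)// sqr_ge0.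
  by move: h5; lra.
have BC : alp * (C1 * (4 * C1) ^+ 4) <= B by rewrite /B mulrA lerDr invr_ge0 exprn_ge0// ltW.
have h1 : alp * v1 <= B * z `^ s.
  apply: le_trans (ler_wpM2l (ltW a0) v1z) _.
  by rewrite mulrA; apply: (ler_wpM2r (ltW zs0)).
have Bz : 0 < B * z `^ s by rewrite (mulr_gt0 B_gt0).
have sB : 0 <= s * (B * z `^ s) by rewrite mulr_ge0 ?(ltW Bz)//; move: s02 => /andP[]; lra.
by move: h1 Bz sB; lra.
Qed.

Let V (Z : 'rV[R]_n * R) := U (pt Z.1 Z.2) - W Z.1 Z.2.
Let Q : set ('rV[R]_n * R) := [set Z | enorm (Z.1 - x0) <= r /\ d <= Z.2 <= r].

Lemma cmp_compact : compact Q.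
Proof.
rewrite (_ : Q = [set x | enorm (x - x0) <= r] `*` [set` `[d, r]%R]); last first.
  by apply/seteqP; split => [[x z] [] /= h1 h2|[x z] [] /= h1 h2]; split;
    rewrite //= ?in_itv // in h2 *.
by apply: compact_setX; [exact: compact_eball_closed|exact: segment_compact].
Qed.

Lemma pt_continuous (Z : 'rV[R]_n * R) :
  {for Z, continuous (fun Z : 'rV[R]_n * R => pt Z.1 Z.2)}.
Proof.
apply: continuous_rV => k; rewrite /pt.
have h1 : {for Z, continuous (fun Z : 'rV[R]_n * R => Z.1)} by exact: cvg_fst.
have h2 : {for Z, continuous (fun Z : 'rV[R]_n * R => Z.2)} by exact: cvg_snd.
have [k1 ->|k1 ->] := split_ordP k.
  apply: (continuous_eq (f := fun Z : 'rV[R]_n * R => Z.1 0 k1)) => [Z'|].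
    by rewrite row_mxEl.
  exact: (continuous_comp h1 (@coord_continuous R 1 n 0 k1 _)).
apply: (continuous_eq (f := fun Z : 'rV[R]_n * R => Z.2)) => // Z'.
by rewrite row_mxEr ord1 mxE eqxx mulr1n.
Qed.

Lemma cmp_continuous : {within Q, continuous V}.
Proof.
apply: continuous_in_subspaceT => -[x z] /set_mem[/= xr /andP[dz zr]].
have z0 : 0 < z by exact: lt_le_trans dz.
have h1 : {for (x, z), continuous (fun Z : 'rV[R]_n * R => Z.1)} by exact: cvg_fst.
have h2 : {for (x, z), continuous (fun Z : 'rV[R]_n * R => Z.2)} by exact: cvg_snd.
have hz2 : {for (x, z), continuous (fun Z : 'rV[R]_n * R => Z.2 ^+ 2)}.
  apply: (continuous_eq (f := fun Z : 'rV[R]_n * R => Z.2 * Z.2)) => //.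
  exact: continuousM.
have cst (c : R) : {for (x, z), continuous (fun Z : 'rV[R]_n * R => c)} by exact: cvg_cst.
have hx (c : 'rV[R]_n) : {for (x, z), continuous (fun Z : 'rV[R]_n * R => Z.1 - c)}.
  by apply: continuousB => //; exact: cvg_cst.
have ht : {for (x, z), continuous (fun Z : 'rV[R]_n * R => enorm2 (Z.1 - x0))}.
  exact: (continuous_comp (hx x0) (@enorm2_continuous R n _)).
have hp (c : R) : {for (x, z), continuous (fun Z : 'rV[R]_n * R => Z.2 `^ c)}.
  by apply: (@continuous_powR_comp _ (fun Z : 'rV[R]_n * R => Z.2)).
have hU : {for (x, z), continuous (fun Z : 'rV[R]_n * R => U (pt Z.1 Z.2))}.
  have Dxz : D (pt x z) by apply: DD; rewrite ?z0.
  apply: (@continuous_comp _ _ _ (fun Z : 'rV[R]_n * R => pt Z.1 Z.2) U).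
    exact: pt_continuous.
  exact: (C1on_continuous U2.1 Dxz).
have hprof : {for (x, z), continuous (fun Z : 'rV[R]_n * R => profile s Z.2)}.
  rewrite /profile; case: (leP s 1) => _ //.
  exact: continuousB.
have hE c : c \in S -> {for (x, z), continuous (fun Z : 'rV[R]_n * R =>
    poisson_barrier (invmx (a c)) c s A Z.1 Z.2)}.
  move=> cS; have /andP[q0 _] := quad_inv_center x (Sr cS).
  have hq : {for (x, z), continuous (fun Z : 'rV[R]_n * R =>
      quad (invmx (a c)) (Z.1 - c) + Z.2 ^+ 2)}.
    by apply: continuousD => //; exact: quad_continuous.
  have hqp (k : R) : {for (x, z), continuous (fun Z : 'rV[R]_n * R =>
      (quad (invmx (a c)) (Z.1 - c) + Z.2 ^+ 2) `^ k)}.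
    apply: (@continuous_powR_comp _ (fun Z : 'rV[R]_n * R =>
      quad (invmx (a c)) (Z.1 - c) + Z.2 ^+ 2)) => //=; by rewrite ltr_wpDl// exprn_gt0.
  apply: continuousD; first exact: continuousM.
  by apply: continuousM => //; exact: continuousM.
have hS : {for (x, z), continuous (fun Z : 'rV[R]_n * R =>
    \sum_(c <- S) poisson_barrier (invmx (a c)) c s A Z.1 Z.2)}.
  elim: (S) hE => [|c S' IH] hE.
    by apply: continuous_eq (cst 0) => Z; rewrite big_nil.
  apply: (continuous_eq (f := fun Z : 'rV[R]_n * R =>
      poisson_barrier (invmx (a c)) c s A Z.1 Z.2 +
      \sum_(c <- S') poisson_barrier (invmx (a c)) c s A Z.1 Z.2)) => [Z|].
    by rewrite big_cons.
  apply: continuousD; first by apply: hE; rewrite mem_head.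
  by apply: IH => c' c'S; apply: hE; rewrite inE c'S orbT.
suff hW : {for (x, z), continuous (fun Z : 'rV[R]_n * R => W Z.1 Z.2)}.
  exact: (continuousB hU hW).
rewrite /W.
apply: continuousD; last exact: continuousM.
apply: continuousD => //; apply: continuousM => //; apply: continuousD.
  apply: continuousM => //; apply: continuousM; last exact: continuousD.
  apply: (continuous_eq (f := fun Z : 'rV[R]_n * R => enorm2 (Z.1 - x0) *
    (enorm2 (Z.1 - x0) * (enorm2 (Z.1 - x0) * (enorm2 (Z.1 - x0) * enorm2 (Z.1 - x0)))))) => //.
  by do 4 (apply: continuousM => //).
by apply: continuousM => //; apply: continuousM => //; exact: continuousB.
Qed.

Lemma barrier_terms x z : enorm (x - x0) <= r -> d <= z <= r ->
  [/\ 0 <= alp * (enorm2 (x - x0) ^+ 5 * (1 + profile s z)),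
      0 <= B * (z `^ s * (2 - z ^+ 2)) &
      0 <= m * (2 ^+ (n + 2) * d ^+ n) *
        \sum_(c <- S) poisson_barrier (invmx (a c)) c s A x z].
Proof.
move=> xr /andP[dz zr]; have [r0 r1 _] := cmp_radius_bounds; rewrite -/r in r0 r1.
have z0 : 0 < z by exact: lt_le_trans dz.
have z1 : z <= 1 by lra.
have /andP[p0 _] : 0 <= profile s z <= 1 by apply: profile01; rewrite z0.
have z21 : z ^+ 2 <= 1 by rewrite expr_le1// ltW.
split.
- rewrite (mulr_ge0 (ltW alp_gt0))// mulr_ge0 ?exprn_ge0 ?enorm2_ge0//; lra.
- rewrite (mulr_ge0 (ltW B_gt0))// mulr_ge0 ?powR_ge0//; lra.
- rewrite mulr_ge0 ?(mulr_ge0 (ltW m0)) ?mulr_ge0 ?exprn_ge0 ?(ltW d0)//.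
  by apply: sumr_ge0 => c _; exact: (poisson_barrier_ge0 _ _ _ _ _ A_ge0).
Qed.

(** A positive maximum of [U - W] is excluded everywhere: on the side and on the top [W >= m >= U];
    at the bottom either [U <= e] or some Poisson barrier reaches [m]; inside, [W] is a strict
    supersolution and [Lval_max] applies. *)
Lemma U_le_barrier x z : enorm (x - x0) <= r -> d <= z <= r -> U (pt x z) <= W x z.
Proof.
move=> xr0 zr0; have [r0 r1 _] := cmp_radius_bounds; rewrite -/r in r0 r1.
rewrite -subr_le0 -/(V (x, z)).
have Q0 : Q (x, z) by [].
have [|[x1 z1] /set_mem[/= xr zr] Hmax] := compact_EVT_max (_ : Q !=set0) cmp_compact cmp_continuous.
  by exists (x, z).
apply: le_trans (Hmax _ (mem_set Q0)) _; rewrite leNgt; apply/negP => V0.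
have {}Hmax x' z' : enorm (x' - x0) <= r -> d <= z' <= r -> V (x', z') <= V (x1, z1).
  by move=> h1 h2; apply: Hmax; apply/mem_set.
have [w1 w2 w3] := barrier_terms xr zr.
have /andP[dz zr'] := zr; have z10 : 0 < z1 by exact: lt_le_trans dz.
have z11 : z1 <= 1 by lra.
have zr1 : 0 < z1 <= r by rewrite z10.
have Um1 := Um xr zr1.
have /andP[p0 _] : 0 <= profile s z1 <= 1 by apply: profile01; rewrite z10.
have z21 : z1 ^+ 2 <= 1 by rewrite expr_le1// ltW.
have {}V0 : W x1 z1 < U (pt x1 z1) by rewrite -subr_gt0.
have xin : enorm (x1 - x0) < r.
  rewrite lt_neqAle xr andbT; apply/negP => /eqP E.
  have h : 1 <= alp * (enorm2 (x1 - x0) ^+ 5 * (1 + profile s z1)).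
    rewrite -sqr_enorm E -exprM /alp mulrA mulVf ?mul1r; first lra.
    by rewrite expf_eq0 gt_eqF.
  have := ler_wpM2l (ltW m0) (lerD h w2); move: V0; rewrite /W.
  by move: w3 Um1 e0; lra.
have zin : z1 < r.
  rewrite lt_neqAle zr' andbT; apply/negP => /eqP E.
  have h : 1 <= B * (z1 `^ s * (2 - z1 ^+ 2)).
    have h1 : z1 ^+ 2 <= z1 `^ s.
      rewrite -powR_mulrn ?(ltW z10)//; apply: ger_powR; rewrite ?z10//.
      by move: s02 => /andP[]; lra.
    have h2 : r ^+ 2 <= z1 `^ s * (2 - z1 ^+ 2).
      rewrite -E -[leLHS]mulr1 ler_pM ?sqr_ge0//; lra.
    apply: le_trans (ler_wpM2l (ltW B_gt0) h2).
    by rewrite -ler_pdivrMr ?exprn_gt0// mul1r; exact: B_low.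
  have := ler_wpM2l (ltW m0) (lerD w1 h); move: V0; rewrite /W.
  by move: w3 Um1 e0; lra.
have din : d < z1.
  rewrite lt_neqAle dz andbT; apply/negP => /eqP E.
  have mw : 0 <= m * (alp * (enorm2 (x1 - x0) ^+ 5 * (1 + profile s z1)) +
      B * (z1 `^ s * (2 - z1 ^+ 2))) by rewrite (mulr_ge0 (ltW m0))// addr_ge0.
  have [h|[c cS xc]] := bottom xr.
    by move: V0; rewrite /W -E in mw w3 *; move: mw w3 h; lra.
  have /andP[q0 q1] := quad_inv_center x1 (Sr cS).
  have q2 : 0 <= quad (invmx (a c)) (x1 - c) <= d ^+ 2.
    rewrite q0; apply: le_trans q1 _.
    have : enorm2 (x1 - c) <= (d / 2) ^+ 2 by rewrite -enorm_le//; lra.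
    by have := sqr_ge0 d; lra.
  have low := poisson_barrier_low s02 A_ge0 d0 q2.
  have : m * 1 <= m * (2 ^+ (n + 2) * d ^+ n) *
      \sum_(c <- S) poisson_barrier (invmx (a c)) c s A x1 z1.
    rewrite -mulrA (ler_wpM2l (ltW m0))//; apply: le_trans low _; rewrite E.
    rewrite ler_wpM2l ?mulr_ge0 ?exprn_ge0 ?(ltW z10)//.
    rewrite (big_rem c)//= lerDl.
    by apply: sumr_ge0 => c' _; exact: (poisson_barrier_ge0 _ _ _ _ _ A_ge0).
  by rewrite mulr1; move: V0; rewrite /W; move: mw Um1 e0; lra.
have [v v0 LW] := barrier_supersolution xr zr1.
have LU := @Lval_C2 R n (a x1) (b x1) s D U x1 z1 oD U2 (DD xr zr1).
rewrite eqU// in LU.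
have LV := LvalB LU LW.
have xr2 : enorm (x1 - x0) <= 2 * r by lra.
have a0 u : 0 <= quad (a x1) u.
  have /andP[h _] := ab xr2 u; apply: le_trans h; rewrite mulr_ge0 ?enorm2_ge0//; lra.
suff : 0 - v <= 0 by rewrite sub0r oppr_le0 leNgt v0.
apply: (Lval_max (as_ xr2) a0 LV) => [xi|].
  have : \forall t \near (0 : R), enorm (x1 + t *: xi - x0) < r.
    have : continuous (fun t : R => x1 + t *: xi).
      by move=> t; apply: cvgD; [exact: cvg_cst|apply: cvgZr_tmp; exact: cvg_id].
    move=> /(_ 0)/=; rewrite /continuous_at scale0r addr0 => h.
    apply: (h [set y | enorm (y - x0) < r]).
    by apply: open_nbhs_nbhs; split => //; exact: open_eball.
  by apply: filterS => t /ltW h; exact: (Hmax (x1 + t *: xi) z1 h zr).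
have [g [g0 g1 g2]] : exists g, [/\ 0 < g, g <= z1 - d & g <= r - z1].
  exists (Num.min (z1 - d) (r - z1)); rewrite lt_min !ge_min !lexx ?orbT !subr_gt0.
  by rewrite din zin.
exists g => //= t; rewrite /ball_ /= sub0r normrN ltr_norml => /andP[t1 t2].
apply: (Hmax x1 (z1 + t) xr).
by apply/andP; split; lra.
Qed.

(** On the axis the bowl vanishes. What remains is the height term, of order [z^s], and one term of
    order [d^n / z^n] for each centre. *)
Lemma comparison_bound z : d <= z <= r ->
  U (pt x0 z) <= m * cmp_const * (z `^ s + (size S)%:R * d ^+ n / z ^+ n) + e.
Proof.
move=> zr; have [r0 r1 _] := cmp_radius_bounds; rewrite -/r in r0 r1.
have x00 : enorm (x0 - x0) <= r by rewrite subrr enorm0 ltW.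
apply: le_trans (U_le_barrier x00 zr) _.
have /andP[dz zr'] := zr; have z0 : 0 < z by exact: lt_le_trans dz.
have zr1 : 0 < z <= r by rewrite z0.
rewrite /W subrr enorm20 expr0n mul0r mulr0 add0r.
have sum_le : \sum_(c <- S) poisson_barrier (invmx (a c)) c s A x0 z <=
    (size S)%:R * ((1 + A) * (z ^+ n)^-1).
  have h c : c \in S -> poisson_barrier (invmx (a c)) c s A x0 z <= (1 + A) * (z ^+ n)^-1.
    move=> cS; have cr := Sr cS; have n0 : (0 < n)%N by case: Sn => // S0; rewrite S0 in cS.
    have /andP[q0 _] := quad_inv_center x0 cr.
    have [_ q1] := center_q_le cr x00 zr1.
    exact: (poisson_barrier_high n0 s02 A_ge0 z0 q0 q1).
  elim: (S) h => [|c S' IH] h; first by rewrite big_nil mul0r.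
  rewrite big_cons /= -natr1 mulrDl mul1r addrC lerD//.
    by apply: IH => c' c'S; apply: h; rewrite inE c'S orbT.
  by apply: h; rewrite mem_head.
have zs : 0 <= z `^ s by exact: powR_ge0.
have h1 : B * (z `^ s * (2 - z ^+ 2)) <= 2 * B * z `^ s.
  have : 0 <= B * (z `^ s * z ^+ 2) by rewrite (mulr_ge0 (ltW B_gt0))// mulr_ge0// sqr_ge0.
  by lra.
set N := (size S)%:R; have N0 : 0 <= N :> R by [].
have dn : 0 <= d ^+ n by rewrite exprn_ge0// ltW.
have zn : 0 <= (z ^+ n)^-1 by rewrite invr_ge0 exprn_ge0// ltW.
have NA : 0 <= N * d ^+ n * (z ^+ n)^-1 by rewrite !mulr_ge0.
have h2 : 2 ^+ (n + 2) * d ^+ n * \sum_(c <- S) poisson_barrier (invmx (a c)) c s A x0 z <=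
    2 ^+ (n + 2) * (1 + A) * (N * d ^+ n / z ^+ n).
  apply: le_trans (ler_wpM2l _ sum_le) _; first by apply: mulr_ge0 => //; exact: exprn_ge0.
  by rewrite le_eqVlt; apply/orP; left; apply/eqP; rewrite /N; ring.
have BA : 0 <= 2 ^+ (n + 2) * (1 + A) :> R.
  by rewrite mulr_ge0 ?exprn_ge0// addr_ge0// A_ge0.
have B0 := B_gt0.
have h3 : B * (z `^ s * (2 - z ^+ 2)) + 2 ^+ (n + 2) * d ^+ n *
   \sum_(c <- S) poisson_barrier (invmx (a c)) c s A x0 z <=
   cmp_const * (z `^ s + N * d ^+ n / z ^+ n).
  have aux (p q X Y b2 c : R) : p <= b2 * X -> q <= c * Y -> 0 <= b2 * Y -> 0 <= c * X ->
    p + q <= (b2 + c) * (X + Y) by lra.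
  apply: aux h1 h2 _ _; last exact: mulr_ge0.
  by apply: mulr_ge0 => //; rewrite mulr_ge0 ?(ltW B0).
have := ler_wpM2l (ltW m0) h3; rewrite /N; lra.
Qed.

End maximum_principle.
End cylinder_comparison.
End comparison.

(** * Weighted gradient estimate in coordinates *)

Section core.
Context {R : realType}.

Lemma enorm_pt n (x : 'rV[R]_n) z : enorm2 (pt x z) = enorm2 x + z ^+ 2.
Proof. by rewrite /pt enorm2_row_mx; congr (_ + _); rewrite /enorm2 big_ord1 mxE eqxx mulr1n. Qed.

Lemma ptK n (Y : 'rV[R]_(n + 1)) : pt (lsubmx Y) (rsubmx Y 0 0) = Y.
Proof. by rewrite /pt -mx11_scalar hsubmxK. Qed.

Lemma pt_sub n (x x' : 'rV[R]_n) z z' : pt x z - pt x' z' = pt (x - x') (z - z').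
Proof. by rewrite /pt opp_row_mx add_row_mx -raddfB. Qed.

Lemma quad_block1 n (a : 'M[R]_n) (v : 'rV[R]_n) (c : R) :
  quad (block_mx a 0 0 1%:M) (pt v c) = quad a v + c ^+ 2.
Proof.
rewrite /pt quad_row_mx mulmx0 (mulmx0 _ c%:M) ![dot 0 _]dotC !dot0r !addr0.
by rewrite quad_scalar mul1r /enorm2 big_ord1 mxE eqxx mulr1n.
Qed.

Lemma quad_block0 n (a : 'M[R]_n) (v : 'rV[R]_n) (c : R) :
  quad (block_mx a 0 0 0) (pt v c) = quad a v.
Proof.
rewrite /pt quad_row_mx mulmx0 (mulmx0 _ c%:M) ![dot 0 _]dotC !dot0r !addr0.
by rewrite [quad 0 _]quad_sum !big_ord1 [X in _ * X * _]mxE mulr0 mul0r addr0.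
Qed.

(* 119/100 leaves room both below 6/5, divided by the distortion of the
   chart, and above the points where the estimate is wanted. *)
Definition half_region n : set 'rV[R]_(n + 1) :=
  [set Y | 0 < rsubmx Y 0 0 /\ enorm Y < 119 / 100].

Arguments half_region n _ : clear implicits.

Lemma open_half_region n : open (half_region n).
Proof.
have -> : half_region n =
    ((fun Y : 'rV[R]_(n + 1) => Y 0 (rshift n 0)) @^-1` [set x | 0 < x]) `&`
    [set Y | enorm (Y - 0) < 119 / 100].
  by apply/seteqP; split => Y; rewrite /half_region /= subr0 !mxE.
apply: openI; last exact: open_eball.
by apply: open_comp; [move=> Y _; exact: coord_continuous|exact: open_gt].
Qed.

Lemma half_region_pt n (x : 'rV[R]_n) z : half_region n (pt x z) <-> 0 < z /\ enorm (pt x z) < 119 / 100.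
Proof. by rewrite /half_region /= /pt row_mxKr mxE eqxx mulr1n. Qed.

Lemma enorm_lsub n (x : 'rV[R]_n) z : enorm x <= enorm (pt x z).
Proof. by rewrite enorm_le ?enorm_ge0// sqr_enorm enorm_pt lerDl sqr_ge0. Qed.

Lemma enorm_rsub n (x : 'rV[R]_n) z : `|z| <= enorm (pt x z).
Proof.
rewrite -(@ler_pXn2r _ 2)// ?nnegrE ?enorm_ge0//.
by rewrite real_normK ?num_real// sqr_enorm enorm_pt lerDr enorm2_ge0.
Qed.

Definition coefficients n (K : R) (a : 'rV[R]_n -> 'M[R]_n) (b : 'rV[R]_n -> 'rV[R]_n) :=
  [/\ forall x, enorm x <= 3 / 2 -> (a x)^T = a x,
   forall x, enorm x <= 3 / 2 -> forall v,
     9 / 10 * enorm2 v <= quad (a x) v <= 11 / 10 * enorm2 v,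
   forall x y, enorm x <= 3 / 2 -> enorm y <= 3 / 2 ->
     forall v, `|quad (a x - a y) v| <= K * enorm (x - y) * enorm2 v &
   forall x, enorm x <= 3 / 2 -> enorm (b x) <= K].

Definition solution n (s : R) (a : 'rV[R]_n -> 'M[R]_n) (b : 'rV[R]_n -> 'rV[R]_n)
    (U : 'rV[R]_(n + 1) -> R) :=
  C2on (half_region n) U /\
  forall x z, half_region n (pt x z) ->
  \tr (block_mx (a x) 0 0 1%:M *m hess U (pt x z)) +
     dot (row_mx (b x) ((1 - s) / z)%:M) (grd U (pt x z)) = 0.

(** The form in which the boundary values enter. The count times [k.+1^-n] is the quantity appearing
    in [comparison_bound], and a radius of half the height suits [poisson_barrier_low]. *)
Definition few_bad_points n (U : 'rV[R]_(n + 1) -> R) (A : set 'rV[R]_n) :=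
  forall e eta : R, 0 < e -> 0 < eta -> \forall k \near \oo,
    exists S : seq 'rV[R]_n, (size S)%:R * (k.+1%:R^-1) ^+ n <= eta /\
      forall x, A x -> `|U (pt x k.+1%:R^-1)| <= e \/
        exists2 c, c \in S & enorm (x - c) <= k.+1%:R^-1 / 2.

(** On the ball of radius [z / 100] the singular drift [(1 - s) / z] stays of order [1 / z], the
    size that [interior_gradient] allows at this radius; since [z / 100 <= 1], the bounds by [K] are
    weaker requirements than those by [K / rho]. *)
Lemma gradient_scaled n K : 0 < K -> exists2 C : R, 0 < C &
  forall s a b (U : 'rV[R]_(n + 1) -> R) M x z, 0 < s < 2 -> 0 < M ->
  coefficients K a b -> solution s a b U -> 0 < z -> enorm (pt x z) <= 117 / 100 ->
  (forall x' z', enorm (pt x' z' - pt x z) <= z / 100 -> `|U (pt x' z')| <= M) ->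
  enorm (grd U (pt x z)) <= C * M / z.
Proof.
move=> K0.
have K2 : 0 <= K + 2 by lra.
have [||//|C C0 HC] := @interior_gradient R (n + 1) (9 / 10) (11 / 10) (K + 2); [lra|lra|].
exists (C * 100); first by rewrite mulr_gt0.
move=> s a b U M x z s02 M0 [as_ ab aL bb] [U2 eqU] z0 Yle UM.
have z117 : z <= 117 / 100.
  by apply: le_trans Yle; apply: le_trans (enorm_rsub x z); rewrite ler_norm.
have rho0 : 0 < z / 100 by rewrite divr_gt0.
have near Y : enorm (Y - pt x z) <= z / 100 -> [/\ half_region n Y,
    99 / 100 * z <= rsubmx Y 0 0 & enorm (lsubmx Y) <= 3 / 2].
  rewrite -{1 2}[Y]ptK; set x' := lsubmx Y; set z' := rsubmx Y 0 0 => h.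
  have hz : `|z' - z| <= z / 100 by apply: le_trans h; rewrite pt_sub; exact: enorm_rsub.
  move: hz; rewrite ler_norml => /andP[hz1 hz2].
  have hY : enorm (pt x' z') <= 117 / 100 + z / 100.
    rewrite -(subrK (pt x z) (pt x' z')); apply: le_trans (enormD _ _) _; lra.
  split; last 2 first.
  - by lra.
  - by apply: le_trans (enorm_lsub x' z') _; lra.
  - by apply/half_region_pt; split; lra.
have KK : K + 2 <= (K + 2) / (z / 100).
  by rewrite ler_pdivlMr// ler_piMr//; lra.
pose A (Y : 'rV[R]_(n + 1)) := block_mx (a (lsubmx Y)) 0 0 (1%:M : 'M[R]_1).
pose B (Y : 'rV[R]_(n + 1)) := row_mx (b (lsubmx Y)) ((1 - s) / (rsubmx Y 0 0))%:M.
have H := HC (half_region n) U A B (pt x z) (z / 100) M (@open_half_region n) U2.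
have {}H := H (fun Y h => let: And3 h1 _ _ := near Y h in h1).
have {}H : forall v, `|dot v (grd U (pt x z))| <= C * M / (z / 100) * enorm v.
  apply: H => //.
  - by move=> Y h; rewrite -(ptK Y); apply: UM; rewrite ptK.
  - move=> Y /near[_ _ h]; rewrite /A tr_block_mx as_// !trmx0 trmx1 //.
  - move=> Y /near[_ _ h] v; rewrite /A -(ptK v) quad_block1 enorm_pt.
    have /andP[h1 h2] := ab _ h (lsubmx v).
    by have := sqr_ge0 (rsubmx v 0 0); move: h1 h2; lra.
  - move=> Y Y' /near[_ _ h] /near[_ _ h'] v.
    have -> : A Y' - A Y = block_mx (a (lsubmx Y') - a (lsubmx Y)) 0 0 0.
      by rewrite /A opp_block_mx add_block_mx !subrr.
    rewrite -(ptK v) quad_block0.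
    apply: le_trans (aL _ _ h' h _) _; rewrite ler_pM ?mulr_ge0 ?enorm_ge0 ?enorm2_ge0 ?(ltW K0)//.
      rewrite ler_pM ?enorm_ge0 ?(ltW K0)//.
        by apply: le_trans KK; lra.
      rewrite -(opprB Y') enormN -{2}(ptK Y) -{2}(ptK Y') pt_sub; exact: enorm_lsub.
    by rewrite enorm_pt lerDl sqr_ge0.
  - move=> Y /near[_ h1 h2]; rewrite /B -/(pt _ _).
    have z'0 : 0 < rsubmx Y 0 0 by apply: lt_le_trans h1; lra.
    have e0 : enorm (pt (b (lsubmx Y)) ((1 - s) / rsubmx Y 0 0)) <=
        enorm (b (lsubmx Y)) + `|(1 - s) / rsubmx Y 0 0|.
      rewrite enorm_le ?addr_ge0 ?enorm_ge0// enorm_pt sqrrD sqr_enorm real_normK ?num_real//.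
      by rewrite lerD2r lerDl mulrn_wge0// mulr_ge0// enorm_ge0.
    apply: le_trans e0 _; have e1 := bb _ h2.
    have e2 : `|(1 - s) / rsubmx Y 0 0| <= 2 / z.
      rewrite normrM normfV (gtr0_norm z'0) ler_pdivrMr//.
      have : `|1 - s| <= 1 by rewrite ler_norml; move: s02 => /andP[]; lra.
      have : 2 * (99 / 100) <= 2 / z * rsubmx Y 0 0.
        rewrite -mulrA ler_wpM2l// -ler_pdivrMl ?invr_gt0// invrK mulrC.
        by rewrite mulrC; move: h1; lra.
      by lra.
    have e3 : (K + 2) / (z / 100) = K * 100 / z + 200 / z by field; rewrite gt_eqF.
    have e4 : K <= K * 100 / z by rewrite ler_pdivlMr//; apply: ler_wpM2l (ltW K0) _ _ _; lra.
    have e5 : 0 < z^-1 by rewrite invr_gt0.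
    by rewrite e3; move: e1 e2 e4 e5; lra.
  - by move=> Y /near[h _ _]; have := eqU (lsubmx Y) (rsubmx Y 0 0); rewrite ptK; exact.
have [g0|g0] := eqVneq (enorm (grd U (pt x z))) 0.
  by rewrite g0 !mulr_ge0 ?invr_ge0 ?ltW.
have gp : 0 < enorm (grd U (pt x z)) by rewrite lt_neqAle eq_sym g0 enorm_ge0.
have := H (grd U (pt x z)); rewrite dotvv -sqr_enorm expr2 normrM ger0_norm ?enorm_ge0//.
rewrite ler_pM2r// => h; apply: le_trans h _.
by rewrite le_eqVlt; apply/orP; left; apply/eqP; field; rewrite gt_eqF.
Qed.

Lemma C1onN n (D : set 'rV[R]_n) (f : 'rV[R]_n -> R) : open D -> C1on D f ->
  C1on D (fun x => - f x).
Proof.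
move=> oD f1; apply: (@C1on_ext R n D (fun x => -1 * f x)) => // [x _|].
  by rewrite mulN1r.
by apply: C1on_mul => //; exact: C1on_cst.
Qed.

Lemma partialN n (f : 'rV[R]_n -> R) (x : 'rV[R]_n) i : differentiable f x ->
  partial i (fun x => - f x) x = - partial i f x.
Proof. by move=> df; rewrite /partial deriveN//; exact: diff_derivable. Qed.

Lemma solutionN n s (a : 'rV[R]_n -> 'M[R]_n) b U :
  solution s a b U -> solution s a b (fun Y => - U Y).
Proof.
move=> [[U1 U2] eqU]; have oD := @open_half_region n.
have pN i Y : half_region n Y -> partial i (fun Y => - U Y) Y = - partial i U Y.
  by move=> hY; apply: partialN; have [] := U1 _ hY.
split.
  split; first exact: C1onN.
  move=> i; apply: (@C1on_ext R _ _ (fun Y => - partial i U Y)) => // [Y hY|].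
    by rewrite pN.
  exact: C1onN.
move=> x z h; have := eqU x z h.
have -> : grd (fun Y => - U Y) (pt x z) = - grd U (pt x z).
  by apply/rowP => i; rewrite !mxE pN.
have -> : hess (fun Y => - U Y) (pt x z) = - hess U (pt x z).
  apply/matrixP => i j; rewrite !mxE.
  rewrite (@partial_ext R _ (half_region n) _ (fun Y => - partial i U Y))//.
    by rewrite partialN//; have [] := U2 i _ h.
  by move=> Y hY; exact: pN.
by rewrite mulmxN raddfN dotNr -opprD => ->; rewrite oppr0.
Qed.

(** Above the height [r] the bound on [U] suffices, since [z^s >= r^2]. Below it, [U] and [- U] are
    compared with the barrier around the vertical axis of the given point, between a height
    [k.+1^-1] and [r], up to an arbitrary error [e]. *)
Lemma boundary_growth n K : 0 < K -> exists2 C : R, 0 < C &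
  forall s a b (U : 'rV[R]_(n + 1) -> R) M x z, 0 < s < 2 -> 0 < M ->
  coefficients K a b -> solution s a b U ->
  (forall Y, half_region n Y -> `|U Y| <= M) ->
  few_bad_points U [set x | enorm x <= 23 / 20] ->
  0 < z -> enorm x <= 104 / 100 -> half_region n (pt x z) ->
  `|U (pt x z)| <= C * M * z `^ s.
Proof.
move=> K0; have [r0 r1 _] := cmp_radius_bounds n K0; set r := cmp_radius n K in r0 r1.
have C0 := cmp_const_gt0 n K0.
exists (cmp_const n K + (r ^+ 2)^-1); first by rewrite addr_gt0// invr_gt0 exprn_gt0.
move=> s a b U M x z s02 M0 co so UM bad z0 x104 hz; have /andP[s0 s2] := s02.
have zs0 : 0 < z `^ s by exact: powR_gt0.
have r2 : 0 < r ^+ 2 by rewrite exprn_gt0.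
have [zr|zr] := leP r z.
  apply: le_trans (UM _ hz) _; rewrite mulrDl mulrDl.
  have h1 : 0 <= cmp_const n K * M * z `^ s by rewrite !mulr_ge0 ?(ltW C0) ?(ltW M0) ?(ltW zs0).
  suff h2 : M <= (r ^+ 2)^-1 * M * z `^ s by move: h1 h2; lra.
  have h3 : r ^+ 2 <= z `^ s.
    apply: (@le_trans _ _ (r `^ s)).
      by rewrite -powR_mulrn ?(ltW r0)//; apply: ger_powR; [rewrite r0; lra|lra].
    by apply: ge0_ler_powR => //; rewrite ?nnegrE ?(ltW r0) ?(ltW z0)//; lra.
  rewrite mulrAC -[leLHS]mul1r ler_pM2r//.
  by rewrite mulrC ler_pdivlMr// mul1r.
suff main V : solution s a b V -> (forall Y, half_region n Y -> `|V Y| <= M) ->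
    few_bad_points V [set x | enorm x <= 23 / 20] ->
    V (pt x z) <= cmp_const n K * M * z `^ s.
  have m1 := main U so UM bad.
  have m2 := main (fun Y => - U Y) (solutionN so).
  have {}m2 : - U (pt x z) <= cmp_const n K * M * z `^ s.
    apply: m2 => [Y|]; first by rewrite normrN; exact: UM.
    move=> e eta e0 eta0; have := bad e eta e0 eta0.
    apply: filterS => k [S [h1 h2]]; exists S; split=> // x' /h2.
    by rewrite normrN.
  have h : 0 <= (r ^+ 2)^-1 * M * z `^ s.
    by rewrite !mulr_ge0 ?invr_ge0 ?(ltW r2) ?(ltW M0) ?(ltW zs0).
  have key : cmp_const n K * M * z `^ s <= (cmp_const n K + (r ^+ 2)^-1) * M * z `^ s.
    by rewrite !(mulrDl (cmp_const n K)) mulrDl lerDl.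
  by rewrite ler_norml lerNl; apply/andP; split; [exact: le_trans m2 key|exact: le_trans m1 key].
move=> {so UM bad} [V2 eqV] VM bad.
have [as_ ab aL bb] := co.
apply/ler_addgt0Pr => e e0.
(* The first entry makes the Poisson terms at most [e / 2] at this fixed height [z]; the second
   serves dimension 0. *)
pose eta := Num.min (e / 2 / (M * cmp_const n K) * z ^+ n) (1 / 2).
have MC : 0 < M * cmp_const n K by rewrite mulr_gt0.
have zn : 0 < z ^+ n by rewrite exprn_gt0.
have eta0 : 0 < eta by rewrite lt_min !mulr_gt0 ?invr_gt0.
have n1 : \forall k \near \oo, (k.+1%:R^-1 : R) < z.
  exact: (near_infty_natSinv_lt (PosNum z0)).
have e20 : 0 < e / 2 by rewrite divr_gt0.
have n2 := bad (e / 2) eta e20 eta0.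
have [k [hk1 [S [Sk HS]]]] := @filter_ex _ \oo _ _ (filterI n1 n2).
have hk2 : (k.+1%:R^-1 : R) <= 1 by rewrite invf_le1// ler1n.
set d : R := k.+1%:R^-1 in hk1 hk2 Sk HS.
have d0 : 0 < d by rewrite invr_gt0.
(* A centre farther than [2 r] from [x] has no bad point within [r] of [x], because the balls have
   radius [d / 2 < r]. *)
pose S' := [seq c <- S | enorm (c - x) <= 2 * r].
have dom x' z' : enorm (x' - x) <= r -> 0 < z' <= r -> half_region n (pt x' z').
  move=> h /andP[z'0 z'r]; apply/half_region_pt; split=> //.
  have hx : enorm x' <= 114 / 100.
    have : enorm x' <= enorm (x' - x) + enorm x by rewrite -{1}(subrK x x') enormD.
    by move: h; rewrite -/r; lra.
  have c0 : 0 <= 114 / 100 :> R by lra.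
  rewrite enorm_le// in hx;
  have c1 : 0 <= 119 / 100 :> R by lra.
  rewrite (enorm_lt _ c1) enorm_pt.
  have z1 : z' <= 1 / 10 := le_trans z'r r1.
  have z2 : z' ^+ 2 <= (1 / 10) ^+ 2 by rewrite lerXn2r ?nnegrE ?(ltW z'0)// (le_trans (ltW z'0)).
  by move: hx z2; lra.
have dom2 x' : enorm (x' - x) <= 2 * r -> enorm x' <= 3 / 2.
  have : enorm x' <= enorm (x' - x) + enorm x by rewrite -{1}(subrK x x') enormD.
  by lra.
have S'S : (size S' <= size S)%N by rewrite size_filter count_size.
have S'n : (0 < n)%N \/ S' = [::].
  (* In dimension 0 the count itself is at most [eta <= 1/2], hence zero. *)
  have [n0|n0] := posnP n; [right|by left].
  have dn : d ^+ n = 1 by rewrite n0 expr0.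
  have e2 : eta <= 1 / 2 by rewrite /eta ge_min lexx orbT.
  have S1 : (size S < 1)%N.
    by rewrite -(ltr_nat R); move: Sk e2; rewrite dn mulr1; lra.
  by apply/nilP; rewrite /nilp -leqn0 (leq_trans S'S).
have := @comparison_bound R n K K0 s a b (half_region n) V x d (e / 2) M S' s02
  (@open_half_region n) V2 dom (fun x' h => as_ _ (dom2 x' h)) (fun x' h => ab _ (dom2 x' h))
  (fun x' y' h h' => aL _ _ (dom2 x' h) (dom2 y' h')) (fun x' h => bb _ (dom2 x' h))
  (fun x' z' h h' => eqV _ _ (dom x' z' h h')).
move=> /(_ (fun x' z' h h' => le_trans (ler_norm _) (VM _ (dom x' z' h h'))) M0).
move=> /(_ (ltW e20) d0).
move=> /(_ _ S'n _ z) H; apply: le_trans (H _ _ _) _.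
- by move=> c; rewrite mem_filter => /andP[].
- move=> x' hx'.
  have x'2 : enorm x' <= 23 / 20.
    have : enorm x' <= enorm (x' - x) + enorm x by rewrite -{1}(subrK x x') enormD.
    by move: hx'; rewrite -/r; lra.
  have [h|[c cS cx]] := HS x' x'2; [left|right].
    exact: le_trans (ler_norm _) h.
  exists c => //; rewrite mem_filter cS andbT.
  rewrite -(subrKA x'); apply: le_trans (enormD _ _) _.
  rewrite -(opprB x' c) enormN; move: cx hx' hk1 zr; rewrite -/r; lra.
- by rewrite (ltW hk1) (ltW zr).
have h1 : (size S')%:R * d ^+ n / z ^+ n <= e / 2 / (M * cmp_const n K).
  rewrite ler_pdivrMr//; apply: (@le_trans _ _ eta); last by rewrite /eta ge_min lexx.
  apply: le_trans Sk; rewrite ler_wpM2r ?exprn_ge0 ?(ltW d0)// ler_nat//.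
have := ler_wpM2l (ltW MC) h1; rewrite (mulrC (M * _) (e / 2 / _)) divfK ?gt_eqF//.
by move: (_ / z ^+ n) (z `^ s) => X Y; move: (cmp_const n K) => c; lra.
Qed.

(** On the ball of radius [z / 100] the boundary growth gives [|U| <= 2 Cb M z^s], where the 2
    absorbs [(101/100)^s]; the scaled gradient estimate then divides by [z]. *)
Lemma weighted_gradient n K : 0 < K -> exists2 C : R, 0 < C &
  forall s a b (U : 'rV[R]_(n + 1) -> R) M x z, 0 < s < 2 -> 0 < M ->
  coefficients K a b -> solution s a b U ->
  (forall Y, half_region n Y -> `|U Y| <= M) ->
  few_bad_points U [set x | enorm x <= 23 / 20] ->
  0 < z -> enorm (pt x z) <= 102 / 100 ->
  z `^ (1 - s) * enorm (grd U (pt x z)) <= C * M.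
Proof.
move=> K0; have [Cg Cg0 Hg] := @gradient_scaled n K K0.
have [Cb Cb0 Hb] := boundary_growth n K0.
exists (Cg * (Cb * 2)); first by rewrite !mulr_gt0.
move=> s a b U M x z s02 M0 co so UM bad z0 Y102; have /andP[s0 s2] := s02.
have zs0 : 0 < z `^ s by exact: powR_gt0.
have z102 : z <= 102 / 100.
  by apply: le_trans Y102; apply: le_trans (enorm_rsub x z); rewrite ler_norm.
have x102 : enorm x <= 102 / 100 by exact: le_trans (enorm_lsub x z) Y102.
have M'0 : 0 < Cb * 2 * M * z `^ s by rewrite !mulr_gt0.
have H := Hg s a b U (Cb * 2 * M * z `^ s) x z s02 M'0 co so z0 ltac:(lra).
have {}H : enorm (grd U (pt x z)) <= Cg * (Cb * 2 * M * z `^ s) / z.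
  apply: H => x' z' h.
  have hz : `|z' - z| <= z / 100 by apply: le_trans h; rewrite pt_sub; exact: enorm_rsub.
  have hx : enorm (x' - x) <= z / 100 by apply: le_trans h; rewrite pt_sub; exact: enorm_lsub.
  move: hz; rewrite ler_norml => /andP[hz1 hz2].
  have z'0 : 0 < z' by lra.
  have x'l : enorm x' <= enorm (x' - x) + enorm x by rewrite -{1}(subrK x x') enormD.
  have Y'l : enorm (pt x' z') <= enorm (pt x' z' - pt x z) + enorm (pt x z).
    by rewrite -{1}(subrK (pt x z) (pt x' z')) enormD.
  apply: le_trans (Hb s a b U M x' z' s02 M0 co so UM bad z'0 _ _) _.
  - lra.
  - by apply/half_region_pt; split; lra.
  rewrite -!mulrA ler_pM2l// (mulrCA 2) ler_pM2l//.
  apply: (@le_trans _ _ ((101 / 100 * z) `^ s)).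
    by apply: ge0_ler_powR; rewrite ?nnegrE//; lra.
  have c0 : 0 <= 101 / 100 :> R by lra.
  rewrite (powRM _ c0 (ltW z0)).
  rewrite ler_pM2r//; apply: (@le_trans _ _ ((101 / 100) `^ 2%:R)).
    by apply: ler_powR; lra.
  by rewrite powR_mulrn; lra.
apply: le_trans (ler_wpM2l (powR_ge0 _ _) H) _.
rewrite (_ : 1 - s = - s + 1); last by ring.
rewrite powRD; last by rewrite (gt_eqF z0) implybT.
rewrite powRN powRr1 ?(ltW z0)// le_eqVlt; apply/orP; left; apply/eqP.
by field; rewrite !gt_eqF.
Qed.

End core.
Arguments half_region {R} n _.

(** * Change of variables in the Laplace-Beltrami operator *)

Section matrix_calculus.
Context {R : realType} {n : nat}.
Implicit Types (x : 'rV[R]_n) (D : set 'rV[R]_n).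

Definition mxdiff p q (A : 'rV[R]_n -> 'M[R]_(p, q)) x : Prop :=
  forall j k, differentiable (fun y => A y j k) x.

Definition dmx p q (i : 'I_n) (A : 'rV[R]_n -> 'M[R]_(p, q)) x : 'M[R]_(p, q) :=
  \matrix_(j, k) partial i (fun y => A y j k) x.

Lemma differentiable_mulr (f g : 'rV[R]_n -> R) x :
  differentiable f x -> differentiable g x -> differentiable (fun y => f y * g y) x.
Proof. by move=> df dg; exact: differentiableM. Qed.

Lemma mxdiff_mul p q r (A : 'rV[R]_n -> 'M[R]_(p, q)) (B : 'rV[R]_n -> 'M[R]_(q, r)) x :
  mxdiff A x -> mxdiff B x -> mxdiff (fun y => A y *m B y) x.
Proof.
move=> dA dB j k; rewrite (_ : (fun y => _) = fun y => \sum_l A y j l * B y l k).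
  by apply: differentiable_sumr => l; exact: differentiable_mulr.
by apply/funext => y; rewrite mxE.
Qed.

Lemma dmx_mul p q r (A : 'rV[R]_n -> 'M[R]_(p, q)) (B : 'rV[R]_n -> 'M[R]_(q, r)) x i :
  mxdiff A x -> mxdiff B x ->
  dmx i (fun y => A y *m B y) x = dmx i A x *m B x + A x *m dmx i B x.
Proof.
move=> dA dB; apply/matrixP => j k; rewrite !mxE.
rewrite (_ : (fun y => _) = fun y => \sum_l A y j l * B y l k); last first.
  by apply/funext => y; rewrite mxE.
rewrite partial_sum => [|l]; last exact: differentiable_mulr.
rewrite -big_split; apply: eq_bigr => l _ /=.
by rewrite !mxE partialM// addrC (mulrC (B x l k)).
Qed.

Lemma mxdiff_tr p q (A : 'rV[R]_n -> 'M[R]_(p, q)) x : mxdiff A x -> mxdiff (fun y => (A y)^T) x.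
Proof.
move=> dA j k; rewrite (_ : (fun y => _) = fun y => A y k j)//.
by apply/funext => y; rewrite mxE.
Qed.

Lemma dmx_tr p q (A : 'rV[R]_n -> 'M[R]_(p, q)) x i : dmx i (fun y => (A y)^T) x = (dmx i A x)^T.
Proof.
apply/matrixP => j k; rewrite !mxE; congr (partial i _ x).
by apply/funext => y; rewrite mxE.
Qed.

Lemma dmx_ext p q D (A B : 'rV[R]_n -> 'M[R]_(p, q)) x i :
  open D -> (forall y, D y -> A y = B y) -> D x -> dmx i A x = dmx i B x.
Proof.
move=> oD AB Dx; apply/matrixP => j k; rewrite !mxE.
by apply: (partial_ext _ oD) => // y Dy; rewrite AB.
Qed.

Lemma partial_cst i (c : R) x : partial i (fun _ : 'rV[R]_n => c) x = 0.
Proof. by rewrite /partial derive_cst. Qed.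

Lemma differentiable_prod (I : Type) (r : seq I) (f : I -> 'rV[R]_n -> R) x :
  (forall k, differentiable (f k) x) ->
  differentiable (fun y => \prod_(k <- r) f k y) x.
Proof.
move=> df; elim: r => [|a r IH].
  by under eq_fun do rewrite big_nil; exact: differentiable_cst.
by under eq_fun do rewrite big_cons; exact: differentiable_mulr.
Qed.

Lemma partial_prod (I : eqType) (r : seq I) (f : I -> 'rV[R]_n -> R) x i :
  (forall k, differentiable (f k) x) -> uniq r ->
  partial i (fun y => \prod_(k <- r) f k y) x =
  \sum_(k <- r) partial i (f k) x * \prod_(l <- r | l != k) f l x.
Proof.
move=> df; elim: r => [_|a r IH /=/andP[ar ur]].
  by under eq_fun do rewrite big_nil; rewrite partial_cst big_nil.
have E : (fun y => \prod_(k <- a :: r) f k y) = (fun y => f a y * \prod_(k <- r) f k y).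
  by apply/funext => y; rewrite big_cons.
rewrite E partialM//; last exact: differentiable_prod.
rewrite IH// big_cons addrC; congr (_ + _).
  rewrite mulrC; congr (_ * _); rewrite big_cons eqxx /=.
  rewrite big_seq [RHS]big_seq_cond; apply: eq_bigl => l.
  by case: (boolP (l \in r)) => //= lr; case: eqP lr ar => // -> ->.
rewrite mulr_sumr; apply: eq_big_seq => k kr.
rewrite big_cons; case: eqP kr ar => [-> ->//|_ _ _].
by rewrite mulrCA.
Qed.

Lemma det_diff p (A : 'rV[R]_n -> 'M[R]_p) x : mxdiff A x ->
  differentiable (fun y => \det (A y)) x.
Proof.
move=> dA; rewrite /determinant; apply: differentiable_sumr => s.
apply: differentiable_mulr; first exact: differentiable_cst.
exact: differentiable_prod.
Qed.

(** Jacobi's formula. Differentiating the Leibniz sum replaces one row at a time, and expansion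
    along that row leaves the cofactors of [A x]. *)
Lemma partial_det p (A : 'rV[R]_n -> 'M[R]_p) x i : mxdiff A x ->
  partial i (fun y => \det (A y)) x = \tr (\adj (A x) *m dmx i A x).
Proof.
move=> dA.
have F s : differentiable (fun y => \prod_k A y k (s k)) x by exact: differentiable_prod.
rewrite /determinant partial_sum => [|s]; last first.
  by apply: differentiable_mulr => //; exact: differentiable_cst.
pose B k := \matrix_(l, j) if l == k then dmx i A x k j else A x l j.
transitivity (\sum_k \det (B k)).
  rewrite exchange_big /=; apply: eq_bigr => s _.
  rewrite partialM; [|exact: differentiable_cst|exact: F].
  rewrite partial_cst mulr0 addr0 partial_prod ?index_enum_uniq// mulr_sumr.
  apply: eq_bigr => k _; congr (_ * _).
  rewrite [RHS](bigD1 k)//= !mxE eqxx; congr (_ * _).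
  by apply: eq_bigr => l /negbTE lk; rewrite mxE lk.
rewrite mxtrace_mulC; apply: eq_bigr => k _.
rewrite (expand_det_row _ k) mxE; apply: eq_bigr => j _.
rewrite [\adj _ _ _]mxE /B [X in X * _]mxE eqxx; congr (_ * _).
rewrite /cofactor; congr (_ * \det _); apply/matrixP => l m; rewrite !mxE.
by rewrite eq_sym (negbTE (neq_lift _ _)).
Qed.

Lemma invmx_diff p D (A : 'rV[R]_n -> 'M[R]_p) x : open D ->
  (forall y, D y -> A y \in unitmx) -> D x -> mxdiff A x -> mxdiff (fun y => invmx (A y)) x.
Proof.
move=> oD uA Dx dA j k.
apply: (differentiable_ext oD (f := fun y => (\det (A y))^-1 * cofactor (A y) k j)) => //.
  by move=> y Dy; rewrite /invmx uA// !mxE.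
apply: differentiable_mulr.
  apply: differentiableV; first exact: det_diff.
  by have := uA _ Dx; rewrite unitmxE unitfE.
rewrite /cofactor; apply: differentiable_mulr; first exact: differentiable_cst.
apply: det_diff => j' k'.
by rewrite (_ : (fun y => _) = fun y => A y (lift k j') (lift j k'))//; apply/funext => y; rewrite !mxE.
Qed.

Lemma dmx_inv p D (A : 'rV[R]_n -> 'M[R]_p) x i : open D ->
  (forall y, D y -> A y \in unitmx) -> D x -> mxdiff A x ->
  dmx i (fun y => invmx (A y)) x = - (invmx (A x) *m dmx i A x *m invmx (A x)).
Proof.
move=> oD uA Dx dA; have dI := invmx_diff oD uA Dx dA.
have : dmx i (fun y => A y *m invmx (A y)) x = 0.
  rewrite (@dmx_ext _ _ D _ (fun _ => 1%:M))// => [|y Dy]; last by rewrite mulmxV ?uA.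
  by apply/matrixP => j k; rewrite !mxE partial_cst.
rewrite dmx_mul// => /(congr1 (mulmx (invmx (A x)))).
rewrite mulmxDr mulmx0 mulKmx ?uA// => /eqP; rewrite addr_eq0 => /eqP E.
by rewrite mulmxA in E; rewrite E opprK.
Qed.

(* The contraction [Gamma_p = h^ij (d_i g_pj - d_p g_ij / 2)] of the Christoffel
   symbols of [g], for [h] the inverse of [g] and [d i] its i-th derivative. *)
Definition christ (h : 'M[R]_n) (d : 'I_n -> 'M[R]_n) : 'rV[R]_n :=
  \row_p (\sum_i (d i *m h) p i - 2^-1 * \tr (h *m d p)).

(** The density contributes [tr (h d_i g) / 2] by Jacobi's formula and the inverse metric
    [- h (d_i g) h]; together they form the contracted Christoffel symbols. The derivative of the
    weight [w] is the last term. *)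
Lemma divergence_expand D (g : 'rV[R]_n -> 'M[R]_n) (w u : 'rV[R]_n -> R) x :
  let h := invmx (g x) in
  open D -> D x -> mxdiff g x ->
  (forall y, D y -> (g y)^T = g y) -> (forall y, D y -> 0 < \det (g y)) ->
  differentiable w x -> C2on D u ->
  (Num.sqrt (\det (g x)))^-1 *
  \sum_i partial i (fun y => Num.sqrt (\det (g y)) *
     (w y *: (grd u y *m invmx (g y))) 0 i) x =
  w x * (\tr (h *m hess u x) - dot (christ h (fun i => dmx i g x)) (grd u x *m h))
  + dot (grd w x *m h) (grd u x).
Proof.
move=> h oD Dx dg gs gp dw u2.
have gu y : D y -> g y \in unitmx by move=> Dy; rewrite unitmxE unitfE gt_eqF ?gp.
set rho := fun y => Num.sqrt (\det (g y)).
have rho0 : 0 < rho x by rewrite sqrtr_gt0 gp.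
have dG : differentiable (fun y => \det (g y)) x by exact: det_diff.
have drho : differentiable rho x.
  apply: (@differentiable_comp _ _ _ _ (fun y => \det (g y)) Num.sqrt) => //.
  by apply/derivable1_diffP; have [] := is_derive1_sqrt (gp _ Dx).
have adjE : \adj (g x) = rho x ^+ 2 *: h.
  by rewrite /h /invmx gu// scalerA sqr_sqrtr ?(ltW (gp _ Dx))// mulfV ?scale1r// gt_eqF ?gp.
have prho i : partial i rho x = rho x * (2^-1 * \tr (h *m dmx i g x)).
  have := partial_det i dg; rewrite adjE -scalemxAl mxtraceZ.
  rewrite (@partial_ext _ _ D _ (fun y => rho y * rho y))// => [|y Dy]; last first.
    by rewrite -expr2 sqr_sqrtr ?(ltW (gp _ Dy)).
  rewrite partialM//; move: (partial i rho x) (\tr _) => q t E.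
  by apply: (mulfI (lt0r_neq0 rho0)); move: E; lra.
have dh : mxdiff (fun y => invmx (g y)) x by exact: (invmx_diff oD).
have dgr : mxdiff (grd u) x.
  move=> j k; rewrite (_ : (fun y => _) = partial k u); first by case: (u2.2 k x Dx).
  by apply/funext => y; rewrite mxE.
set V := fun y => grd u y *m invmx (g y).
have dV : mxdiff V x by exact: mxdiff_mul.
have pV i : partial i (fun y => V y 0 i) x =
    \sum_j hess u x j i * h j i - ((grd u x *m h) *m (dmx i g x *m h)) 0 i.
  have := dmx_mul i dgr dh => /matrixP /(_ 0 i); rewrite mxE => ->.
  rewrite (dmx_inv i oD gu Dx dg) mxE; congr (_ + _).
    rewrite mxE; apply: eq_bigr => j _; rewrite !mxE; congr (partial i _ x * _).
    by apply/funext => y; rewrite mxE.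
  by rewrite mulmxN mxE -!mulmxA.
have E i : partial i (fun y => rho y * (w y *: V y) 0 i) x = rho x *
   (w x * (2^-1 * \tr (h *m dmx i g x) * V x 0 i + partial i (fun y => V y 0 i) x)
     + partial i w x * V x 0 i).
  rewrite (_ : (fun y => _) = (fun y => rho y * (w y * V y 0 i))); last first.
    by apply/funext => y; rewrite mxE.
  rewrite partialM//; last exact: differentiable_mulr.
  by rewrite partialM// prho; ring.
under eq_bigr do rewrite E.
have hs : h^T = h by rewrite invmx_sym ?gs.
have Vx : V x = grd u x *m h by [].
rewrite -mulr_sumr mulKf ?gt_eqF// big_split /=; congr (_ + _); last first.
  transitivity (dot (V x) (grd w x)).
    by rewrite dotE; apply: eq_bigr => i _; rewrite mulrC [grd w x 0 i]mxE.
  by rewrite Vx; exact: dot_sym.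
rewrite -mulr_sumr; congr (_ * _); rewrite big_split /= -Vx.
under [X in _ + X]eq_bigr do rewrite pV.
rewrite sumrB addrCA; congr (_ + _).
  apply: eq_bigr => i _; rewrite mxE; apply: eq_bigr => j _.
  by rewrite mulrC -[in LHS]hs mxE.
rewrite dotE -[RHS]sumrN; under [X in _ - X]eq_bigr do rewrite mxE.
rewrite [X in _ - X]exchange_big -sumrB; apply: eq_bigr => p _.
rewrite [christ _ _ _ _]mxE; under [X in _ - X]eq_bigr do rewrite mulrC.
by rewrite -mulr_suml -mulrBl -mulNr opprB.
Qed.

(** [T] stands for the second derivatives of a change of coordinates, and the assumption on [dG] is
    the product rule for [J g J^T]. The contraction transforms as a covector up to the inhomogeneous
    term [t]. *)
Lemma christ_change (J g a : 'M[R]_n) (T dg dG : 'I_n -> 'M[R]_n) :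
  let h := invmx g in
  let t := \row_k \sum_i ((T i)^T *m a) k i in
  J \in unitmx -> g \in unitmx -> a = invmx (J *m g *m J^T) ->
  g^T = g -> (forall i m k, T i m k = T m i k) ->
  (forall i, dG i = T i *m g *m J^T + J *m (\sum_q J i q *: dg q) *m J^T + J *m g *m (T i)^T) ->
  christ a dG = (christ h dg + t *m g) *m J^T.
Proof.
move=> h t uJ ug aE gs TC dGE.
have uJT : J^T \in unitmx by rewrite unitmx_tr.
have uG : J *m g *m J^T \in unitmx by rewrite !unitmx_mul uJ ug.
have gJa : g *m J^T *m a = invmx J.
  by apply: (can_inj (mulKmx uJ)); rewrite !mulmxA aE !mulmxV.
have Ja : J^T *m a = h *m invmx J by rewrite -gJa !mulmxA mulVmx// mul1mx.
have as_ : a^T = a by rewrite aE invmx_sym// !trmx_mul trmxK gs mulmxA.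
apply/rowP => m; rewrite mxE.
have -> : \tr (a *m dG m) = 2 * (\sum_i (T m *m invmx J) i i) +
    \sum_q J m q * \tr (h *m dg q).
  rewrite dGE !mulmxDr !mxtraceD.
  have -> : \tr (a *m (J *m g *m (T m)^T)) = \tr (a *m (T m *m g *m J^T)).
    by rewrite -mxtrace_tr !trmx_mul trmxK as_ gs mxtrace_mulC !mulmxA.
  have -> : \tr (a *m (T m *m g *m J^T)) = \sum_i (T m *m invmx J) i i.
    by rewrite mxtrace_mulC -!mulmxA (mulmxA g) gJa.
  have -> : \tr (a *m (J *m (\sum_q J m q *: dg q) *m J^T)) = \sum_q J m q * \tr (h *m dg q).
    rewrite mxtrace_mulC -!mulmxA Ja (mxtrace_mulC J) -!mulmxA mulVmx// mulmx1 mxtrace_mulC.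
    rewrite mulmx_sumr raddf_sum /=; apply: eq_bigr => q _.
    by rewrite -scalemxAr mxtraceZ.
  by rewrite addrAC -mulr2n mulr_natl.
have -> : \sum_i (dG i *m a) m i = \sum_i (T m *m invmx J) i i +
   (\row_p (\sum_i (dg i *m h) p i) *m J^T) 0 m + (t *m g *m J^T) 0 m.
  have addE (A B : 'M[R]_n) i j : (A + B) i j = A i j + B i j by rewrite mxE.
  under eq_bigr do rewrite dGE !mulmxDl !addE.
  rewrite !big_split /=; congr (_ + _ + _).
  - apply: eq_bigr => i _; rewrite -!mulmxA (mulmxA g) gJa mxE [RHS]mxE.
    by apply: eq_bigr => k _; rewrite TC.
  - under eq_bigr do rewrite -!mulmxA Ja mulmx_suml mulmx_sumr summxE.
    rewrite exchange_big /=; rewrite mxE.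
    transitivity (\sum_q (J *m (dg q *m h)) m q).
      apply: eq_bigr => q _.
      transitivity ((J *m (dg q *m h) *m invmx J *m J) m q).
        by rewrite mxE; apply: eq_bigr => i _; rewrite mulrC -!scalemxAl -scalemxAr mxE -!mulmxA.
      by rewrite mulmxKV.
    under eq_bigr do rewrite mxE.
    rewrite exchange_big /=; apply: eq_bigr => k _; rewrite !mxE mulr_suml.
    by apply: eq_bigr => i _; rewrite mulrC.
  - under eq_bigr do rewrite -mulmxA mxE.
    rewrite exchange_big /= -mulmxA -[g *m J^T]trmxK trmx_mul trmxK gs mxE.
    apply: eq_bigr => k _; rewrite !mxE mulr_suml; apply: eq_bigr => i _.
    by rewrite mulrC.
have E : (christ h dg *m J^T) 0 m = (\row_p (\sum_i (dg i *m h) p i) *m J^T) 0 m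
    - 2^-1 * \sum_q J m q * \tr (h *m dg q).
  rewrite mulr_sumr !mxE -sumrB; apply: eq_bigr => q _.
  by rewrite !mxE; ring.
have addE (A B : 'rV[R]_n) j : (A + B) 0 j = A 0 j + B 0 j by rewrite mxE.
by rewrite mulmxDl addE E; move: (\sum_i _) (_ 0 m) (_ 0 m) (\sum_q _) => A B C' D; lra.
Qed.

Definition jacobian m (tau : 'rV[R]_n -> 'rV[R]_m) x : 'M[R]_(n, m) :=
  \matrix_(i, k) partial i (fun y => tau y 0 k) x.

End matrix_calculus.

Section laplacian.
Context {R : realType} {n : nat}.
Implicit Types (D E : set 'rV[R]_n) (g : 'rV[R]_n -> 'M[R]_n).
Variables (D E : set 'rV[R]_n) (tau : 'rV[R]_n -> 'rV[R]_n) (x : 'rV[R]_n).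
Hypotheses (oE : open E) (Ex : E x) (ED : forall y, E y -> D (tau y)).
Hypothesis tau2 : forall k, C2on E (fun y => tau y 0 k).

Let J := jacobian tau.
Let T i : 'M[R]_n := dmx i J x.

Lemma tau_diff y k : E y -> differentiable (fun y => tau y 0 k) y.
Proof. by move=> Ey; have [/(_ y Ey)[]] := tau2 k. Qed.

Lemma jacobian_diff : mxdiff J x.
Proof.
move=> i k; rewrite (_ : (fun y => _) = partial i (fun y => tau y 0 k)).
  by have [_ /(_ i x Ex)[]] := tau2 k.
by apply/funext => y; rewrite mxE.
Qed.

Lemma djacobianE i m k : T i m k = partial i (partial m (fun y => tau y 0 k)) x.
Proof. by rewrite mxE; congr (partial i _ x); apply/funext => y; rewrite mxE. Qed.

Lemma djacobianC i m k : T i m k = T m i k.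
Proof.
have nE : nbhs x E by exact: open_nbhs_nbhs.
apply: (etrans (djacobianE i m k)); apply: (etrans _ (esym (djacobianE m i k))).
exact: (@partialC R n E (fun y => tau y 0 k) x i m nE (tau2 k)).
Qed.

Lemma grd_comp (u : 'rV[R]_n -> R) y : E y -> differentiable u (tau y) ->
  grd (u \o tau) y = grd u (tau y) *m (J y)^T.
Proof.
move=> Ey du; apply/rowP => i; rewrite !mxE partial_comp// => [|k]; last exact: tau_diff.
by apply: eq_bigr => k _; rewrite !mxE mulrC.
Qed.

Lemma hess_comp (u : 'rV[R]_n -> R) : C2on D u ->
  hess (u \o tau) x = J x *m hess u (tau x) *m (J x)^T + \sum_k grd u (tau x) 0 k *: \matrix_(i, m) T i m k.
Proof.
move=> u2; apply/matrixP => i m; rewrite !mxE summxE.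
have du y : D y -> differentiable u y by move=> Dy; have [/(_ y Dy)[]] := u2.
have ddu y k : D y -> differentiable (partial k u) y.
  by move=> Dy; have [_ /(_ k y Dy)[]] := u2.
have dtx k : differentiable (fun y => tau y 0 k) x by exact: tau_diff.
rewrite (@partial_ext _ _ E _ (fun y => \sum_k J y i k * (partial k u \o tau) y))//; last first.
  move=> y Ey; rewrite partial_comp//; [|by move=> k; exact: tau_diff|by apply/du/ED].
  by apply: eq_bigr => k _; rewrite mxE.
have dc k : differentiable (partial k u \o tau) x.
  apply: differentiable_comp; first exact: differentiable_rV.
  by apply/ddu/ED.
rewrite partial_sum => [|k]; last by apply: differentiable_mulr; [exact: jacobian_diff|exact: dc].
under eq_bigr => k _.
  rewrite (partialM _ (jacobian_diff i k) (dc k)); over.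
rewrite big_split /=; congr (_ + _); last first.
  apply: eq_bigr => k _; have -> : partial m (fun y => J y i k) x = T i m k.
    by rewrite djacobianC /T [RHS]mxE.
  by rewrite [RHS]mxE [X in _ = _ * X]mxE [grd _ _ _ _]mxE.
transitivity (\sum_k \sum_l J x i k * (J x m l * partial l (partial k u) (tau x))).
  apply: eq_bigr => k _; rewrite (partial_comp m dtx (ddu _ k (ED Ex))) mulr_sumr.
  by apply: eq_bigr => l _; rewrite [J x m l]mxE.
rewrite exchange_big /=; apply: eq_bigr => l _.
rewrite [(J x *m _) _ _]mxE [((J x)^T) _ _]mxE mulr_suml; apply: eq_bigr => k _.
by rewrite mulrA mulrAC; congr (_ * _ * _); rewrite [RHS]mxE.
Qed.

(** The left side lives in a chart of the atlas, where nothing is controlled; the right side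
    involves only the pulled-back metric and its first derivatives. Both are put in nondivergence
    form, and the inhomogeneous term of [christ_change] cancels the second derivatives of [tau] in
    [hess_comp]. *)
Lemma laplacian_change g (w u : 'rV[R]_n -> R) :
  let G y := J y *m g (tau y) *m (J y)^T in let a := invmx (G x) in
  open D -> J x \in unitmx ->
  (forall y, D y -> mxdiff g y) -> (forall y, D y -> (g y)^T = g y) ->
  (forall y, D y -> 0 < \det (g y)) -> differentiable w (tau x) -> C2on D u ->
  (Num.sqrt (\det (g (tau x))))^-1 *
  \sum_i partial i (fun y => Num.sqrt (\det (g y)) *
     (w y *: (grd u y *m invmx (g y))) 0 i) (tau x) =
  w (tau x) * (\tr (a *m hess (u \o tau) x)
      - dot (christ a (fun i => dmx i G x) *m a) (grd (u \o tau) x))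
  + dot (grd (w \o tau) x *m a) (grd (u \o tau) x).
Proof.
move=> G a oD uJ dg gs gp dw u2.
have Dx := ED Ex.
have ug : g (tau x) \in unitmx by rewrite unitmxE unitfE gt_eqF ?gp.
set h := invmx (g (tau x)).
have uJT : (J x)^T \in unitmx by rewrite unitmx_tr.
have JaJ : (J x)^T *m a *m J x = h.
  have uG : G x \in unitmx by rewrite !unitmx_mul uJ ug.
  apply: (can_inj (mulKmx ug)); rewrite mulmxV//; apply: (can_inj (mulKmx uJ)).
  by rewrite !mulmxA mulmxV// mul1mx mulmx1.
have := divergence_expand oD Dx (dg _ Dx) gs gp dw u2; rewrite -/h => ->.
have du : differentiable u (tau x) by have [/(_ _ Dx)[]] := u2.
have dtx k : differentiable (fun y => tau y 0 k) x by exact: tau_diff.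
have dgt : mxdiff (fun y => g (tau y)) x.
  move=> i k; apply: (@differentiable_comp _ _ _ _ tau (fun y => g y i k)).
    exact: differentiable_rV.
  exact: dg.
set t := \row_k \sum_i ((T i)^T *m a) k i.
have dJ := jacobian_diff.
have cE : christ a (fun i => dmx i G x) =
    (christ h (fun i => dmx i g (tau x)) + t *m g (tau x)) *m (J x)^T.
  apply: christ_change => // [|i m k|i]; first exact: gs.
    exact: djacobianC.
  rewrite /G dmx_mul; [|exact: mxdiff_mul|exact: mxdiff_tr].
  rewrite dmx_mul// dmx_tr mulmxDl; congr (_ + _ *m _ + _); congr (_ *m _).
  apply/matrixP => j k; rewrite mxE summxE.
  rewrite (@partial_comp _ _ _ tau (fun y => g y j k))//; last exact: dg.
  by apply: eq_bigr => q _; rewrite !mxE.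
have hE : \tr (a *m hess (u \o tau) x) = \tr (h *m hess u (tau x)) + dot t (grd u (tau x)).
  rewrite (hess_comp u2) mulmxDr mxtraceD; congr (_ + _).
    by rewrite mulmxA mxtrace_mulC !mulmxA JaJ.
  rewrite mulmx_sumr raddf_sum /= dotE; apply: eq_bigr => k _.
  rewrite -scalemxAr mxtraceZ mulrC; congr (_ * _).
  rewrite mxtrace_mulC !mxE; apply: eq_bigr => i _.
  by rewrite !mxE; apply: eq_bigr => m _; rewrite !mxE.
have hs : h^T = h by rewrite invmx_sym ?gs.
have gE := grd_comp Ex du.
have gwE := grd_comp Ex dw.
have gh : g (tau x) *m h = 1%:M by rewrite mulmxV.
clearbody h a.
rewrite [X in _ = _ * (X - _) + _]hE [X in _ = _ * (_ - dot (X *m _) _) + _]cE.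
rewrite [X in _ = _ * (_ - dot _ X) + dot _ X]gE [X in _ = _ + dot (X *m _) _]gwE.
have dotJ (v p : 'rV[R]_n) : dot (v *m (J x)^T *m a) (p *m (J x)^T) = dot (v *m h) p.
  by rewrite /dot -JaJ trmx_mul trmxK !mulmxA.
rewrite !dotJ mulmxDl -(mulmxA t) gh mulmx1 dotDl.
have -> : dot (christ h (fun i => dmx i g (tau x))) (grd u (tau x) *m h) =
    dot (christ h (fun i => dmx i g (tau x)) *m h) (grd u (tau x)).
  by rewrite dotC; exact: dot_sym.
congr (_ * _ + _); move: (dot _ _) (dot _ _) (\tr _) => A B C.
by rewrite opprD addrACA subrr addr0.
Qed.

End laplacian.

(** * Coefficients of the equation *)

(** Along the segment from the identity to [G] all forms are positive, so the determinant never
    vanishes and keeps the sign of 1. The parameter is a row of length one so that [det_diff] gives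
    the continuity. *)
Lemma det_pos (R : realType) n (G : 'M[R]_n) :
  (forall v : 'rV[R]_n, v != 0 -> 0 < quad G v) -> 0 < \det G.
Proof.
move=> Gp; pose A (y : 'rV[R]_1) : 'M[R]_n := 1%:M + y 0 0 *: (G - 1%:M).
have dA y : mxdiff A y.
  move=> j k; rewrite (_ : (fun y => _) = fun y : 'rV[R]_1 => (1%:M : 'M[R]_n) j k + y 0 0 * (G - 1%:M) j k).
    apply: differentiableD; first exact: differentiable_cst.
    by apply: differentiable_mulr; [exact: differentiable_coord|exact: differentiable_cst].
  by apply/funext => z; rewrite !mxE.
pose f (t : R) := \det (A (t *: delta_mx 0 0)).
have fc : {within `[0, 1], continuous f}.
  apply: continuous_subspaceT => t.
  apply: (@continuous_comp _ _ _ (fun t : R => t *: delta_mx 0 0 : 'rV[R]_1) (fun y => \det (A y))).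
    exact: scalel_continuous.
  by apply: differentiable_continuous; exact: det_diff.
have A01 t : A (t *: delta_mx 0 0) = (1 - t)%:M + t *: G.
  rewrite /A !mxE eqxx mulr1 scalerBr scalemx1 addrCA addrC raddfB /=.
  by rewrite -addrA addrC.
have f0 : f 0 = 1 by rewrite /f A01 subr0 scale0r addr0 det1.
have f1 : f 1 = \det G by rewrite /f A01 subrr scale1r raddf0 add0r.
rewrite -f1 ltNge; apply/negP => f1n.
have [|t] := IVT ler01 fc (v := 0).
  by rewrite f0 ge_min le_max ler01 f1n orbT.
rewrite in_itv /= => /andP[t0 t1] ft.
have : A (t *: delta_mx 0 0) \in unitmx.
  apply: pos_unitmx => v v0; rewrite A01 quadD quad_scalar quadZ.
  have q0 := Gp v v0; have e0 : 0 < enorm2 v.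
    by rewrite lt_neqAle enorm2_ge0 andbT eq_sym; apply/eqP => /enorm2_eq0 /eqP; apply/negP.
  have [->|tn0] := eqVneq t 0; first by rewrite subr0 mul1r mul0r addr0.
  by apply: ltr_wpDl; [rewrite mulr_ge0// ?subr_ge0 ?(ltW e0)|rewrite mulr_gt0// lt_neqAle eq_sym tn0].
by rewrite unitmxE -/(f t) ft unitr0.
Qed.

Section charts.
Context {R : realType} {n : nat} {M : topologicalType}.
Variables (X : riemann_data R M n) (p : M) (phi : 'rV[R]_n -> M) (r : R).
Hypotheses (rm : riemannian_manifold X) (fl : flatness X 2 r p phi).

Local Notation E := (eball r : set 'rV[R]_n).
Let Ec (c : chart X) := E `&` phi @^-1` dom c.
Let tau (c : chart X) (x : 'rV[R]_n) := Defs.coord c (phi x).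
Local Notation G := (pullback_metric X phi).

Lemma open_eball0 : open E.
Proof.
have := @open_eball R n 0 r; congr open.
by apply/seteqP; split=> x; rewrite /eball /= subr0.
Qed.

Lemma phi_continuous x : E x -> {for x, continuous phi}.
Proof. by have [[_ + _ _] _ _ _] := fl; exact. Qed.

Lemma open_phi_preimage (A : set M) : open A -> open (E `&` phi @^-1` A).
Proof.
move=> oA; rewrite openE => x [Ex Ax]; apply: filterI.
  exact: (open_nbhs_nbhs (conj open_eball0 Ex)).
exact: (phi_continuous Ex (open_nbhs_nbhs (conj oA Ax))).
Qed.

Lemma open_Ec c : open (Ec c).
Proof. by apply: open_phi_preimage; exact: rm_dom_open. Qed.

Lemma Ec_at x : E x -> Ec (chart_at X (phi x)) x.
Proof. by move=> Ex; split=> //; exact: rm_chart_at. Qed.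

Lemma tau_smooth c k : C2on (Ec c) (fun x => tau c x 0 k).
Proof.
have [[_ _ sm _] _ _ _] := fl.
refine (@smooth_C2on R n _ (Ec c) (fun x => tau c x 0 k) (@open_Ec c) (@subset_refl _ (Ec c)) (sm c k)).
Qed.
Arguments tau_smooth : clear implicits.

Lemma coord_image_dom (c : chart X) (A : set M) q : dom c q -> A q -> coord_image c A (Defs.coord c q).
Proof. by move=> cq Aq; exists q. Qed.

Lemma open_coord_image (c : chart X) (A : set M) : open A -> open (coord_image c A).
Proof.
move=> oA; rewrite openE => _ [q [cq Aq] <-].
have cI : coord_image c setT (Defs.coord c q) by exists q.
have n1 := open_nbhs_nbhs (conj (@rm_image_open _ _ _ _ rm c) cI).
have n2 : nbhs (coordV c (Defs.coord c q)) A.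
  by rewrite (rm_coordK rm)//; exact: (open_nbhs_nbhs (conj oA Aq)).
have n3 := rm_coordV_continuous rm cI n2.
apply: filterS (filterI n1 n3) => _ [[q' [cq' _] <-]] /=.
by rewrite /preimage /= (rm_coordK rm)// => Aq'; exists q'.
Qed.

Lemma transition_coord (c d : chart X) k : C2on (coord_image c (dom d)) (transition c d k).
Proof.
have oD : open (coord_image c (dom d)) by apply: open_coord_image; exact: rm_dom_open.
exact: (smooth_C2on oD (@subset_refl _ _) (@rm_transition_smooth _ _ _ _ rm c d k)).
Qed.
Arguments transition_coord : clear implicits.

Lemma metric_C1 (c : chart X) i j : C1on (coord_image c setT) (fun x => gmat c x i j).
Proof.
have oD : open (coord_image c setT) by exact: rm_image_open.
by have [] := smooth_C2on oD (@subset_refl _ _) (@rm_metric_smooth _ _ _ _ rm c i j).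
Qed.
Arguments metric_C1 : clear implicits.

Let J c := jacobian (tau c).

(** The definition uses the chart attached to [phi x], which may jump as [x] varies; in a fixed
    chart the same matrix can be differentiated. *)
Lemma pullback_chart c x : Ec c x ->
  G x = J c x *m gmat c (tau c x) *m (J c x)^T.
Proof.
move=> [Ex cx]; rewrite /pullback_metric; set d := chart_at X (phi x).
have dx : dom d (phi x) by exact: rm_chart_at.
set S : 'M[R]_n := \matrix_(i, k) partial i (transition c d k) (Defs.coord c (phi x)).
rewrite (rm_metric_change rm cx dx) -/S.
suff -> : \matrix_(i, k) partial i (fun y => Defs.coord d (phi y) 0 k) x = J c x *m S.
  by rewrite trmx_mul !mulmxA.
apply/matrixP => i k; rewrite !mxE.
pose D := Ec c `&` Ec d.
have oD : open D by apply: openI; exact: open_Ec.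
have Dx : D x by [].
have cdx : coord_image c (dom d) (tau c x) by exact: coord_image_dom.
rewrite (@partial_ext _ _ D _ (transition c d k \o tau c))//; last first.
  by move=> y [[_ cy] _]; rewrite /transition /= (rm_coordK rm).
rewrite partial_comp//.
- by apply: eq_bigr => l _; rewrite !mxE.
- by move=> l; have [/(_ x (conj Ex cx))[]] := tau_smooth c l.
- by have [/(_ _ cdx)[]] := transition_coord c d k.
Qed.

Lemma pullback_C1 i j : C1on E (fun x => G x i j).
Proof.
move=> x Ex; pose c := chart_at X (phi x); have Ecx := Ec_at Ex; rewrite -/c in Ecx.
have J1 k l : C1on (Ec c) (fun y => J c y k l).
  have [_ /(_ k)] := tau_smooth c l; apply: C1on_ext; first exact: open_Ec.
  by move=> y _; rewrite mxE.
suff : C1on (Ec c) (fun y => G y i j) by move=> /(_ x Ecx).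
apply: (@C1on_ext _ _ (Ec c) (fun y => \sum_k (\sum_l J c y i l * gmat c (tau c y) l k) * J c y j k)).
- exact: open_Ec.
- move=> y /pullback_chart ->; rewrite [RHS]mxE; apply: eq_bigr => k _.
  by rewrite [(_ *m _) _ _]mxE [(_^T) _ _]mxE.
apply: C1on_sum => [|k]; first exact: open_Ec.
apply: C1on_mul => //; first exact: open_Ec.
apply: C1on_sum => [|l]; first exact: open_Ec.
apply: C1on_mul => //; first exact: open_Ec.
apply: (C1on_comp (@open_Ec c) _ _ (metric_C1 c l k)).
  by move=> y [_ cy]; exact: coord_image_dom.
by move=> m; have [] := tau_smooth c m.
Qed.
Arguments pullback_C1 : clear implicits.

Lemma pullback_sym x : E x -> (G x)^T = G x.
Proof.
move=> Ex; have Ecx := Ec_at Ex; rewrite (pullback_chart Ecx) !trmx_mul trmxK.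
rewrite (rm_metric_sym rm) ?mulmxA//.
by case: Ecx => _ cx; apply: coord_image_dom.
Qed.

Lemma pullback_bounds x v : E x ->
  99 / 100 * enorm2 v <= quad (G x) v <= 101 / 100 * enorm2 v.
Proof.
move=> Ex; have [_ _ /(_ x v Ex) + _] := fl.
have e1 : 1 - 100%:R^-1 = 99 / 100 :> R by lra.
have e2 : 1 + 100%:R^-1 = 101 / 100 :> R by lra.
by rewrite e1 e2.
Qed.

Lemma pullback_partial i j k x : E x -> r * `|partial k (fun y => G y i j) x| <= 100%:R^-1.
Proof.
move=> Ex; have [_ _ _ /(_ (fun l => (l == k : nat)) i j x)] := fl.
have -> : (\sum_l (l == k : nat) = 1)%N.
  by rewrite (bigD1 k)//= eqxx big1 ?addn0// => l /negbTE ->.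
rewrite expr1 => /(_ isT Ex); congr (_ * `|_| <= _).
rewrite /mpartial.
have H : forall s : seq 'I_n, uniq s ->
   foldr (fun i h => iter (i == k) (partial i) h) (fun y => G y i j) s =
   if k \in s then partial k (fun y => G y i j) else (fun y => G y i j).
  elim=> //= l s IH /andP[ls us]; rewrite IH// inE eq_sym.
  by case: (eqVneq k l) ls => [<-|] //= /negbTE ->.
by rewrite H ?enum_uniq// mem_enum.
Qed.

End charts.

Section coefficient_bounds.
Context {R : realType}.

Lemma ler_sum_const n (f : 'I_n -> R) c : (forall i, f i <= c) -> \sum_i f i <= n%:R * c.
Proof.
move=> fc; rewrite mulr_natl -[X in _ <= _ *+ X]card_ord -sumr_const.
by apply: ler_sum.
Qed.

Lemma ler_norm_sum_const n (f : 'I_n -> R) c : (forall i, `|f i| <= c) ->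
  `|\sum_i f i| <= n%:R * c.
Proof. by move=> fc; apply: le_trans (ler_norm_sum _ _ _) (ler_sum_const fc). Qed.

Lemma mulmx_entry_le m k l (A : 'M[R]_(m, k)) (B : 'M[R]_(k, l)) al be :
  0 <= al -> (forall i j, `|A i j| <= al) -> (forall i j, `|B i j| <= be) ->
  forall i j, `|(A *m B) i j| <= k%:R * (al * be).
Proof.
move=> al0 Aal Bbe i j; rewrite mxE; apply: ler_norm_sum_const => q.
by rewrite normrM; apply: ler_pM.
Qed.

Lemma quad_entries_le n (S : 'M[R]_n) s v : 0 <= s -> (forall i j, `|S i j| <= s) ->
  `|quad S v| <= n%:R ^+ 2 * s * enorm2 v.
Proof.
move=> s0 Ss; rewrite quad_sum expr2 -!mulrA.
apply: ler_norm_sum_const => i; apply: ler_norm_sum_const => j.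
rewrite !normrM (mulrC `|v 0 i|) -mulrA; apply: ler_pM => //.
by rewrite -sqr_enorm expr2; apply: ler_pM; rewrite ?normr_ge0 ?normr_coord_le.
Qed.

Lemma enorm_entries_le n (v : 'rV[R]_n) c : 0 <= c -> (forall i, `|v 0 i| <= c) ->
  enorm v <= n%:R * c.
Proof.
move=> c0 vc; rewrite enorm_le ?mulr_ge0//.
apply: (@le_trans _ _ (n%:R * c ^+ 2)).
  by apply: ler_sum_const => i; rewrite -real_normK ?num_real// lerXn2r ?nnegrE.
rewrite exprMn ler_wpM2r ?exprn_ge0//; case: n {v vc} => [|n]; first by rewrite expr0n.
by rewrite expr2 -[leLHS]mul1r ler_wpM2r// ler1n.
Qed.

Lemma increment_le n (D : set 'rV[R]_n) (f : 'rV[R]_n -> R) (x y : 'rV[R]_n) c :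
  0 <= c -> C1on D f -> (forall t : R, 0 <= t <= 1 -> D (y + t *: (x - y))) ->
  (forall z k, D z -> `|partial k f z| <= c) -> `|f x - f y| <= n%:R * c * enorm (x - y).
Proof.
move=> c0 f1 Dt fc; set v := x - y.
have dv (t : R) : 0 <= t <= 1 -> is_derive t 1 (fun t : R => f (y + t *: v)) (\sum_i v 0 i * partial i f (y + t *: v)).
  by move=> /Dt Dy; apply: is_derive_partials; have [] := f1 _ Dy.
have [t||t /itvP t01] := @MVT_segment R (fun t : R => f (y + t *: v)) (fun t : R => \sum_i v 0 i * partial i f (y + t *: v)) 0 1 ler01.
- by rewrite in_itv /= => /andP[t0 t1]; apply: dv; rewrite !ltW.
- apply: derivable_within_continuous => t; rewrite in_itv /= => t01.
  by have [] := dv t t01.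
have Dy : D (y + t *: v) by apply: Dt; rewrite !t01.
rewrite scale1r scale0r addr0 subr0 mulr1 {1}/v subrKC => ->.
by rewrite -mulrA; apply: ler_norm_sum_const => i; rewrite normrM mulrC; apply: ler_pM; rewrite ?normr_ge0 ?normr_coord_le ?fc.
Qed.

Definition lap_matrix (M : topologicalType) n (X : riemann_data R M n) phi x : 'M[R]_n :=
  invmx (pullback_metric X phi x).

(** The first-order coefficient [- g^ij Gamma_ij^k] of the Laplace-Beltrami operator in the
    coordinates [phi]. *)
Definition lap_drift (M : topologicalType) n (X : riemann_data R M n) phi x : 'rV[R]_n :=
  - (christ (lap_matrix X phi x) (fun i => dmx i (pullback_metric X phi) x)
     *m lap_matrix X phi x).

(** The power [n^5] bounds the Lipschitz constant of the inverse metric and [n^4] the drift, with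
    generous numerical factors; the 1 keeps the constant positive in dimension 0. *)
Definition coef_const n : R := 81 * n%:R ^+ 5 + 45 * n%:R ^+ 4 + 1.

Lemma coefficients_flat (M : topologicalType) n (X : riemann_data R M n) p phi :
  riemannian_manifold X -> flatness X 2 2 p phi ->
  coefficients (coef_const n) (lap_matrix X phi) (lap_drift X phi).
Proof.
move=> rm fl; set G := pullback_metric X phi.
have n0 : 0 <= n%:R :> R by [].
have E (x : 'rV[R]_n) : enorm x <= 3 / 2 -> eball 2 x.
  by move=> h; apply: le_lt_trans h _; lra.
have Gs x : enorm x <= 3 / 2 -> (G x)^T = G x by move=> /E /(pullback_sym rm fl).
have H x : enorm x <= 3 / 2 -> G x \in unitmx /\
    forall v, (101 / 100)^-1 * enorm2 v <= quad (invmx (G x)) v <= (99 / 100)^-1 * enorm2 v.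
  move=> h; apply: quad_invmx_bounds; [exact: Gs|lra|lra|].
  by move=> v; apply: (pullback_bounds fl); exact: E.
have as_ x : enorm x <= 3 / 2 -> (lap_matrix X phi x)^T = lap_matrix X phi x.
  by move=> h; rewrite invmx_sym ?Gs.
have ab x : enorm x <= 3 / 2 -> forall v,
    9 / 10 * enorm2 v <= quad (lap_matrix X phi x) v <= 11 / 10 * enorm2 v.
  move=> h v; have [_ /(_ v)/andP[h1 h2]] := H x h; have := enorm2_ge0 v; move: h1 h2.
  rewrite -/(lap_matrix X phi x); move: (quad _ _) (enorm2 _) => q e.
  have -> : (101 / 100)^-1 = 100 / 101 :> R by rewrite invf_div.
  have -> : (99 / 100)^-1 = 100 / 99 :> R by rewrite invf_div.
  by move=> h1 h2 h3; apply/andP; split; lra.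
have ae x : enorm x <= 3 / 2 -> forall i j, `|lap_matrix X phi x i j| <= 3.
  move=> h i j; apply: (@le_trans _ _ (2 * (11 / 10))); last lra.
  apply: quad_entry_le; first exact: as_.
  move=> v; have /andP[h1 h2] := ab x h v; have := enorm2_ge0 v => h3.
  by rewrite ger0_norm//; apply: le_trans h1; apply: mulr_ge0 => //; lra.
have dG x i j k : eball 2 x -> `|partial k (fun y => G y i j) x| <= 1.
  by move=> /(pullback_partial fl i j k); move: `|_| => q; lra.
have dGe x i j k : enorm x <= 3 / 2 -> `|dmx i G x j k| <= 1.
  by move=> h; rewrite mxE; apply: dG; exact: E.
have GL x y : enorm x <= 3 / 2 -> enorm y <= 3 / 2 -> forall i j,
    `|(G y - G x) i j| <= n%:R * enorm (x - y).
  have subE (A B : 'M[R]_n) i j : (A - B) i j = A i j - B i j by rewrite !mxE.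
  move=> hx hy i j; rewrite subE distrC.
  have := @increment_le n (eball 2) (fun z => G z i j) x y 1 ler01 (pullback_C1 rm fl i j).
  rewrite mulr1; apply => [t /andP[t0 t1]|z k]; last exact: dG.
  apply: E; rewrite (_ : _ + _ = t *: x + (1 - t) *: y); last first.
    by rewrite scalerBr scalerBl scale1r addrCA addrA.
  apply: le_trans (enormD _ _) _; rewrite !enormZ !ger0_norm ?subr_ge0//.
  have := ler_wpM2l t0 hx; have := ler_wpM2l (_ : 0 <= 1 - t) hy; rewrite subr_ge0 => /(_ t1).
  by move: (t * enorm x) ((1 - t) * enorm y) => A B; lra.
have K1 : 81 * n%:R ^+ 5 <= coef_const n.
  by rewrite /coef_const -addrA lerDl addr_ge0// mulr_ge0// exprn_ge0.
have K2 : 45 * n%:R ^+ 4 <= coef_const n.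
  by rewrite /coef_const addrAC lerDr addr_ge0// mulr_ge0// exprn_ge0.
split=> //.
- move=> x y hx hy v.
  (* The resolvent identity carries the Lipschitz bound of the metric over to its inverse. *)
  have -> : lap_matrix X phi x - lap_matrix X phi y =
      lap_matrix X phi x *m (G y - G x) *m lap_matrix X phi y.
    have [uy _] := H y hy; have [ux _] := H x hx.
    by rewrite mulmxBr mulmxBl -(mulmxA _ (G y)) (mulmxV uy) mulmx1 (mulVmx ux) mul1mx.
  have e0 := enorm_ge0 (x - y).
  have P1 := mulmx_entry_le (ler0n _ _ : 0 <= 3%:R) (ae x hx) (GL x y hx hy).
  have c0 : 0 <= n%:R * (3 * (n%:R * enorm (x - y))) by rewrite !mulr_ge0.
  have P2 := mulmx_entry_le c0 P1 (ae y hy).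
  apply: le_trans (quad_entries_le v _ P2) _; first by rewrite !mulr_ge0.
  rewrite ler_wpM2r ?enorm2_ge0//; apply: le_trans (ler_wpM2r e0 K1).
  move: (enorm _) e0 => e e0; have q0 : 0 <= n%:R ^+ 5 * e by rewrite mulr_ge0// exprn_ge0.
  by move: q0; lra.
- move=> x hx.
  have c1 p' : `|christ (lap_matrix X phi x) (fun i => dmx i G x) 0 p'| <= 5 * n%:R ^+ 2.
    have P1 i : `|\tr (lap_matrix X phi x *m dmx i G x)| <= n%:R * (n%:R * 3).
      apply: ler_norm_sum_const => q.
      rewrite -(mulr1 3); apply: mulmx_entry_le => //; [exact: ae|by move=> j' k'; exact: dGe].
    have P2 : `|\sum_i (dmx i G x *m lap_matrix X phi x) p' i| <= n%:R * (n%:R * 3).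
      apply: ler_norm_sum_const => q.
      rewrite -(mul1r 3); apply: mulmx_entry_le => //; [by move=> j' k'; exact: dGe|exact: ae].
    rewrite mxE; apply: le_trans (ler_normB _ _) _.
    rewrite normrM (_ : `|2^-1| = 2^-1 :> R); last by rewrite ger0_norm ?invr_ge0.
    have h2 : 0 <= 2^-1 :> R by rewrite invr_ge0.
    apply: le_trans (lerD P2 (ler_wpM2l h2 (P1 p'))) _.
    have q0 : 0 <= n%:R ^+ 2 :> R by rewrite exprn_ge0.
    by move: q0; lra.
  have c50 : 0 <= 5 * n%:R ^+ 2 :> R by rewrite mulr_ge0// exprn_ge0.
  have P3 : forall i, `|lap_drift X phi x 0 i| <= n%:R * (5 * n%:R ^+ 2 * 3).
    move=> i; rewrite mxE normrN; apply: mulmx_entry_le => //; last exact: ae.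
    by move=> i' j; rewrite (ord1 i').
  apply: le_trans (enorm_entries_le _ P3) _; first by rewrite !mulr_ge0.
  apply: le_trans K2; have q0 : 0 <= n%:R ^+ 4 :> R by rewrite exprn_ge0.
  by move: q0; lra.
Qed.

End coefficient_bounds.

(** * Distances in coordinates *)

Section local_coordinates.
Context {R : realType} {N : topologicalType} {m : nat}.

Lemma derivable_row (f : R -> 'rV[R]_m) (t : R) (d : 'I_m -> R) :
  (forall k, is_derive t 1 (fun t => f t 0 k) (d k)) ->
  derivable f t 1 /\ forall k, (derive1 f t) 0 k = d k.
Proof.
move=> fd.
have df : derivable f t 1.
  by apply/derivable_mxP => i k; rewrite (ord1 i); have [] := fd k.
split=> // k; rewrite derive1E derive_mx// mxE.
by have [] := fd k.
Qed.

Lemma derivable1_continuous (V : normedModType R) (f : R -> V) (t : R) : derivable f t 1 -> {for t, continuous f}.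
Proof. by move=> /derivable1_diffP /differentiable_continuous. Qed.

Lemma continuous_near (T : topologicalType) (f h : T -> 'rV[R]_m) (t : T) :
  (\forall t' \near t, f t' = h t') -> {for t, continuous h} -> {for t, continuous f}.
Proof.
move=> fh hc; rewrite /prop_for /continuous_at (nbhs_singleton fh).
apply: cvg_trans hc; apply: near_eq_cvg.
by apply: filterS fh => t' ->.
Qed.

Variables (Y : riemann_data R N m) (D : set 'rV[R]_m) (Phi : 'rV[R]_m -> N) (Psi : N -> 'rV[R]_m).

(** What the estimates use of a parametrization [Phi] with inverse [Psi]. Stated for arbitrary
    manifold data, it serves both [M] and the cylinder, and it passes to smaller domains. *)
Record local_coords : Prop := {
  lc_open : open D;
  lc_dom : forall q, dom (chart_at Y q) q;
  lc_dom_open : forall c : chart Y, open (dom c);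
  lc_coordK : forall (c : chart Y) q, dom c q -> coordV c (Defs.coord c q) = q;
  lc_continuous : forall x, D x -> {for x, continuous Phi};
  lc_PsiK : forall x, D x -> Psi (Phi x) = x;
  lc_tau : forall (c : chart Y) k, C2on (D `&` Phi @^-1` dom c) (fun x => Defs.coord c (Phi x) 0 k);
  lc_image_open : forall c : chart Y, open (coord_image c (Phi @` D));
  lc_sigma : forall (c : chart Y) k,
    C2on (coord_image c (Phi @` D)) (fun y => Psi (coordV c y) 0 k) }.

Hypothesis lc : local_coords.

Lemma lc_preimage_open (A : set N) : open A -> open (D `&` Phi @^-1` A).
Proof.
move=> oA; rewrite openE => x [Dx Ax]; apply: filterI.
  exact: (open_nbhs_nbhs (conj (lc_open lc) Dx)).
exact: (lc_continuous lc Dx (open_nbhs_nbhs (conj oA Ax))).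
Qed.

Lemma lc_jacobianK (c : chart Y) x : D x -> dom c (Phi x) ->
  jacobian (fun x => Defs.coord c (Phi x)) x *m
  jacobian (fun y => Psi (coordV c y)) (Defs.coord c (Phi x)) = 1%:M.
Proof.
move=> Dx cx.
have Ix : coord_image c (Phi @` D) (Defs.coord c (Phi x)).
  by exists (Phi x) => //; split=> //; exists x.
apply/matrixP => i k; rewrite !mxE.
transitivity (partial i ((fun y => Psi (coordV c y) 0 k) \o (fun x => Defs.coord c (Phi x))) x).
  rewrite partial_comp//.
  - by apply: eq_bigr => l _; rewrite !mxE.
  - by move=> l; have [/(_ x (conj Dx cx))[]] := lc_tau lc c l.
  - by have [/(_ _ Ix)[]] := lc_sigma lc c k.
rewrite (@partial_ext _ _ (D `&` Phi @^-1` dom c) _ (fun y : 'rV[R]_m => y 0 k))//.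
- by rewrite /partial -(derive_coord (h := id)) ?derive_id ?mxE ?eqxx 1?eq_sym.
- by apply: lc_preimage_open; exact: lc_dom_open.
- by move=> y [Dy cy] /=; rewrite (lc_coordK lc)// (lc_PsiK lc).
Qed.

Lemma lc_jacobian_unit (c : chart Y) x : D x -> dom c (Phi x) ->
  jacobian (fun x => Defs.coord c (Phi x)) x \in unitmx.
Proof. by move=> Dx cx; have /mulmx1_unit[] := lc_jacobianK Dx cx. Qed.

Lemma segment_curve x v : (forall t : R, 0 <= t <= 1 -> D (x + t *: v)) ->
  C1_curve Y (fun t => Phi (x + t *: v)) /\
  forall t : R, 0 <= t <= 1 -> speed Y (fun t => Phi (x + t *: v)) t =
    Num.sqrt (quad (pullback_metric Y Phi (x + t *: v)) v).
Proof.
move=> Dv; pose l (t : R) := x + t *: v.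
have lC : continuous l.
  by move=> t; apply: cvgD; [exact: cvg_cst|exact: scalel_continuous].
have Dc (c : chart Y) (t : R) k : (D `&` Phi @^-1` dom c) (l t) ->
   is_derive t 1 (fun t : R => Defs.coord c (Phi (l t)) 0 k)
     ((v *m jacobian (fun x => Defs.coord c (Phi x)) (l t)) 0 k).
  move=> Dt; rewrite mxE.
  under eq_bigr do rewrite mxE.
  apply: (@is_derive_partials R m (fun x => Defs.coord c (Phi x) 0 k)).
  by have [/(_ _ Dt)[]] := lc_tau lc c k.
split; last first.
  move=> t /Dv Dt; rewrite /speed /pullback_metric -/(l t) quad_conj.
  set c := chart_at Y _; congr (Num.sqrt (quad _ _)).
  have ct : (D `&` Phi @^-1` dom c) (l t) by split=> //; exact: (lc_dom lc).
  have [_ H] := derivable_row (fun k => Dc c t k ct).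
  by apply/rowP => k; rewrite H.
move=> t t01; have Dt := Dv _ t01; split.
  by apply: continuous_comp; [exact: lC|exact: (lc_continuous lc)].
move=> c ct; pose Ec := D `&` Phi @^-1` dom c.
have oE : open Ec by apply: lc_preimage_open; exact: (lc_dom_open lc).
have nt : \forall t' \near t, Ec (l t').
  by apply: (lC t); exact: open_nbhs_nbhs.
have H t' (h : Ec (l t')) := derivable_row (fun k => Dc c t' k h).
split; first by near=> t'; have [|//] := H t'; near: t'; exact: nt.
apply: (@continuous_near _ _ (fun t' => v *m jacobian (fun x => Defs.coord c (Phi x)) (l t'))).
  by apply: filterS nt => t' h; apply/rowP => k; have [_ <-] := H t' h.
apply: continuous_rV => k.
rewrite (_ : (fun y => _) = fun t' => \sum_i v 0 i * (partial i (fun x => Defs.coord c (Phi x) 0 k) \o l) t').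
  apply: continuous_sumr => i; apply: cvgM; first exact: cvg_cst.
  apply: continuous_comp; first exact: lC.
  by have [/(_ _ (conj Dt ct))[_]] := lc_tau lc c k.
by apply/funext => t'; rewrite mxE; apply: eq_bigr => i _; rewrite mxE.
Unshelve. all: by end_near. Qed.

(** Monotonicity from the definition of the integral as a supremum over simple functions.
    Measurability is not an assumption, so it need not be shown for [speed], which is computed in a
    chart that changes with the time. *)
Lemma le_integral_sub (A B : set R) (f g : R -> \bar R) : A `<=` B ->
  (forall x, A x -> (f x <= g x)%E) -> (forall x, B x -> (0 <= g x)%E) ->
  (\int[lebesgue_measure]_(x in A) f x <= \int[lebesgue_measure]_(x in B) g x)%E.
Proof.
move=> AB fg g0; rewrite (@ge0_integralE _ _ _ lebesgue_measure B g g0) integralE.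
apply: (@le_trans _ _ (\int[lebesgue_measure]_(x in A) (f^\+ x))%E).
  by rewrite -[leRHS]adde0; apply: leeD => //; rewrite oppe_le0; exact: integral_ge0.
rewrite (@ge0_integralE _ _ _ lebesgue_measure A) => [|//].
apply: le_ereal_sup => _ [h /= hf <-]; exists h => //= x.
apply: le_trans (hf x) _; rewrite /patch.
case: ifPn => xA; last by case: ifPn => // /set_mem; exact: g0.
have Ax := set_mem xA.
by rewrite (mem_set (AB _ Ax)) funeposE ge_max fg// g0//; exact: AB.
Qed.

Lemma rdist_segment K x y : 0 <= K -> (forall t : R, 0 <= t <= 1 -> D (x + t *: (y - x))) ->
  (forall z v, D z -> quad (pullback_metric Y Phi z) v <= K ^+ 2 * enorm2 v) ->
  (rdist Y (Phi x) (Phi y) <= (K * enorm (y - x))%:E)%E.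
Proof.
move=> K0 Dv qK; have [C1 sp] := segment_curve Dv.
apply: (@le_trans _ _ (curve_length Y (fun t => Phi (x + t *: (y - x))))).
  apply: ereal_inf_lbound; exists (fun t => Phi (x + t *: (y - x))) => //; split=> //.
    by rewrite scale0r addr0.
  by rewrite scale1r subrKC.
rewrite /curve_length.
apply: (@le_trans _ _ (\int[lebesgue_measure]_(t in `[0%R, 1%R]) (K * enorm (y - x))%:E)%E).
  apply: le_integral_sub => // t /=; rewrite in_itv /= => t01; rewrite lee_fin.
    rewrite sp// -[leRHS]ger0_norm ?mulr_ge0 ?enorm_ge0// -sqrtr_sqr ler_sqrt ?sqr_ge0//.
    by rewrite exprMn sqr_enorm; exact: qK (Dv _ t01).
  by rewrite mulr_ge0 ?enorm_ge0.
by rewrite integral_cst//= lebesgue_measure_itv /= lte_fin ltr01 -EFinD subr0 mule1.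
Qed.

Lemma curve_psi (g : R -> N) (t : R) : C1_curve Y g -> 0 <= t <= 1 -> (Phi @` D) (g t) ->
  let c := chart_at Y (g t) in let S := jacobian (fun y => Psi (coordV c y)) in
  let xi := Defs.coord c \o g in
  \forall t' \near t, (forall k, is_derive (t' : R) 1 (fun t : R => Psi (g t) 0 k) ((derive1 xi t' *m S (xi t')) 0 k))
   /\ {for t', continuous (fun t => Psi (g t))}.
Proof.
move=> gC t01 Ig c S xi; have [gc /(_ c (lc_dom lc _))[gd _]] := gC t t01.
have xc : {for t, continuous xi} by apply: derivable1_continuous; exact: nbhs_singleton gd.
have It : coord_image c (Phi @` D) (xi t) by exists (g t) => //; split=> //; exact: (lc_dom lc).
have n1 : \forall t' \near t, coord_image c (Phi @` D) (xi t').
  by apply: xc; apply: open_nbhs_nbhs; split=> //; exact: (lc_image_open lc).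
have n2 : \forall t' \near t, dom c (g t').
  apply: gc; apply: open_nbhs_nbhs; split; [exact: (lc_dom_open lc)|exact: (lc_dom lc)].
have n3 := near_join n2.
apply: filterS (filterI (filterI gd n1) n3) => t' [[d' I'] n'].
have key k : is_derive (t' : R) 1 (fun t : R => Psi (g t) 0 k) ((derive1 xi t' *m S (xi t')) 0 k).
  have E : {near t', (fun t => Psi (coordV c (xi t)) 0 k) =1 (fun t => Psi (g t) 0 k)}.
    by apply: filterS n' => t2 dt2; rewrite /xi /= (lc_coordK lc).
  have df : differentiable (fun y => Psi (coordV c y) 0 k) (xi t').
    by have [/(_ _ I')[]] := lc_sigma lc c k.
  have dx : differentiable xi t' by apply/derivable1_diffP.
  have H : is_derive (t' : R) 1 (fun t : R => Psi (coordV c (xi t)) 0 k) ((derive1 xi t' *m S (xi t')) 0 k).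
    have dc : differentiable ((fun y => Psi (coordV c y) 0 k) \o xi) t' by exact: differentiable_comp.
    split; first exact: diff_derivable.
    transitivity ('D_1 ((fun y => Psi (coordV c y) 0 k) \o xi) t'); first by [].
    rewrite deriveE// diff_comp//= -!deriveE// derive_partials// mxE.
    by apply: eq_bigr => i _; rewrite mxE derive1E.
  have [H1 H2] := H; split.
    by apply: near_eq_derivable H1.
  by rewrite -H2; apply/esym/near_eq_derive.
split=> //; apply: continuous_rV => k.
by apply: derivable1_continuous; have [] := key k.
Qed.

(** [f] is [kap] times the component of [Psi \o g] along the displacement [e]. By Cauchy-Schwarz and
    the bound on the metric its derivative is at most the speed, and its increment is
    [kap * enorm e]. Only the part of the curve after [t0] has to stay in the chart. *)
Lemma curve_length_ge kap (g : R -> N) (t0 : R) : 0 < kap ->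
  (forall z v, D z -> kap ^+ 2 * enorm2 v <= quad (pullback_metric Y Phi z) v) ->
  C1_curve Y g -> 0 <= t0 <= 1 -> (forall t : R, t0 <= t <= 1 -> (Phi @` D) (g t)) ->
  ((kap * enorm (Psi (g t0) - Psi (g 1)))%:E <= curve_length Y g)%E.
Proof.
move=> k0 qk gC /andP[t00 t01] gD.
have sp0 t : (0 <= (speed Y g t)%:E)%E by rewrite lee_fin sqrtr_ge0.
rewrite -enormN opprB; set e := Psi (g 1) - Psi (g t0).
have [e0|e0] := eqVneq (enorm e) 0; first by rewrite e0 mulr0; apply: integral_ge0 => t _; exact: sp0.
have eg0 : 0 < enorm e by rewrite lt_neqAle eq_sym e0 enorm_ge0.
have t01' : t0 < 1.
  rewrite lt_neqAle t01 andbT; apply/eqP => h; move: e0.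
  by rewrite /e h subrr /enorm enorm20 sqrtr0 eqxx.
pose f (t : R) := dot (Psi (g t)) ((kap / enorm e) *: e).
pose w (t : R) := let c := chart_at Y (g t) in
  derive1 (Defs.coord c \o g) t *m jacobian (fun y => Psi (coordV c y)) (Defs.coord c (g t)).
have fE (t : R) (d : 'rV[R]_m) : (forall k, is_derive t 1 (fun t : R => Psi (g t) 0 k) (d 0 k)) ->
    is_derive t 1 f (dot d ((kap / enorm e) *: e)).
  move=> H; rewrite dotE (_ : f = fun t => \sum_k Psi (g t) 0 k * ((kap / enorm e) *: e) 0 k).
    apply: is_derive_sumr => k; have := H k.
    move: (((kap / enorm e) *: e) 0 k) => C Hk.
    rewrite (_ : (fun t => _) = C *: (fun t : R => Psi (g t) 0 k)).
      by rewrite mulrC; exact: is_deriveZ.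
    by apply/funext => t'; rewrite mulrC.
  by apply/funext => t'; rewrite /f dotE.
have in01 t : t0 <= t <= 1 -> 0 <= t <= 1.
  by move=> /andP[h ->]; rewrite (le_trans t00 h).
have fd (t : R) : t0 <= t <= 1 -> is_derive t 1 f (dot (w t) ((kap / enorm e) *: e)).
  move=> h; apply: fE => k.
  by have [] := nbhs_singleton (curve_psi gC (in01 _ h) (gD _ h)).
have f'c t : t0 <= t <= 1 -> {for t, continuous (derive1 f)}.
  move=> h; have nt := curve_psi gC (in01 _ h) (gD _ h); set c := chart_at Y (g t) in nt.
  pose S := jacobian (fun y => Psi (coordV c y)).
  pose xi := Defs.coord c \o g.
  have [gc /(_ c (lc_dom lc _))[gd gdc]] := gC t (in01 _ h).
  have xc : {for t, continuous xi} by apply: derivable1_continuous; exact: nbhs_singleton gd.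
  have It : coord_image c (Phi @` D) (xi t) by exists (g t) => //; split; [exact: (lc_dom lc)|exact: gD].
  have E : \forall t' \near t, dot (derive1 xi t' *m S (xi t')) ((kap / enorm e) *: e) = derive1 f t'.
    apply: filterS nt => t' [H0 _]; have [_ H] := fE t' (derive1 xi t' *m S (xi t')) H0.
    by rewrite [RHS]derive1E H.
  rewrite /prop_for /continuous_at -(nbhs_singleton E).
  suff hc : {for t, continuous (fun t' => dot (derive1 xi t' *m S (xi t')) ((kap / enorm e) *: e))}.
    by apply: cvg_trans hc; apply: near_eq_cvg.
  apply: dot_continuous; last exact: cst_continuous.
  apply: continuous_rV => k.
  rewrite (_ : (fun y => _) = fun t' => \sum_i (derive1 xi t') 0 i *
      (partial i (fun y => Psi (coordV c y) 0 k) \o xi) t'); last first.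
    by apply/funext => t'; rewrite mxE; apply: eq_bigr => i _; rewrite [S _ _ _]mxE.
  apply: continuous_sumr => i; apply: cvgM.
    exact: (continuous_comp gdc (@coord_continuous _ _ _ 0 i _)).
  apply: (continuous_comp xc).
  by have [/(_ _ It)[_]] := lc_sigma lc c k.
have fsp t : t0 <= t <= 1 -> `|derive1 f t| <= speed Y g t.
  move=> h; have [x Dx xg] := gD _ h; set c := chart_at Y (g t).
  have -> : derive1 f t = dot (w t) ((kap / enorm e) *: e) by rewrite derive1E; have [_ H] := fd t h.
  rewrite dotZr normrM ger0_norm ?divr_ge0 ?(ltW k0) ?enorm_ge0//.
  apply: (@le_trans _ _ (kap * enorm (w t))).
    rewrite mulrAC -mulrA ler_pM2l// ler_pdivrMr//; exact: normr_dot_le.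
  have hq : kap ^+ 2 * enorm2 (w t) <=
      quad (gmat c (Defs.coord c (g t))) (derive1 (Defs.coord c \o g) t).
    apply: le_trans (qk x _ Dx) _; rewrite /pullback_metric quad_conj xg -/c.
    have cx : dom c (Phi x) by rewrite xg; exact: (lc_dom lc).
    have SJ := mulmx1C (lc_jacobianK Dx cx); rewrite xg in SJ.
    have -> : \matrix_(i, k) partial i (fun y => Defs.coord c (Phi y) 0 k) x =
      jacobian (fun x => Defs.coord c (Phi x)) x by [].
    by rewrite /w -/c -mulmxA SJ mulmx1.
  rewrite -[leLHS]ger0_norm ?mulr_ge0 ?enorm_ge0 ?(ltW k0)// -sqrtr_sqr exprMn sqr_enorm.
  rewrite ler_sqrt//; apply: le_trans hq; rewrite mulr_ge0 ?enorm2_ge0//.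
  by rewrite exprn_ge0 ?(ltW k0).
have FTC : (\int[lebesgue_measure]_(t in `[t0, 1%R]) (derive1 f t)%:E = (f 1)%:E - (f t0)%:E)%E.
  apply: continuous_FTC2 => //.
    apply: continuous_in_subspaceT => t /set_mem; rewrite /= in_itv /=; exact: f'c.
  have fc t : t0 <= t <= 1 -> {for t, continuous f}.
    by move=> h; apply: derivable1_continuous; have [] := fd t h.
  split.
  - by move=> t; rewrite in_itv /= => /andP[h1 h2]; have [|//] := fd t _; rewrite !ltW.
  - by apply: cvg_at_right_filter; apply: fc; rewrite lexx.
  - by apply: cvg_at_left_filter; apply: fc; rewrite lexx andbT.
have fe : f 1 - f t0 = kap * enorm e.
  rewrite /f -[X in _ - X]opprK -dotNl opprK -dotDl -/e dotZr dotvv -sqr_enorm; field.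
  by rewrite gt_eqF.
rewrite -fe EFinB -FTC.
apply: le_integral_sub => [t|t|//] /=; rewrite !in_itv /=; first exact: in01.
by move=> h; rewrite lee_fin; apply: le_trans (fsp t h); rewrite ler_norm.
Qed.

End local_coordinates.

Section row_coordinates.
Context {R : realType}.

Lemma partial_coord n (i k : 'I_n) (x : 'rV[R]_n) : partial i (fun y : 'rV[R]_n => y 0 k) x = (k == i)%:R.
Proof. by rewrite /partial -(derive_coord (h := id)) ?derive_id ?mxE ?eqxx. Qed.

Lemma C2on_coord n (D : set 'rV[R]_n) k : C2on D (fun y : 'rV[R]_n => y 0 k).
Proof.
split=> [x Dx|i].
  split; first exact: differentiable_coord.
  by move=> i; rewrite (_ : partial i _ = cst (k == i)%:R);
    [exact: cst_continuous|apply/funext => y; rewrite partial_coord].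
rewrite (_ : partial i _ = (fun=> (k == i)%:R)); first exact: C1on_cst.
by apply/funext => y; rewrite partial_coord.
Qed.

Lemma lsubmx_coordE n (Y : 'rV[R]_(n + 1)) k : lsubmx Y 0 k = Y 0 (lshift 1 k).
Proof. by rewrite mxE. Qed.

Lemma rsubmx_coordE n (Y : 'rV[R]_(n + 1)) : rsubmx Y 0 0 = Y 0 (rshift n 0).
Proof. by rewrite mxE. Qed.

Lemma lsubmx_continuous n : continuous (fun Y : 'rV[R]_(n + 1) => lsubmx Y).
Proof.
move=> Y; apply: continuous_rV => k.
rewrite (_ : (fun y => _) = fun Y : 'rV[R]_(n + 1) => Y 0 (lshift 1 k)); first exact: coord_continuous.
by apply/funext => y; exact: lsubmx_coordE.
Qed.

Lemma rsubmx_continuous n : continuous (fun Y : 'rV[R]_(n + 1) => rsubmx Y 0 0).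
Proof.
move=> Y; rewrite (_ : (fun y => _) = fun Y : 'rV[R]_(n + 1) => Y 0 (rshift n 0)); first exact: coord_continuous.
by apply/funext => y; exact: rsubmx_coordE.
Qed.

Lemma C2on_lsub n (D : set 'rV[R]_n) (f : 'rV[R]_n -> R) : open D -> C2on D f ->
  C2on [set Y : 'rV[R]_(n + 1) | D (lsubmx Y)] (fun Y => f (lsubmx Y)).
Proof.
move=> oD f2; apply: (C2on_comp (E := D) (h := fun Y : 'rV[R]_(n + 1) => lsubmx Y)) => // [|k].
  by apply: open_comp => // Y _; exact: lsubmx_continuous.
rewrite (_ : (fun y => _) = fun Y : 'rV[R]_(n + 1) => Y 0 (lshift 1 k)); first exact: C2on_coord.
by apply/funext => y; exact: lsubmx_coordE.
Qed.

Lemma partial_lsub n (f : 'rV[R]_n -> R) (Y : 'rV[R]_(n + 1)) : differentiable f (lsubmx Y) ->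
  (forall i, partial (lshift 1 i) (fun Y => f (lsubmx Y)) Y = partial i f (lsubmx Y)) /\
  (forall j, partial (rshift n j) (fun Y => f (lsubmx Y)) Y = 0).
Proof.
move=> df.
have E i : partial i (fun Y => f (lsubmx Y)) Y = \sum_k (lshift 1 k == i)%:R * partial k f (lsubmx Y).
  rewrite (@partial_comp _ _ _ (fun Y : 'rV[R]_(n + 1) => lsubmx Y) f)// => [|k].
    apply: eq_bigr => k _; congr (_ * _); rewrite -(partial_coord i (lshift 1 k) Y).
    by congr (partial i _ Y); apply/funext => y; rewrite lsubmx_coordE.
  rewrite (_ : (fun y => _) = fun Y : 'rV[R]_(n + 1) => Y 0 (lshift 1 k)); first exact: differentiable_coord.
  by apply/funext => y; exact: lsubmx_coordE.
split=> [i|j]; rewrite E.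
  rewrite (bigD1 i)//= eqxx mul1r big1 ?addr0// => k /negbTE ki.
  by rewrite (inj_eq (@lshift_inj _ _)) ki mul0r.
by rewrite big1// => k _; rewrite eq_lrshift mul0r.
Qed.

Lemma partial_rsub n (Y : 'rV[R]_(n + 1)) i :
  partial i (fun Y : 'rV[R]_(n + 1) => rsubmx Y 0 0) Y = (rshift n 0 == i)%:R.
Proof.
rewrite -(partial_coord i (rshift n 0) Y); congr (partial i _ Y).
by apply/funext => y; exact: rsubmx_coordE.
Qed.

End row_coordinates.

(** * Product coordinates on the cylinder *)

Section cylinder_coordinates.
Context {R : realType} {M : topologicalType} {n : nat}.
Variable X : riemann_data R M n.

Lemma flat_coords p phi r : riemannian_manifold X -> flatness X 2 r p phi ->
  exists psi, local_coords X (eball r) phi psi.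
Proof.
move=> rm fl; have [[oV _ _ [psi [psiK psis]]] _ _ _] := fl; exists psi.
have oI (c : chart X) : open (coord_image c (phi @` eball r)) by exact: (open_coord_image rm).
split=> //.
- exact: open_eball0.
- exact: rm_chart_at.
- exact: rm_dom_open.
- by move=> c q; exact: (rm_coordK rm).
- by move=> x; exact: (phi_continuous fl).
- by move=> c k; exact: (tau_smooth rm fl).
- by move=> c k; exact: (smooth_C2on (oI c) (@subset_refl _ _) (psis c k)).
Qed.

Variables (D : set 'rV[R]_n) (phi : 'rV[R]_n -> M) (psi : M -> 'rV[R]_n).
Hypothesis lc : local_coords X D phi psi.

Definition cyl_region : set 'rV[R]_(n + 1) := [set Y | D (lsubmx Y)].
Definition cyl_phi (Y : 'rV[R]_(n + 1)) : M * R := (phi (lsubmx Y), rsubmx Y 0 0).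
Definition cyl_psi (y : M * R) : 'rV[R]_(n + 1) := pt (psi y.1) y.2.

Lemma open_lsub (A : set 'rV[R]_n) : open A -> open [set Y : 'rV[R]_(n + 1) | A (lsubmx Y)].
Proof. by move=> oA; apply: open_comp => // Y _; exact: lsubmx_continuous. Qed.

Lemma cyl_coordE (c : chart X) (y : M * R) k :
  @Defs.coord R _ _ (cylinder X) c y 0 k =
  match fintype.split k with inl i => Defs.coord c y.1 0 i | inr _ => y.2 end.
Proof. by rewrite /= mxE; case: fintype.split => // j; rewrite (ord1 j) mxE eqxx mulr1n. Qed.

Lemma cyl_imageE (c : chart X) :
  @coord_image R _ _ (cylinder X) c (cyl_phi @` cyl_region) =
  [set Y | coord_image c (phi @` D) (lsubmx Y)].
Proof.
apply/seteqP; split=> [_ [y [cy [Y DY Yy]] <-]|Y [q [cq [x Dx xq]] qY]] /=.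
  move: cy; rewrite -Yy /= => cy; rewrite row_mxKl; exists (phi (lsubmx Y)) => //; split=> //; exists (lsubmx Y).
exists (q, rsubmx Y 0 0); last first.
  rewrite /= qY -[RHS]hsubmxK; congr row_mx.
  by apply/matrixP => i j; rewrite !ord1 mxE eqxx mulr1n.
split=> //; exists (pt x (rsubmx Y 0 0)).
  by rewrite /cyl_region /= row_mxKl.
by rewrite /cyl_phi row_mxKl row_mxKr mxE eqxx mulr1n xq.
Qed.

Lemma cyl_coords : local_coords (cylinder X) cyl_region cyl_phi cyl_psi.
Proof.
split=> //.
- by apply: open_lsub; exact: (lc_open lc).
- by move=> y; exact: (lc_dom lc).
- by move=> c; apply: open_comp => [y _|]; [exact: cvg_fst|exact: (lc_dom_open lc)].
- move=> c [q z] /= cq; rewrite row_mxKl row_mxKr mxE eqxx mulr1n.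
  by rewrite (lc_coordK lc).
- move=> Y DY; apply: (@cvg_pair _ _ _ (nbhs Y) (nbhs (phi (lsubmx Y))) (nbhs (rsubmx Y 0 0)) _ _ _ (fun Y => phi (lsubmx Y)) (fun Y => rsubmx Y 0 0)); last exact: rsubmx_continuous.
  by apply: continuous_comp; [exact: lsubmx_continuous|exact: (lc_continuous lc)].
- by move=> Y DY; rewrite /cyl_psi /= (lc_PsiK lc)// ptK.
- move=> c k; rewrite (_ : (fun x => _) = fun Y : 'rV[R]_(n + 1) => match fintype.split k with
     inl i => @Defs.coord R M n X c (phi (lsubmx Y)) 0 i | inr _ => rsubmx Y 0 0 end); last first.
    by apply/funext => Y; rewrite cyl_coordE.
  case: fintype.split => [i|_].
    apply: (C2on_lsub _ (lc_tau lc c i)).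
    by apply: (lc_preimage_open lc); exact: (lc_dom_open lc).
  rewrite (_ : (fun Y : 'rV[R]_(n + 1) => rsubmx Y 0 0) = (fun Y : 'rV[R]_(n + 1) => Y 0 (rshift n 0))).
    exact: C2on_coord.
  by apply/funext => Y; exact: rsubmx_coordE.
- by move=> c; rewrite cyl_imageE; apply: open_lsub; exact: (lc_image_open lc).
- move=> c k; rewrite cyl_imageE (_ : (fun x => _) = fun Y : 'rV[R]_(n + 1) => match fintype.split k with
     inl i => psi (@coordV R M n X c (lsubmx Y)) 0 i | inr _ => rsubmx Y 0 0 end); last first.
    apply/funext => Y; rewrite /cyl_psi /= mxE.
    by case: fintype.split => // j; rewrite (ord1 j) mxE eqxx mulr1n.
  case: fintype.split => [i|_].
    have oD : open (@coord_image R M n X c (phi @` D)) by exact: (lc_image_open lc).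
    have sc : C2on (@coord_image R M n X c (phi @` D)) (fun y => psi (@coordV R M n X c y) 0 i) by exact: (lc_sigma lc).
    exact (C2on_lsub oD sc).
  rewrite (_ : (fun Y : 'rV[R]_(n + 1) => rsubmx Y 0 0) = (fun Y : 'rV[R]_(n + 1) => Y 0 (rshift n 0))).
    exact: C2on_coord.
  by apply/funext => Y; exact: rsubmx_coordE.
Qed.

Lemma cyl_jacobian (c : chart X) Y : cyl_region Y -> dom c (phi (lsubmx Y)) ->
  jacobian (fun Y => @Defs.coord R _ _ (cylinder X) c (cyl_phi Y)) Y =
  block_mx (jacobian (fun x => Defs.coord c (phi x)) (lsubmx Y)) 0 0 1%:M.
Proof.
move=> DY cY.
have E k : partial^~ (fun Y => @Defs.coord R _ _ (cylinder X) c (cyl_phi Y) 0 k) =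
   partial^~ (fun Y => match fintype.split k with inl i => Defs.coord c (phi (lsubmx Y)) 0 i | inr _ => rsubmx Y 0 0 end).
  by apply/funext => i; congr (partial i _); apply/funext => Z; rewrite cyl_coordE.
have dl l : differentiable (fun x => Defs.coord c (phi x) 0 l) (lsubmx Y).
  by have [/(_ _ (conj DY cY))[]] := lc_tau lc c l.
apply/matrixP => i k; rewrite mxE; have := congr1 (fun F => F i Y) (E k) => /= ->.
rewrite [RHS]mxE; case: (split_ordP i) => i' ->; case: (split_ordP k) => k' ->.
- by rewrite row_mxEl (partial_lsub (dl k')).1 mxE.
- by rewrite row_mxEr partial_rsub mxE eq_rlshift.
- by rewrite row_mxEl (partial_lsub (dl k')).2 mxE.
by rewrite row_mxEr partial_rsub mxE !ord1 !eqxx.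
Qed.

Lemma cyl_metric_conj (J g : 'M[R]_n) :
  block_mx J 0 0 1%:M *m block_mx g 0 0 1%:M *m (block_mx J 0 0 1%:M)^T =
  block_mx (J *m g *m J^T) 0 0 (1%:M : 'M[R]_1).
Proof.
by rewrite tr_block_mx !trmx0 trmx1 !mulmx_block !mul0mx !mulmx0 !addr0 !add0r !mulmx1 !mul0mx.
Qed.

Lemma cyl_pullback Y : cyl_region Y ->
  pullback_metric (cylinder X) cyl_phi Y = block_mx (pullback_metric X phi (lsubmx Y)) 0 0 1%:M.
Proof.
move=> DY; have cY : dom (chart_at X (phi (lsubmx Y))) (phi (lsubmx Y)) by exact: (lc_dom lc).
have := cyl_jacobian DY cY; rewrite /pullback_metric /= => E.
rewrite -cyl_metric_conj -[in RHS]E row_mxKl.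
by rewrite -[X in X *m _ *m X^T]/(jacobian _ _) E.
Qed.

Lemma cyl_pullback_quad Y v : cyl_region Y ->
  quad (pullback_metric (cylinder X) cyl_phi Y) v =
  quad (pullback_metric X phi (lsubmx Y)) (lsubmx v) + (rsubmx v 0 0) ^+ 2.
Proof. by move=> DY; rewrite cyl_pullback// -{1}(ptK v) quad_block1. Qed.

End cylinder_coordinates.

(** * Metric balls in the flat chart *)

Section flat_geometry.
Context {R : realType} {M : topologicalType} {n : nat}.
Variables (X : riemann_data R M n) (p : M) (phi : 'rV[R]_n -> M) (psi : M -> 'rV[R]_n).
Hypotheses (rm : riemannian_manifold X) (fl : flatness X 2 2 p phi)
  (lc : local_coords X (eball 2) phi psi).

Let lc' := cyl_coords lc.

Lemma eball_convex m (r : R) (x v : 'rV[R]_m) (t : R) : 0 <= t <= 1 -> eball r x -> eball r (x + v) -> eball r (x + t *: v).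
Proof.
move=> /andP[t0 t1] h1 h2; have -> : x + t *: v = (1 - t) *: x + t *: (x + v).
  by rewrite scalerDr addrA -scalerDl subrK scale1r.
apply: le_lt_trans (enormD _ _) _; rewrite !enormZ !ger0_norm ?subr_ge0//.
have [t00|tn0] := eqVneq t 0; first by rewrite t00 mul0r addr0 subr0 mul1r.
have tp : 0 < t by rewrite lt_neqAle eq_sym tn0.
have A : (1 - t) * enorm x <= (1 - t) * r by rewrite ler_wpM2l ?subr_ge0 ?(ltW h1).
have B : t * enorm (x + v) < t * r by rewrite ltr_pM2l.
by apply: lt_le_trans (ler_ltD A B) _; rewrite mulrBl mul1r subrK.
Qed.

(** The image of the segment from the origin is a competitor. The factor 201/200 exceeds the square
    root of 101/100, and 29/20 times it is below 3/2. *)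
Lemma rball_phi x : enorm x < 29 / 20 -> rball X (3 / 2) p (phi x).
Proof.
move=> hx; have [_ p0 _ _] := fl.
have e0 : enorm (0 : 'rV[R]_n) = 0 by rewrite /enorm enorm20 sqrtr0.
have K0 : 0 <= 201 / 200 :> R by lra.
have h0 : eball 2 (0 : 'rV[R]_n) by rewrite /eball /= -/(enorm _) e0; lra.
have h1 : eball 2 x by rewrite /eball /= -/(enorm _); move: hx; lra.
rewrite /rball /= -p0; apply: le_lt_trans (rdist_segment lc K0 _ _) _ => [t t01|z v Dz|].
- by apply: eball_convex => //; rewrite subrKC.
- have /andP[_ h] := pullback_bounds fl v Dz; apply: le_trans h _.
  by rewrite ler_wpM2r ?enorm2_ge0//; lra.
by rewrite lte_fin sub0r enormN; move: hx; lra.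
Qed.

(** The coordinate segment is again the competitor: 119/100 times 201/200 is below 6/5. *)
Lemma half_ball_phi Y : half_region n Y -> half_ball X (6 / 5) p (cyl_phi phi Y).
Proof.
move=> [z0 hY]; split=> //; have [_ p0 _ _] := fl.
have e0 : enorm (0 : 'rV[R]_(n + 1)) = 0 by rewrite /enorm enorm20 sqrtr0.
have K0 : 0 <= 201 / 200 :> R by lra.
have pE : (p, 0%R) = cyl_phi phi 0.
  rewrite /cyl_phi !mxE; congr (_, _); rewrite -p0; congr phi.
  by apply/rowP => i; rewrite !mxE.
have sb (Z : 'rV[R]_(n + 1)) : eball 2 Z -> cyl_region (eball 2) Z.
  by move=> h; apply: le_lt_trans h; rewrite -[X in _ <= enorm X](ptK Z); exact: enorm_lsub.
have h0 : eball 2 (0 : 'rV[R]_(n + 1)) by rewrite /eball /= -/(enorm _) e0; lra.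
have h1 : eball 2 Y by rewrite /eball /= -/(enorm _); move: hY; lra.
rewrite pE; apply: le_lt_trans (rdist_segment lc' K0 _ _) _ => [t t01|z v Dz|].
- by apply: sb; apply: eball_convex => //; rewrite subrKC.
- rewrite (cyl_pullback_quad lc _ Dz); have /andP[_ h] := pullback_bounds fl (lsubmx v) Dz.
  rewrite -{3}(ptK v) enorm_pt; have := sqr_ge0 (rsubmx v 0 0); have := enorm2_ge0 (lsubmx v).
  by move: h; move: (quad _ _) (enorm2 _) (_ ^+ 2) => q e w; lra.
by rewrite lte_fin sub0r enormN; move: hY; lra.
Qed.

(** A short curve from [y] to [(p, 0)] might leave the chart. After the last time outside, the
    length bound keeps it in the image [K] of a smaller closed ball. This image is compact, hence
    closed in the Hausdorff space [M], so the curve is in [K] at the limiting time too, and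
    therefore inside the chart around that time: a contradiction. *)
Lemma half_ball_coords y : half_ball X 1 p y -> exists Y : 'rV[R]_(n + 1),
  [/\ cyl_phi phi Y = y, 0 < rsubmx Y 0 0 & enorm Y <= 102 / 100].
Proof.
move=> [y0 /ereal_inf_lt[_ [g [gC g0 g1] <-]] gL]; have [[oV _ _ _] p0 _ _] := fl.
(* [kap ^+ 2] is below 99/100, and [1 / kap] is below 102/100. *)
pose kap : R := 994 / 1000; have k0 : 0 < kap by rewrite /kap; lra.
have qk (z v : 'rV[R]_(n + 1)) : cyl_region (eball 2) z ->
    kap ^+ 2 * enorm2 v <= quad (pullback_metric (cylinder X) (cyl_phi phi) z) v.
  move=> Dz; rewrite (cyl_pullback_quad lc _ Dz); have /andP[h _] := pullback_bounds fl (lsubmx v) Dz.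
  rewrite -{1}(ptK v) enorm_pt; have := sqr_ge0 (rsubmx v 0 0); have := enorm2_ge0 (lsubmx v).
  by move: h; rewrite /kap; move: (quad _ _) (enorm2 _) (_ ^+ 2) => q e w; lra.
have e0 : enorm (0 : 'rV[R]_n) = 0 by rewrite /enorm enorm20 sqrtr0.
have h0 : eball 2 (0 : 'rV[R]_n) by rewrite /eball /= -/(enorm _) e0; lra.
have psip : psi p = 0 by rewrite -p0 (lc_PsiK lc).
have key t0 : 0 <= t0 <= 1 -> (forall t : R, t0 <= t <= 1 -> (phi @` eball 2) (g t).1) ->
    enorm (pt (psi (g t0).1) (g t0).2) <= 102 / 100.
  move=> t001 gD; have gD' t : t0 <= t <= 1 -> (cyl_phi phi @` cyl_region (eball 2)) (g t).
    move=> /gD[x Dx xg]; exists (pt x (g t).2); first by rewrite /cyl_region /= row_mxKl.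
    by rewrite /cyl_phi row_mxKl row_mxKr mxE eqxx mulr1n xg -surjective_pairing.
  have := le_lt_trans (curve_length_ge lc' k0 qk gC t001 gD') gL.
  rewrite lte_fin /cyl_psi g1 /= psip; have -> : pt (0 : 'rV[R]_n) (0 : R) = 0.
    by rewrite /pt raddf0 row_mx0.
  by rewrite subr0 /kap; lra.
pose K := phi @` [set x | enorm (x - 0) <= 11 / 10].
have Ksub : K `<=` phi @` eball 2.
  by move=> q [x hx <-]; move: hx; rewrite /= subr0 => hx; exists x => //; rewrite /eball /= -/(enorm _); move: hx; lra.
have Kc : closed K.
  apply: compact_closed; first exact: (rm_hausdorff rm).
  apply: continuous_compact; last exact: compact_eball_closed.
  apply: continuous_in_subspaceT => x /set_mem /=; rewrite subr0 => hx.
  by apply: (lc_continuous lc); rewrite /eball /= -/(enorm _); move: hx; lra.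
pose B := [set t : R | 0 <= t <= 1 /\ ~ (phi @` eball 2) (g t).1].
have [[b Bb]|nB] := pselect (B !=set0).
  exfalso; have Bub : has_ubound B by exists 1 => t [/andP[]].
  have BS : has_sup B by split=> //; exists b.
  (* Times outside the chart accumulate at or before [T]; since the curve ends at [(p, 0)], the case
     [T = 1] is covered by the end point. *)
  pose T := sup B.
  have T0 : 0 <= T by case: (Bb) => /andP[b0 _] _; apply: le_trans b0 _; exact: ub_le_sup.
  have T1 : T <= 1 by apply: ge_sup => [|t [/andP[]]//]; exists b.
  have gT : {for T, continuous (fun t => (g t).1)}.
    have [|gc _] := gC T; first by rewrite T0.
    by apply: (continuous_comp gc); exact: cvg_fst.
  have good t : T < t <= 1 -> K (g t).1.
    move=> /andP[Tt t1]; have t001 : 0 <= t <= 1 by rewrite t1 (le_trans T0) ?(ltW Tt).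
    have gt' t' : t <= t' <= 1 -> (phi @` eball 2) (g t').1.
      move=> /andP[tt' t'1]; apply: contrapT => nI.
      have Bt' : B t' by split=> //; rewrite t'1 andbT; case/andP: t001 => h _; exact: le_trans tt'.
      by have := ub_le_sup Bub Bt'; rewrite leNgt (lt_le_trans Tt tt').
    have [x Dx xg] := gt' t ltac:(by rewrite lexx t1).
    exists x => //=; rewrite subr0; have := key t t001 gt'.
    by have := enorm_lsub (psi (g t).1) (g t).2; rewrite -xg (lc_PsiK lc)//; lra.
  have KT : K (g T).1.
    have [T1'|Tn1] := eqVneq T 1.
      by rewrite T1' g1 /=; exists 0; rewrite /= ?subr0 ?e0//; lra.
    have T1' : T < 1 by rewrite lt_neqAle Tn1.
    apply: contrapT => nK.
    have nb : nbhs (g T).1 (~` K) by apply: open_nbhs_nbhs; split=> //; exact: closed_openC.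
    have /nbhs_ballP[e /= e0' He] := gT _ nb.
    pose t := Num.min (T + e / 2) 1.
    have tT : T < t <= 1 by rewrite lt_min T1' ge_min lexx orbT andbT ltrDl divr_gt0.
    apply: (He t) (good _ tT); rewrite /ball /= ltr_norml.
    have : t <= T + e / 2 by rewrite ge_min lexx.
    by case/andP: tT; move: (t) e0' => t' e0' h1 _ h2; apply/andP; split; lra.
  have nb : nbhs (g T).1 (phi @` eball 2) by apply: open_nbhs_nbhs; split=> //; exact: Ksub.
  have /nbhs_ballP[e /= e0' He] := gT _ nb.
  have [t Bt tT] := sup_adherent e0' BS.
  have := ub_le_sup Bub Bt => tT'; case: (Bt) => _; apply; apply: He.
  by rewrite /ball /= ltr_norml -/T; move: tT tT'; rewrite -/T => h1 h2; apply/andP; split; lra.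
have gI t : 0 <= t <= 1 -> (phi @` eball 2) (g t).1.
  by move=> t01; apply: contrapT => nI; apply: nB; exists t.
exists (pt (psi y.1) y.2); have [x Dx xy] := gI 0 ltac:(by rewrite lexx ler01).
split; last first.
- by have := key 0; rewrite g0; apply => //; rewrite lexx ler01.
- by rewrite row_mxKr mxE eqxx mulr1n.
rewrite /cyl_phi row_mxKl row_mxKr mxE eqxx mulr1n; rewrite g0 in xy.
by rewrite -xy (lc_PsiK lc)// xy -surjective_pairing.
Qed.

End flat_geometry.

(** * The equation in coordinates *)

Section restriction.
Context {R : realType}.

Lemma C2on_ext n (D : set 'rV[R]_n) (f g : 'rV[R]_n -> R) :
  open D -> (forall y, D y -> f y = g y) -> C2on D f -> C2on D g.
Proof.
move=> oD fg [f1 f2]; split=> [|i]; first exact: C1on_ext f1.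
by apply: C1on_ext (f2 i) => // y Dy; exact: (partial_ext i oD).
Qed.

Lemma grd_ext n (D : set 'rV[R]_n) (f g : 'rV[R]_n -> R) x :
  open D -> (forall y, D y -> f y = g y) -> D x -> grd f x = grd g x.
Proof. by move=> oD fg Dx; apply/rowP => i; rewrite !mxE; exact: (partial_ext i oD). Qed.

Lemma hess_ext n (D : set 'rV[R]_n) (f g : 'rV[R]_n -> R) x :
  open D -> (forall y, D y -> f y = g y) -> D x -> hess f x = hess g x.
Proof.
move=> oD fg Dx; apply/matrixP => i j; rewrite !mxE; apply: (partial_ext j oD) => // y Dy.
exact: (partial_ext i oD).
Qed.

(** In a chart, the image of the smaller domain is cut out of the larger one by a condition on the
    continuous map [Psi \o coordV c], hence is open. *)
Lemma local_coords_sub (N : topologicalType) m (Y : riemann_data R N m) D D0 Phi Psi :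
  local_coords Y D Phi Psi -> open D0 -> D0 `<=` D -> local_coords Y D0 Phi Psi.
Proof.
move=> lc oD0 D0D.
have imE (c : chart Y) : coord_image c (Phi @` D0) =
    coord_image c (Phi @` D) `&` [set y | D0 (Psi (coordV c y))].
  apply/seteqP; split=> [y [q [cq [x Dx xq]] qy]|y [[q [cq [x Dx xq]] qy] /=]].
    split; first by exists q => //; split=> //; exists x => //; exact: D0D.
    by rewrite /= -qy (lc_coordK lc)// -xq (lc_PsiK lc)//; exact: D0D.
  rewrite -qy (lc_coordK lc)// -xq (lc_PsiK lc)// => D0x.
  by rewrite xq; exists q => //; split=> //; exists x.
have oI (c : chart Y) : open (coord_image c (Phi @` D0)).
  rewrite imE openE => y [Iy D0y]; apply: filterI.
    by apply: open_nbhs_nbhs; split=> //; exact: (lc_image_open lc).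
  have sc : {for y, continuous (fun y => Psi (coordV c y))}.
    by apply: continuous_rV => k; have [s1 _] := lc_sigma lc c k; exact: C1on_continuous s1 Iy.
  by apply: sc; apply: open_nbhs_nbhs; split.
split=> //.
- exact: (lc_dom lc).
- exact: (lc_dom_open lc).
- by move=> c q; exact: (lc_coordK lc).
- by move=> x /D0D; exact: (lc_continuous lc).
- by move=> x /D0D; exact: (lc_PsiK lc).
- by move=> c k; apply: C2on_sub (lc_tau lc c k) => x [/D0D].
- by move=> c k; apply: C2on_sub (lc_sigma lc c k); rewrite imE => y [].
Qed.

Lemma dmx_block n (G : 'rV[R]_n -> 'M[R]_n) (Y : 'rV[R]_(n + 1)) : mxdiff G (lsubmx Y) ->
  (forall i, dmx (lshift 1 i) (fun Y => block_mx (G (lsubmx Y)) 0 0 (1%:M : 'M[R]_1)) Y =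
     block_mx (dmx i G (lsubmx Y)) 0 0 0) /\
  (forall j, dmx (rshift n j) (fun Y => block_mx (G (lsubmx Y)) 0 0 (1%:M : 'M[R]_1)) Y = 0).
Proof.
move=> dG.
have bE k l : (exists k' l', [/\ k = lshift 1 k', l = lshift 1 l' & (fun Y : 'rV[R]_(n + 1) => block_mx (G (lsubmx Y)) 0 0 (1%:M : 'M[R]_1) k l) = (fun Y => G (lsubmx Y) k' l')])
  \/ ((forall A : 'M[R]_n, block_mx A 0 0 (0 : 'M[R]_1) k l = 0) /\ exists c, (fun Y : 'rV[R]_(n + 1) => block_mx (G (lsubmx Y)) 0 0 (1%:M : 'M[R]_1) k l) = (fun=> c)).
  case: (split_ordP k) => k' ->; case: (split_ordP l) => l' ->.
  - by left; exists k', l'; split=> //; apply/funext => Z; rewrite block_mxEul.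
  - right; split=> [A|]; first by rewrite block_mxEur mxE.
    by exists 0; apply/funext => Z; rewrite block_mxEur mxE.
  - right; split=> [A|]; first by rewrite block_mxEdl mxE.
    by exists 0; apply/funext => Z; rewrite block_mxEdl mxE.
  - right; split=> [A|]; first by rewrite block_mxEdr mxE.
    by exists ((1%:M : 'M[R]_1) k' l'); apply/funext => Z; rewrite block_mxEdr.
split=> [i|j]; apply/matrixP => k l; rewrite mxE.
  have [[k' [l' [-> -> E]]]|[-> [c ->]]] := bE k l; last by rewrite partial_cst.
  by rewrite block_mxEul E mxE (partial_lsub (dG k' l')).1.
have [[k' [l' [-> -> E]]]|[_ [c ->]]] := bE k l; last by rewrite partial_cst mxE.
by rewrite E mxE (partial_lsub (dG k' l')).2.
Qed.

Lemma christ_block n (a : 'M[R]_n) (d : 'I_n -> 'M[R]_n) (d' : 'I_(n + 1) -> 'M[R]_(n + 1)) :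
  (forall i, d' (lshift 1 i) = block_mx (d i) 0 0 0) -> (forall j, d' (rshift n j) = 0) ->
  christ (block_mx a 0 0 1%:M) d' = row_mx (christ a d) 0.
Proof.
move=> d1 d2; apply/rowP => p; rewrite mxE big_split_ord /= [X in _ + X - _]big1 ?addr0; last first.
  by move=> j _; rewrite d2 (mul0mx _ _) mxE.
under eq_bigr do rewrite d1 mulmx_block !(mul0mx _ _) !(mulmx0 _ _) !addr0.
case: (split_ordP p) => q ->.
  rewrite row_mxEl mxE d1 mulmx_block !(mul0mx _ _) !(mulmx0 _ _) !addr0 mxtrace_block mxtrace0 addr0.
  by congr (_ - _); apply: eq_bigr => i _; rewrite block_mxEul.
rewrite row_mxEr mxE d2 (mulmx0 _ _) mxtrace0 mulr0 subr0 big1// => i _.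
by rewrite block_mxEdl mxE.
Qed.

Lemma powR_rsub_grd n (a : R) (Y : 'rV[R]_(n + 1)) : 0 < rsubmx Y 0 0 ->
  differentiable (fun Y : 'rV[R]_(n + 1) => (rsubmx Y 0 0) `^ a) Y /\
  grd (fun Y : 'rV[R]_(n + 1) => (rsubmx Y 0 0) `^ a) Y =
    row_mx 0 (a * (rsubmx Y 0 0) `^ (a - 1))%:M.
Proof.
move=> z0; pose q := fun z : R => z `^ a.
have [dq qE] : is_derive (rsubmx Y 0 0) 1 q (a * (rsubmx Y 0 0) `^ (a - 1)) by exact: is_derive1_powR.
have dr : differentiable (fun Y : 'rV[R]_(n + 1) => rsubmx Y 0 0) Y.
  rewrite (_ : (fun Y => _) = fun Y : 'rV[R]_(n + 1) => Y 0 (rshift n 0)); first exact: differentiable_coord.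
  by apply/funext => y; exact: rsubmx_coordE.
have dq' : differentiable q (rsubmx Y 0 0) by apply/derivable1_diffP.
have dc : differentiable (q \o (fun Y : 'rV[R]_(n + 1) => rsubmx Y 0 0)) Y by exact: differentiable_comp.
split=> //; apply/rowP => i; rewrite mxE.
have -> : partial i (fun Y : 'rV[R]_(n + 1) => (rsubmx Y 0 0) `^ a) Y =
   partial i (fun Y : 'rV[R]_(n + 1) => rsubmx Y 0 0) Y * (a * (rsubmx Y 0 0) `^ (a - 1)).
  transitivity ('D_(delta_mx 0 i) (q \o (fun Y : 'rV[R]_(n + 1) => rsubmx Y 0 0)) Y) => //.
  rewrite deriveE// diff_comp//= -[X in 'd q _ X]mulr1 [X in 'd q _ X](_ : _ = ('d (fun Y : 'rV[R]_(n + 1) => rsubmx Y 0 0) Y (delta_mx 0 i)) *: 1)// linearZ /=.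
  by rewrite -!deriveE// qE.
rewrite partial_rsub; case: (split_ordP i) => j ->.
  by rewrite row_mxEl [RHS]mxE eq_rlshift mul0r.
by rewrite row_mxEr !ord1 eqxx mul1r [RHS]mxE eqxx mulr1n.
Qed.

End restriction.

Section equation.
Context {R : realType} {M : topologicalType} {n : nat}.
Variables (X : riemann_data R M n) (p : M) (phi : 'rV[R]_n -> M) (psi : M -> 'rV[R]_n).
Hypotheses (rm : riemannian_manifold X) (fl : flatness X 2 2 p phi)
  (lc : local_coords X (eball 2) phi psi).
Variables (U : M * R -> R).
Hypothesis U2 : Ck_on (cylinder X) 2 (half_ball X 2 p) U.

Let Ut Y := U (cyl_phi phi Y).
Let CX := cylinder X.

Lemma half_region_sub : @half_region R n `<=` cyl_region (eball 2).
Proof.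
move=> Y [_ hY]; rewrite /cyl_region /= /eball /= -/(enorm _).
by have := enorm_lsub (lsubmx Y) (rsubmx Y 0 0); rewrite ptK; move: hY; lra.
Qed.

Let lch := local_coords_sub (cyl_coords lc) (@open_half_region R n) half_region_sub.

Section at_point.
Variable Y : 'rV[R]_(n + 1).
Hypothesis hY : half_region n Y.
Let c : chart X := chart_at X (phi (lsubmx Y)).
Let tau (Z : 'rV[R]_(n + 1)) : 'rV[R]_(n + 1) := @Defs.coord R _ _ CX c (cyl_phi phi Z).
Let E := @half_region R n `&` cyl_phi phi @^-1` @dom R _ _ CX c.
Let D := @coord_image R _ _ CX c (cyl_phi phi @` @half_region R n).
Let u := U \o @coordV R _ _ CX c.
Let g := @gmat R _ _ CX c.

Lemma eq_open_E : open E.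
Proof. by apply: (lc_preimage_open lch); exact: (lc_dom_open lch). Qed.

Lemma eq_E : E Y.
Proof. by split=> //; exact: (lc_dom lc). Qed.

Lemma eq_open_D : open D.
Proof. exact: (lc_image_open lch). Qed.

Lemma eq_ED Z : E Z -> D (tau Z).
Proof. by move=> [hZ cZ]; exists (cyl_phi phi Z) => //; split=> //; exists Z. Qed.

Lemma eq_u2 : C2on D u.
Proof.
apply: (Ck_C2on eq_open_D _ (U2 c)) => _ [q [cq [Z hZ Zq]] <-].
exists q => //; split=> //; rewrite -Zq; have [z0 h] := half_ball_phi fl lc hZ.
by split=> //; apply: lt_trans h _; rewrite lte_fin; lra.
Qed.

Lemma eq_uE Z : E Z -> (u \o tau) Z = Ut Z.
Proof. by move=> [hZ cZ]; exact: (congr1 U (lc_coordK lch cZ)). Qed.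

Lemma eq_C2 : (differentiable Ut Y /\ forall i, {for Y, continuous (partial i Ut)}) /\
  forall i, differentiable (partial i Ut) Y /\ forall j, {for Y, continuous (partial j (partial i Ut))}.
Proof.
have [h1 h2] := C2on_ext eq_open_E eq_uE (C2on_comp eq_open_E eq_ED (lc_tau lch c) eq_u2).
by split=> [|i]; [exact: h1 eq_E|exact: h2 eq_E].
Qed.

Lemma eq_gmat Z : D Z -> [/\ mxdiff g Z, (g Z)^T = g Z & 0 < \det (g Z)].
Proof.
move=> [q [cq _] <-]; have gI : coord_image c setT (Defs.coord c q.1) by exists q.1.
have lE : lsubmx (@Defs.coord R _ _ CX c q) = Defs.coord c q.1 by rewrite row_mxKl.
have gs := rm_metric_sym rm gI.
have gp v : v != 0 -> 0 < quad (gmat c (Defs.coord c q.1)) v by exact: (rm_metric_pos rm gI).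
split.
- move=> k l; have dg k' l' : differentiable (fun x => gmat c x k' l') (lsubmx (@Defs.coord R _ _ CX c q)).
    by rewrite lE; have [] := metric_C1 rm k' l' gI.
  rewrite /g /=; case: (split_ordP k) => k' ->; case: (split_ordP l) => l' ->.
  + under eq_fun do rewrite block_mxEul.
    apply: (@differentiable_comp _ _ _ _ (fun Y : 'rV[R]_(n + 1) => lsubmx Y) (fun x => gmat c x k' l')) => //.
    apply: differentiable_rV => m; under eq_fun do rewrite lsubmx_coordE.
    exact: differentiable_coord.
  + by under eq_fun do rewrite block_mxEur mxE; exact: differentiable_cst.
  + by under eq_fun do rewrite block_mxEdl mxE; exact: differentiable_cst.
  + by under eq_fun do rewrite block_mxEdr; exact: differentiable_cst.
- by rewrite /g /= lE tr_block_mx !trmx0 trmx1 gs.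
- by rewrite /g /= lE det_ublock det1 mulr1; exact: det_pos.
Qed.

Lemma eq_conj Z : E Z -> jacobian tau Z *m g (tau Z) *m (jacobian tau Z)^T =
  block_mx (pullback_metric X phi (lsubmx Z)) 0 0 1%:M.
Proof.
move=> [hZ cZ]; have DZ := half_region_sub hZ.
rewrite (cyl_jacobian lc DZ cZ) /g /= row_mxKl cyl_metric_conj.
by rewrite (pullback_chart rm fl (conj DZ cZ)).
Qed.

Lemma eq_invmx : invmx (block_mx (pullback_metric X phi (lsubmx Y)) 0 0 (1%:M : 'M[R]_1)) =
  block_mx (lap_matrix X phi (lsubmx Y)) 0 0 1%:M.
Proof.
rewrite invmx_block_diag ?invmx1//; rewrite block_diag_mx_unit unitmx1 andbT.
apply: pos_unitmx => v v0; have e0 : 0 < enorm2 v.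
  by rewrite lt_neqAle enorm2_ge0 andbT eq_sym; apply/eqP => /enorm2_eq0 /eqP; apply/negP.
have /andP[+ _] := pullback_bounds fl v (half_region_sub hY).
by move: e0; move: (enorm2 v) (quad _ _) => e q; lra.
Qed.

(** The divergence is computed in the chart attached to the point, where [laplacian_change] applies
    with the weight [z^(1 - s)]. Dividing by the weight leaves [(1 - s) / z] from its derivative. *)
Lemma equation_at (s : R) :
  div_vf (scale_vf (fun y' : M * R => y'.2 `^ (1 - s)) (grad CX U)) (cyl_phi phi Y) = 0 ->
  \tr (block_mx (lap_matrix X phi (lsubmx Y)) 0 0 1%:M *m hess Ut Y) +
  dot (row_mx (lap_drift X phi (lsubmx Y)) ((1 - s) / rsubmx Y 0 0)%:M) (grd Ut Y) = 0.
Proof.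
move=> pde; have [z0 _] := hY.
pose w := fun x : 'rV[R]_(n + 1) => (rsubmx x 0 0) `^ (1 - s).
have tz Z : rsubmx (tau Z) 0 0 = rsubmx Z 0 0 by rewrite row_mxKr mxE eqxx mulr1n.
have [dw _] := @powR_rsub_grd R n (1 - s) (tau Y) ltac:(by rewrite tz).
have L := @laplacian_change R (n + 1) D E tau Y eq_open_E eq_E eq_ED (lc_tau lch c) g w u
  eq_open_D (lc_jacobian_unit lch hY (lc_dom lch _)) (fun y Dy => let: And3 h _ _ := eq_gmat Dy in h)
  (fun y Dy => let: And3 _ h _ := eq_gmat Dy in h) (fun y Dy => let: And3 _ _ h := eq_gmat Dy in h) dw eq_u2.
have L0 := etrans (esym L) pde; move: L0 {L pde}.
rewrite (eq_conj eq_E) eq_invmx.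
rewrite (hess_ext eq_open_E eq_uE eq_E) (grd_ext eq_open_E eq_uE eq_E).
have -> : (fun i => dmx i (fun y => jacobian tau y *m g (tau y) *m (jacobian tau y)^T) Y) =
    (fun i => dmx i (fun Z => block_mx (pullback_metric X phi (lsubmx Z)) 0 0 (1%:M : 'M[R]_1)) Y).
  by apply/funext => i; apply: (dmx_ext i eq_open_E) eq_E => Z EZ; exact: eq_conj.
have dG : mxdiff (pullback_metric X phi) (lsubmx Y).
  by move=> k l; have [] := pullback_C1 rm fl k l (half_region_sub hY).
have [d1 d2] := dmx_block dG; rewrite (christ_block _ d1 d2).
have wE : w \o tau = w by apply/funext => Z; rewrite /w /= tz.
rewrite wE /w tz; have [_ ->] := powR_rsub_grd (1 - s) z0.
move: (rsubmx Y 0 0) z0 (\tr _) (grd Ut Y) => z z0 T G.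
rewrite !mul_row_block !(mul0mx _ _) !(mulmx0 _ _) !addr0 !add0r !mulmx1.
rewrite powRB1// => H.
have wz : 0 < z `^ (1 - s) by exact: powR_gt0.
apply: (mulfI (lt0r_neq0 wz)); rewrite mulr0 -[RHS]H mulrDr mulrBr -addrA; congr (_ + _).
rewrite -mulrN -dotNl -!dotZl -dotDl opp_row_mx !scale_row_mx add_row_mx oppr0 scaler0 addr0 add0r.
congr (dot (row_mx _ _) _); apply/matrixP => i j; rewrite !mxE !ord1 eqxx !mulr1n.
by rewrite mulrCA.
Qed.

(** The squared norm of the gradient is the inverse metric evaluated on the differential, a form
    bounded by 11/10 in the flat coordinates; the factor 2 is generous. *)
Lemma vnorm_le : vnorm (grad CX U) (cyl_phi phi Y) <= 2 * enorm (grd Ut Y).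
Proof.
have cY := lc_dom lch (cyl_phi phi Y).
have uJ := lc_jacobian_unit lch hY cY.
have [_ gs gp] := eq_gmat (eq_ED eq_E).
have ug : g (tau Y) \in unitmx by rewrite unitmxE unitfE gt_eqF.
have du : differentiable u (tau Y) by have [/(_ _ (eq_ED eq_E))[]] := eq_u2.
have gE : grd Ut Y = grd u (tau Y) *m (jacobian tau Y)^T.
  rewrite -(grd_ext eq_open_E eq_uE eq_E).
  exact: (grd_comp (lc_tau lch c) eq_E du).
set J := jacobian tau Y in uJ gE; set v := grd u (tau Y) in gE.
have -> : vnorm (grad CX U) (cyl_phi phi Y) = Num.sqrt (quad (g (tau Y)) (v *m invmx (g (tau Y)))) by [].
rewrite -quad_invmx//.
pose a := block_mx (lap_matrix X phi (lsubmx Y)) 0 0 (1%:M : 'M[R]_1).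
have aE : invmx (J *m g (tau Y) *m J^T) = a by rewrite (eq_conj eq_E) eq_invmx.
have uG : J *m g (tau Y) *m J^T \in unitmx by rewrite !unitmx_mul uJ ug unitmx_tr.
have JaJ : J^T *m a *m J = invmx (g (tau Y)).
  apply: (can_inj (mulKmx ug)); rewrite mulmxV//; apply: (can_inj (mulKmx uJ)).
  by rewrite -aE !mulmxA mulmxV// mul1mx mulmx1.
have -> : quad (invmx (g (tau Y))) v = quad a (grd Ut Y).
  by rewrite -JaJ gE -{2}[J]trmxK quad_conj.
have hx : enorm (lsubmx Y) <= 3 / 2.
  have [_ h] := hY; have := enorm_lsub (lsubmx Y) (rsubmx Y 0 0).
  by rewrite ptK; move: h; lra.
have [_ /(_ _ hx)ab _ _] := coefficients_flat rm fl.
rewrite -[leRHS]ger0_norm ?mulr_ge0 ?enorm_ge0// -sqrtr_sqr ler_sqrt; last first.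
  by rewrite sqr_ge0.
rewrite exprMn sqr_enorm -(ptK (grd Ut Y)) /a quad_block1 enorm_pt.
have /andP[_ h] := ab (lsubmx (grd Ut Y)).
have := sqr_ge0 (rsubmx (grd Ut Y) 0 0); have := enorm2_ge0 (lsubmx (grd Ut Y)); move: h.
by move: (quad _ _) (enorm2 _) (_ ^+ 2) => q e r; lra.
Qed.

End at_point.

Lemma half_region_solution (s : R) :
  (forall y, half_ball X 2 p y ->
    div_vf (scale_vf (fun y' : M * R => y'.2 `^ (1 - s)) (grad CX U)) y = 0) ->
  solution s (lap_matrix X phi) (lap_drift X phi) Ut.
Proof.
move=> pde; split.
  by split=> [Y hY|i Y hY]; have [h1 h2] := eq_C2 hY; [exact: h1|exact: h2].
move=> x z hY; have := equation_at hY (s := s).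
have -> : lsubmx (pt x z) = x by rewrite row_mxKl.
have -> : rsubmx (pt x z) 0 0 = z by rewrite row_mxKr mxE eqxx mulr1n.
apply; apply: pde; have [y0 h] := half_ball_phi fl lc hY.
by split=> //; apply: lt_trans h _; rewrite lte_fin; lra.
Qed.

End equation.

(** * Traces and null sets *)

Section box_measure.
Context {R : realType}.
Local Open Scope ereal_scope.

Definition vbox (l u : nat -> R) n (x : nat -> R) : Prop :=
  forall i, (i < n)%N -> (l i <= x i <= u i)%R.

(* The n-dimensional Lebesgue measure, on a measurable type [T] that is only
   known through its coordinate functions [pt]. *)
Record box_measure n := BoxMeasure {
  bm_d : measure_display;
  bm_T : measurableType bm_d;
  bm_mu : {measure set bm_T -> \bar R};
  bm_pt : bm_T -> nat -> R;
  bm_measurable : forall l u, measurable [set t | vbox l u n (bm_pt t)];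
  bm_box : forall l u, (forall i, (i < n)%N -> (l i <= u i)%R) ->
    bm_mu [set t | vbox l u n (bm_pt t)] = (\prod_(i < n) (u i - l i))%:E }.

Lemma product_measure_exists d1 d2 (T1 : measurableType d1) (T2 : measurableType d2)
    (m1 : {measure set T1 -> \bar R}) (m2 : {sigma_finite_measure set T2 -> \bar R}) :
  exists m : {measure set (T1 * T2)%type -> \bar R},
    forall A1 A2, measurable A1 -> measurable A2 -> m (A1 `*` A2) = m1 A1 * m2 A2.
Proof. by exists (m1 \x m2) => A1 A2; exact: product_measure1E. Qed.

(** Induction by products with the Lebesgue measure of the line. Coordinates are functions on the
    natural numbers so that the type of points may change at each stage. *)
Lemma box_measure_exists n : inhabited (box_measure n).
Proof.
elim: n => [|n [[d T mu pt mb bE]]].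
  constructor; apply: (@BoxMeasure 0 _ unit (dirac tt) (fun _ _ => 0%R)) => [l u|l u _].
  - by [].
  - have H : dirac tt [set _ : unit | vbox l u 0 (fun=> 0%R)] = 1 :> \bar R by rewrite diracE mem_set.
    by rewrite big_ord0; exact: H.
have sE l u (x : T * measurableTypeR R) : vbox l u n.+1 (fun i => if i == n then x.2 else pt x.1 i) <->
    vbox l u n (pt x.1) /\ (x.2 \in `[l n, u n])%R.
  split=> [H|[H1 H2] i].
    split=> [i iN|]; last by have := H n (ltnSn n); rewrite eqxx in_itv.
    by have := H i (ltnW iN); rewrite ltn_eqF.
  by rewrite ltnS leq_eqVlt => /predU1P[->|iN]; [rewrite eqxx; rewrite in_itv in H2|rewrite ltn_eqF//; exact: H1].
have sX l u : [set x : T * measurableTypeR R | vbox l u n.+1 (fun i => if i == n then x.2 else pt x.1 i)] =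
    [set t | vbox l u n (pt t)] `*` `[l n, u n]%classic.
  by apply/seteqP; split=> x /=; rewrite sE.
have mI (a b : R) : measurable (`[a, b]%classic : set (measurableTypeR R)) by exact: measurable_itv.
pose lam : {sigma_finite_measure set (measurableTypeR R) -> \bar R} := @lebesgue_measure R.
have [m mE] := product_measure_exists mu lam.
pose q (x : T * measurableTypeR R) i := if i == n then x.2 else pt x.1 i.
have H1 l u : measurable [set x | vbox l u n.+1 (q x)] by rewrite sX; apply: measurableX.
have H2 l u : (forall i, (i < n.+1)%N -> (l i <= u i)%R) ->
    m [set x | vbox l u n.+1 (q x)] = (\prod_(i < n.+1) (u i - l i))%:E.
  move=> lu; rewrite sX; apply: etrans (mE _ _ (mb l u) (mI _ _)) _.
  rewrite bE => [|i iN]; last by apply: lu; exact: ltnW.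
  rewrite big_ord_recr /= EFinM; congr (_ * _).
  rewrite /lam /= lebesgue_measure_itv /= lte_fin; case: ltP => [//|ul].
  have -> : u n = l n by apply/eqP; rewrite eq_le ul lu.
  by rewrite subrr.
exact: (inhabits (BoxMeasure H1 H2)).
Qed.

Definition nat_ext n (x : 'rV[R]_n) (i : nat) : R := if insub i is Some j then x 0%R j else 0%R.

Lemma nat_extE n (x : 'rV[R]_n) (i : 'I_n) : nat_ext x i = x 0%R i.
Proof. by rewrite /nat_ext valK. Qed.

Variables (n : nat) (B : box_measure n).
Let mu := bm_mu B.
Definition bm_row (t : bm_T B) : 'rV[R]_n := \row_i bm_pt t i.

Definition rbox (l u : 'rV[R]_n) : set 'rV[R]_n := [set x | forall i, (l 0 i <= x 0 i <= u 0 i)%R].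

Lemma rboxE l u t : rbox l u (bm_row t) <-> vbox (nat_ext l) (nat_ext u) n (bm_pt t).
Proof.
split=> [H i iN|H i]; last by rewrite mxE -!nat_extE; exact: H.
by have := H (Ordinal iN); rewrite mxE -!nat_extE.
Qed.

Lemma measurable_rbox (l u : 'rV[R]_n) : measurable (bm_row @^-1` rbox l u).
Proof.
have -> : bm_row @^-1` rbox l u = [set t | vbox (nat_ext l) (nat_ext u) n (bm_pt t)].
  by apply/seteqP; split=> t /rboxE.
exact: bm_measurable.
Qed.

Lemma measure_rbox (l u : 'rV[R]_n) : (forall i, (l 0 i <= u 0 i)%R) ->
  mu (bm_row @^-1` rbox l u) = (\prod_i (u 0 i - l 0 i))%:E.
Proof.
move=> lu; have -> : bm_row @^-1` rbox l u = [set t | vbox (nat_ext l) (nat_ext u) n (bm_pt t)].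
  by apply/seteqP; split=> t /rboxE.
rewrite /mu bm_box => [|i iN]; last by rewrite -[i]/(nat_of_ord (Ordinal iN)) !nat_extE.
by congr EFin; apply: eq_bigr => i _; rewrite !nat_extE.
Qed.

(** A null set in the sense of box covers need not be measurable, so a measurable set of points
    lying over it is measured instead; the covers bound its measure by countable subadditivity. *)
Lemma lebesgue_null_measure (A : set 'rV[R]_n) (Z : set (bm_T B)) :
  lebesgue_null A -> measurable Z -> (forall t, Z t -> A (bm_row t)) -> mu Z = 0.
Proof.
move=> nA mZ ZA; apply/eqP; rewrite eq_le measure_ge0 andbT; apply/lee_addgt0Pr => e e0.
rewrite add0e; have [S [cS lS AS eS]] := nA e e0.
have /countable_injP[f finj] := cS.
(* The boxes are re-indexed by the natural numbers along the injection [f], with the empty set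
   outside its range. *)
pose F k : set (bm_T B) := if pselect (exists b, S b /\ f b = k) is left ex
  then bm_row @^-1` rbox (sval (cid ex)).1 (sval (cid ex)).2 else set0.
have FE b : S b -> F (f b) = bm_row @^-1` rbox b.1 b.2.
  move=> Sb; rewrite /F; case: pselect => [ex|[]]; last by exists b.
  by have [Sb' fb'] := svalP (cid ex); rewrite (finj _ _ _ _ fb') ?mem_set.
have F0 k : ~ (f @` S) k -> F k = set0.
  move=> nk; rewrite /F; case: pselect => // -[b [Sb fb]].
  by exfalso; apply: nk; exists b.
have mF k : measurable (F k).
  by rewrite /F; case: pselect => // ex; exact: measurable_rbox.
have ZF : Z `<=` \bigcup_k F k by move=> t /ZA /AS[b Sb tb]; exists (f b) => //; rewrite FE.
apply: le_trans; first exact: (measure_sigma_subadditive mu mF mZ ZF).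
rewrite nneseries_esumT => [|k]; last exact: measure_ge0.
rewrite (_ : \esum_(i in [set: nat]) mu (F i) = \esum_(i in f @` S) mu (F i)); last first.
  rewrite [RHS]esum_mkcond; apply: eq_esum => i _.
  case: ifPn => // /negP iS; rewrite F0 ?measure0// => Si.
  by apply: iS; exact: mem_set.
rewrite (reindex_esum S (f @` S) f _ (inj_bij finj)).
apply: le_trans eS; rewrite le_eqVlt; apply/orP; left; apply/eqP; apply: eq_esum => b Sb.
by rewrite FE// measure_rbox// => i; exact: lS.
Qed.

Lemma open_not_null (A : set 'rV[R]_n) (x : 'rV[R]_n) : nbhs x A -> ~ lebesgue_null A.
Proof.
move=> /nbhs_norm_ball[r r0 rA] nA.
pose l := \row_i (x 0%R i - r / 2)%R : 'rV[R]_n; pose u := \row_i (x 0%R i + r / 2)%R : 'rV[R]_n.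
have := @lebesgue_null_measure A (bm_row @^-1` rbox l u) nA (measurable_rbox l u).
rewrite measure_rbox => [|i]; last by rewrite !mxE; lra.
rewrite (eq_bigr (fun=> r)) => [|i _]; last by rewrite !mxE; lra.
rewrite prodr_const => H; have : (r ^+ #|'I_n|)%:E = 0 :> \bar R.
  apply: H => t /= Ht; apply: rA; apply: (@le_lt_trans _ _ (r / 2)%R); last by lra.
  apply: mx_norm_le => [|i j]; first by lra.
  by have := Ht j; rewrite (ord1 i) !mxE => /andP[h1 h2]; rewrite ler_norml; apply/andP; split; lra.
by move=> [] /eqP; rewrite gt_eqF// exprn_gt0.
Qed.

End box_measure.

(** * Bad points: oscillation bound and localization *)

Section oscillation.
Context {R : realType} {n : nat}.

(** At height [z] the gradient is of order at most [1 / z], so a horizontal displacement by [th * z]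
    changes [V] little, uniformly in [z]. This lets one bad point spoil a whole cell of size
    proportional to the height. *)
Lemma small_oscillation K s a b (V : 'rV[R]_(n + 1) -> R) Mb e :
  0 < K -> 0 < s < 2 -> 0 < Mb -> coefficients K a b -> solution s a b V ->
  (forall Y, half_region n Y -> `|V Y| <= Mb) -> 0 < e ->
  exists2 th : R, 0 < th <= 1 / 2 & forall x x' z, 0 < z <= 1 / 10 ->
    enorm x <= 116 / 100 -> enorm x' <= 116 / 100 -> enorm (x - x') <= th * z ->
    `|V (pt x z) - V (pt x' z)| <= e.
Proof.
move=> K0 s02 Mb0 co so VM e0; have [C C0 HC] := @gradient_scaled R n K K0.
pose c0 := (n + 1)%:R * (C * Mb) + 1.
have c00 : 0 < c0 by rewrite ltr_wpDl// !mulr_ge0// ltW.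
exists (Num.min (1 / 2) (e / c0)).
  by rewrite lt_min ge_min lexx andbT; apply/andP; split; [lra|exact: divr_gt0].
move=> x x' z /andP[z0 z1] hx hx' hxx.
have hr (y : 'rV[R]_n) : enorm y <= 116 / 100 -> enorm (pt y z) <= 117 / 100.
  move=> hy; have c1 : 0 <= 116 / 100 :> R by lra.
  have c2 : 0 <= 117 / 100 :> R by lra.
  rewrite enorm_le// enorm_pt; rewrite enorm_le// in hy.
  have z2 : z ^+ 2 <= (1 / 10) ^+ 2 by rewrite lerXn2r ?nnegrE ?(ltW z0)// (le_trans (ltW z0)).
  by move: hy z2; lra.
pose D := [set Y : 'rV[R]_(n + 1) | exists2 y, enorm y <= 116 / 100 & Y = pt y z].
have DH : D `<=` half_region n.
  by move=> _ [y hy ->]; apply/half_region_pt; split=> //; have := hr y hy; lra.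
have G Y k : D Y -> `|partial k V Y| <= C * Mb / z.
  move=> [y hy ->]; have H := HC s a b V Mb y z s02 Mb0 co so z0 (hr y hy).
  have {}H : enorm (grd V (pt y z)) <= C * Mb / z.
    apply: H => y' z' h; apply: VM; apply/half_region_pt; split.
      have : `|z' - z| <= z / 100 by apply: le_trans h; rewrite pt_sub; exact: enorm_rsub.
      by rewrite ler_norml => /andP[h1 _]; lra.
    have : enorm (pt y' z') <= enorm (pt y' z' - pt y z) + enorm (pt y z).
      by rewrite -{1}(subrK (pt y z) (pt y' z')) enormD.
    by have := hr y hy; move: h; lra.
  by apply: le_trans H; rewrite (_ : partial k V _ = grd V (pt y z) 0 k) ?normr_coord_le// mxE.
have [V1 _] := so.1.
have q0 : 0 <= C * Mb / z by rewrite !mulr_ge0 ?invr_ge0 ?ltW.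
have H := @increment_le R (n + 1) D V (pt x z) (pt x' z) (C * Mb / z) q0 (C1on_sub DH V1).
apply: (le_trans (H _ (fun Y k => @G Y k))).
  move=> t /andP[t0 t1]; rewrite pt_sub subrr; exists (x' + t *: (x - x')).
    rewrite (_ : _ + _ = t *: x + (1 - t) *: x'); last first.
      by rewrite scalerBr scalerBl scale1r addrCA addrA.
    apply: le_trans (enormD _ _) _; rewrite !enormZ !ger0_norm ?subr_ge0//.
    have h1 := ler_wpM2l t0 hx; have t1' : 0 <= 1 - t by rewrite subr_ge0.
    have h2 := ler_wpM2l t1' hx'; move: h1 h2.
    by move: (t * enorm x) ((1 - t) * enorm x') => A B; lra.
  by rewrite /pt scale_row_mx add_row_mx raddf0 scaler0 addr0.
have exx : enorm (pt x z - pt x' z) = enorm (x - x').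
  by rewrite /enorm pt_sub enorm_pt subrr expr0n addr0.
rewrite exx; apply: (@le_trans _ _ ((n + 1)%:R * (C * Mb / z) * (e / c0 * z))).
  have q1 : 0 <= (n + 1)%:R * (C * Mb / z) by apply: mulr_ge0.
  apply: (ler_wpM2l q1); apply: le_trans hxx _.
  by rewrite ler_wpM2r ?(ltW z0)// ge_min lexx orbT.
rewrite (_ : _ * _ = (n + 1)%:R * (C * Mb) * e / c0); last by field; rewrite !gt_eqF.
by rewrite ler_pdivrMr// mulrC ler_wpM2l ?(ltW e0)// /c0 lerDl.
Qed.

Lemma few_bad_pointsU V (A B : set 'rV[R]_n) :
  few_bad_points V A -> few_bad_points V B -> few_bad_points V (A `|` B).
Proof.
move=> HA HB e eta e0 eta0; have h0 : 0 < eta / 2 by lra.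
apply: filterS (filterI (HA e _ e0 h0) (HB e _ e0 h0)) => k [[S1 [s1 H1]] [S2 [s2 H2]]].
exists (S1 ++ S2); split.
  by rewrite size_cat natrD mulrDl; apply: le_trans (lerD s1 s2) _; lra.
move=> x [/H1|/H2] [h|[c cS h]]; [by left|right|by left|right];
  by exists c => //; rewrite mem_cat cS ?orbT.
Qed.

Lemma few_bad_points_sub V (A B : set 'rV[R]_n) : A `<=` B ->
  few_bad_points V B -> few_bad_points V A.
Proof.
move=> AB HB e eta e0 eta0; apply: filterS (HB e eta e0 eta0) => k [S [s H]].
by exists S; split=> // x /AB; exact: H.
Qed.

(** The null set of the trace is given chart by chart, so the property is first obtained locally. A
    finite subcover makes it global, because it is stable under unions. *)
Lemma few_bad_points_compact V (A : set 'rV[R]_n) : compact A ->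
  (forall x, A x -> exists W, nbhs x W /\ few_bad_points V (W `&` A)) -> few_bad_points V A.
Proof.
rewrite compact_cover => cA loc.
pose P x (W : set 'rV[R]_n) := [/\ open W, W x & few_bad_points V (W `&` A)].
pose f x : set 'rV[R]_n := xget set0 (P x).
have fP x : A x -> P x (f x).
  move=> Ax; apply: xgetPex; have [W [nW H]] := loc x Ax; exists W°; split.
  - exact: open_interior.
  - by [].
  - by apply: few_bad_points_sub H => y [/interior_subset].
have fo x : A x -> open (f x) by move=> /fP[].
have fc : A `<=` cover A f by move=> x Ax; exists x => //; have [] := fP x Ax.
have [D' D'A cov] := cA _ A f fo fc.
have H : forall r : seq 'rV[R]_n, {subset r <= D'} ->
    few_bad_points V ([set y | exists2 x, x \in r & f x y] `&` A).
  elim=> [_|x r IH sr].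
    move=> e eta e0 eta0; apply: (filterS (P := setT)) => [k _|]; last exact: filterT.
    by exists [::]; split=> [|x [[]]//]; rewrite mul0r ltW.
  have Ax : A x by apply/set_mem; exact: (D'A x (sr x (mem_head _ _))).
  have [_ _ Hx] := fP x Ax.
  apply: few_bad_points_sub (few_bad_pointsU Hx (IH _)) => [y [[x' + fy] Ay]|y yr].
    rewrite inE => /predU1P[x'x|x'r]; [left|right]; split=> //; first by rewrite -x'x.
    by exists x'.
  by apply: sr; rewrite inE yr orbT.
apply: few_bad_points_sub (H (enum_fset D') (fun x h => h)) => y Ay; split=> //.
by have [x xD fx] := cov y Ay; exists x.
Qed.

End oscillation.

(** * Grids of cells and their measure *)

Section cells.
Context {R : realType} {n : nat}.

Lemma ereal_sum_const (I : Type) (S : seq I) (v : R) : (\sum_(i <- S) v%:E = (v *+ size S)%:E)%E.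
Proof. by rewrite sumEFin big_const_seq count_predT iter_addr_0. Qed.

Variable B : @box_measure R n.
Let mu := bm_mu B.

(* [J] indexes the cells of side [s] of a grid starting at [o]; the middle
   halves of distinct cells are disjoint. *)
Definition cell (o : 'rV[R]_n) (s : R) m (J : {ffun 'I_n -> 'I_m}) : set 'rV[R]_n :=
  rbox (\row_i (o 0 i + (J i)%:R * s)) (\row_i (o 0 i + (J i)%:R * s + s)).

Definition half_cell (o : 'rV[R]_n) (s : R) m (J : {ffun 'I_n -> 'I_m}) : set 'rV[R]_n :=
  rbox (\row_i (o 0 i + (J i)%:R * s + s / 4)) (\row_i (o 0 i + (J i)%:R * s + 3 * s / 4)).

Lemma half_cell_sub (o : 'rV[R]_n) s m (J : {ffun 'I_n -> 'I_m}) : 0 <= s -> half_cell o s J `<=` cell o s J.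
Proof.
move=> s0 x H i; have := H i; rewrite !mxE; move: (_ + _ * s) => a /andP[h1 h2].
by apply/andP; split; lra.
Qed.

Lemma half_cell_disjoint (o : 'rV[R]_n) s m (J J' : {ffun 'I_n -> 'I_m}) x : 0 < s ->
  half_cell o s J x -> half_cell o s J' x -> J = J'.
Proof.
move=> s0 H H'; apply/ffunP => i; apply/eqP; rewrite -val_eqE /=; apply/eqP.
have K (j j' : nat) : o 0 i + j%:R * s + s / 4 <= x 0 i -> x 0 i <= o 0 i + j'%:R * s + 3 * s / 4 -> (j <= j')%N.
  move=> h1 h2; rewrite leqNgt; apply/negP => jj.
  have : j'%:R * s + s <= j%:R * s by rewrite -{2}(mul1r s) -mulrDl ler_pM2r// natr1 ler_nat.
  by move: h1 h2; move: (j%:R * s) (j'%:R * s) => a b; lra.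
have := H i; have := H' i; rewrite !mxE => /andP[a1 a2] /andP[b1 b2].
by apply/eqP; rewrite eqn_leq (K _ _ b1 a2) (K _ _ a1 b2).
Qed.

Lemma measure_half_cells (o : 'rV[R]_n) s m (S : seq {ffun 'I_n -> 'I_m}) : 0 < s -> uniq S ->
  let F := \bigcup_(J in [set` S]) (@bm_row R n B @^-1` half_cell o s J) in
  measurable F /\ mu F = ((s / 2) ^+ n *+ size S)%:E.
Proof.
move=> s0 uS F; have mc (J : {ffun 'I_n -> 'I_m}) : measurable (@bm_row R n B @^-1` half_cell o s J).
  exact: measurable_rbox.
have fS : finite_set [set` S] by exact: finite_seq.
split; first by apply: fin_bigcup_measurable.
rewrite /F measure_fin_bigcup//; last first.
  move=> J J' _ _ [t [h h']]; exact: (half_cell_disjoint s0 h h').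
rewrite -fsbig_seq// -ereal_sum_const; apply: eq_bigr => J _.
apply: etrans (measure_rbox B _) _ => [i|]; first by rewrite !mxE; move: (_ + _ * s) => a; lra.
congr EFin; rewrite (eq_bigr (fun=> s / 2)) => [|i _]; last by rewrite !mxE; move: (_ + _ * s) => a; lra.
by rewrite prodr_const card_ord.
Qed.

Lemma cell_cover (o : 'rV[R]_n) s m (y : 'rV[R]_n) : 0 < s ->
  (forall i, o 0 i <= y 0 i < o 0 i + m.+1%:R * s) -> exists J : {ffun 'I_n -> 'I_m.+1}, cell o s J y.
Proof.
move=> s0 H; exists [ffun i => inord (Num.truncn ((y 0 i - o 0 i) / s))] => i.
have /andP[h1 h2] := H i.
have q0 : 0 <= (y 0 i - o 0 i) / s by rewrite divr_ge0 ?(ltW s0)// subr_ge0.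
have /andP[t1 t2] := truncn_itv q0; set t := Num.truncn _ in t1 t2 *.
have tm : (t < m.+1)%N.
  by rewrite -(ltr_nat R); apply: le_lt_trans t1 _; rewrite ltr_pdivrMr//; move: h2; lra.
rewrite !mxE ffunE inordK//; rewrite ler_pdivlMr// in t1; rewrite ltr_pdivrMr// -natr1 mulrDl mul1r in t2.
by apply/andP; split; move: t1 t2; move: (t%:R * s) => a; lra.
Qed.

Lemma cell_diam (o : 'rV[R]_n) s m (J : {ffun 'I_n -> 'I_m}) y y' : cell o s J y -> cell o s J y' ->
  forall i, `|(y - y') 0 i| <= s.
Proof.
move=> H H' i; have := H i; have := H' i; rewrite !mxE; move: (_ + _ * s) => a /andP[h1 h2] /andP[h3 h4].
by rewrite ler_norml; apply/andP; split; lra.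
Qed.

End cells.

Section bad_cells.
Context {R : realType} {n : nat}.

(* If the points where [f k] is large are bad, so are the whole cells around
   them, and the middle halves of these cells have total measure tending to 0,
   because their upper limit is contained in the null set where [f k] does not
   tend to 0. *)
Lemma few_bad_cells (f : nat -> 'rV[R]_n -> R) (A N : set 'rV[R]_n) (y0 : 'rV[R]_n)
    (h e eta : R) (q k0 : nat) :
  0 < h -> 0 < e -> 0 < eta -> lebesgue_null N ->
  (forall y, (forall i, `|(y - y0) 0 i| <= h) -> (forall k1 : nat, exists2 k : nat, (k1 <= k)%N & e / 2 <= `|f k y|) -> N y) ->
  (forall k y y', (k0 <= k)%N -> (forall i, `|(y - y0) 0 i| <= h) -> (forall i, `|(y' - y0) 0 i| <= h) ->
     (forall i, `|(y - y') 0 i| <= 2 * h / q.+1%:R * k.+1%:R^-1) -> `|f k y - f k y'| <= e / 2) ->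
  \forall k \near \oo, exists S : seq 'rV[R]_n,
    [/\ (size S)%:R * (k.+1%:R^-1) ^+ n <= eta,
      forall y, y \in S -> (forall i, `|(y - y0) 0 i| <= h) &
      forall y, A y -> (forall i, `|(y - y0) 0 i| < h) -> e < `|f k y| ->
       exists2 y', y' \in S & forall i, `|(y - y') 0 i| <= 2 * h / q.+1%:R * k.+1%:R^-1].
Proof.
move=> h0 e0 eta0 nN fN fosc; have [B] := @box_measure_exists R n.
pose mu := bm_mu B; pose o : 'rV[R]_n := y0 - const_mx h.
pose s (k : nat) : R := 2 * h / q.+1%:R * k.+1%:R^-1.
(* [(m k).+1 = q.+1 * k.+1] cells of side [s k] fill the side [2 h] of the box exactly; the
   successor form keeps the index type inhabited. *)
pose m (k : nat) := (q * k.+1 + k)%N.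
have mE k : (m k).+1 = (q.+1 * k.+1)%N by rewrite /m; lia.
have s0 k : 0 < s k by rewrite !mulr_gt0 ?invr_gt0.
have ms k : (m k).+1%:R * s k = 2 * h.
  rewrite mE natrM /s; have a0 : q.+1%:R != 0 :> R by rewrite pnatr_eq0.
  have b0 : k.+1%:R != 0 :> R by rewrite pnatr_eq0.
  by move: (q.+1%:R) (k.+1%:R) a0 b0 => a b a0 b0; field; rewrite a0 b0.
pose Q := [set y : 'rV[R]_n | forall i, `|(y - y0) 0 i| <= h].
have cellQ k (J : {ffun 'I_n -> 'I_(m k).+1}) : cell o (s k) J `<=` Q.
  move=> y H i; have := H i; rewrite !mxE => /andP[h1 h2].
  have j0 : 0 <= (J i)%:R * s k by rewrite mulr_ge0// ltW.
  have j1 : (J i)%:R * s k + s k <= 2 * h.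
    by rewrite -(ms k) -{2}(mul1r (s k)) -mulrDl ler_pM2r// natr1 ler_nat ltn_ord.
  by move: h1 h2 j0 j1; move: (_%:R * s k) => a; rewrite ler_norml; move=> *; apply/andP; split; lra.
pose bad k (J : {ffun 'I_n -> 'I_(m k).+1}) y := [/\ cell o (s k) J y, A y & e < `|f k y|].
pose S k := [seq J <- enum {ffun 'I_n -> 'I_(m k).+1} | (k0 <= k)%N && `[< exists y, bad k J y >]].
have SP k J : J \in S k -> (k0 <= k)%N /\ exists y, bad k J y.
  by rewrite /S mem_filter => /andP[/andP[kk /asboolP ex] _].
have uS k : uniq (S k) by rewrite /S filter_uniq// enum_uniq.
pose F k := \bigcup_(J in [set` S k]) (@bm_row R n B @^-1` half_cell o (s k) J).
have mF k : measurable (F k) by have [] := measure_half_cells B o (s0 k) (uS k).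
have muF k : mu (F k) = ((s k / 2) ^+ n *+ size (S k))%:E by have [] := measure_half_cells B o (s0 k) (uS k).
have Fcell k t : F k t -> exists2 J, J \in S k & cell o (s k) J (bm_row t).
  by move=> [J JS Jt]; exists J => //; apply: half_cell_sub Jt; exact: ltW.
(* A point in infinitely many bad cells has [|f k| >= e / 2] for infinitely many [k], by the
   oscillation bound, so it belongs to [N]. *)
have F_lim t : lim_sup_set F t -> N (bm_row t).
  move=> Ht; have [k _ Fk] := Ht 0%N I.
  apply: fN => [i|k1].
    have [k2 _ /Fcell[J _ Jt]] := Ht 0%N I; exact: (cellQ _ _ _ Jt).
  have [k2 /= k12 /Fcell[J JS Jt]] := Ht k1 I; exists k2 => //.
  have [k02 [y [yJ _ yb]]] := SP _ _ JS.
  have := fosc k2 (bm_row t) y k02 (cellQ _ _ _ Jt) (cellQ _ _ _ yJ) (cell_diam Jt yJ).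
  have := ler_distD (f k2 (bm_row t)) 0 (f k2 y); rewrite !sub0r !normrN.
  by move: yb; move: `|f k2 y| => a; lra.
have mQ : measurable (@bm_row R n B @^-1` rbox o (y0 + const_mx h)) by exact: measurable_rbox.
have fin : (mu (\bigcup_(k >= 0) F k) < +oo)%E.
  apply: (@le_lt_trans _ _ (mu (@bm_row R n B @^-1` rbox o (y0 + const_mx h)))).
    apply: le_measure; [|exact/mem_set|].
      by apply/mem_set; apply: bigcup_measurable => k _; exact: mF.
    move=> t [k _ /Fcell[J _ Jt]] i; have := cellQ _ _ _ Jt i.
    by rewrite !mxE ler_norml => /andP[h1 h2]; apply/andP; split; lra.
  rewrite /mu measure_rbox ?ltry// => i; rewrite !mxE; lra.
have mL : measurable (lim_sup_set F).
  by apply: bigcap_measurable => // k _; apply: bigcup_measurable => j _; exact: mF.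
have L0 : mu (lim_sup_set F) = 0%E by exact: (lebesgue_null_measure nN mL F_lim).
(* Continuity from above, legitimate since all [F k] lie in one box of finite measure: the measures
   of the tails tend to that of the upper limit. *)
have cv := lim_sup_set_cvg mu F mF fin; rewrite L0 in cv.
(* The middle half of a cell has volume [(h / q.+1)^n * k.+1^-n], so measure below [eta'] means
   count times [k.+1^-n] below [eta]. *)
pose eta' := eta * (h / q.+1%:R) ^+ n.
have hq0 : 0 < h / q.+1%:R by rewrite divr_gt0.
have eta'0 : 0 < eta' by rewrite mulr_gt0// exprn_gt0.
have near1 : \forall k \near \oo, (mu (\bigcup_(j >= k) F j) < eta'%:E)%E.
  have nb : nbhs (0 : \bar R)%E [set z : \bar R | (z < eta'%:E)%E].
    by apply: open_nbhs_nbhs; split; [exact: open_ereal_lt_ereal|rewrite /= lte_fin].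
  exact: (cv _ nb).
have near2 : \forall k \near \oo, (k0 <= k)%N by exact: nbhs_infty_ge.
apply: filterS (filterI near1 near2) => k [k1 k2].
have Fk : (mu (F k) < eta'%:E)%E.
  apply: le_lt_trans k1; apply: le_measure; [exact/mem_set| |].
    by apply/mem_set; apply: bigcup_measurable => j _; exact: mF.
  by move=> t Ft; exists k => /=.
pose w J := xget y0 (bad k J).
have wP J : J \in S k -> bad k J (w J).
  by move=> /SP[_ ex]; exact: xgetPex.
exists [seq w J | J <- S k]; split.
- have : ((s k / 2) ^+ n *+ size (S k) < eta') by rewrite -lte_fin -muF.
  have -> : s k / 2 = h / q.+1%:R * k.+1%:R^-1 by rewrite /s; move: (q.+1%:R^-1) (k.+1%:R^-1) => a b; field.
  rewrite exprMn size_map -[_ *+ _]mulr_natl mulrCA /eta' (mulrC eta) ltr_pM2l ?exprn_gt0//.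
  by move/ltW.
- by move=> y /mapP[J /wP[yJ _ _] ->]; exact: (cellQ _ _ _ yJ).
move=> y Ay hy fy; have [|J yJ] := @cell_cover R n o (s k) (m k) y (s0 k).
  by move=> i; rewrite ms; have := hy i; rewrite !mxE ltr_norml => /andP[a1 a2]; apply/andP; split; lra.
have JS : J \in S k.
  by rewrite /S mem_filter k2 mem_enum inE andbT /=; apply/asboolP; exists y.
exists (w J); first by apply/mapP; exists J.
by have [wJ _ _] := wP J JS; exact: cell_diam yJ wJ.
Qed.

End bad_cells.

Section lipschitz.
Context {R : realType} {n : nat}.

(** [La] strictly exceeds every partial derivative at [y0] in absolute value, hence bounds them on a
    neighbourhood. A box is taken there because it is convex and matches the shape of the cells. *)
Lemma local_lipschitz (I : set 'rV[R]_n) (sg : 'rV[R]_n -> 'rV[R]_n) y0 r : open I -> I y0 ->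
  (forall k, C1on I (fun y => sg y 0 k)) -> enorm (sg y0) < r ->
  exists h L : R, [/\ 0 < h, 0 < L,
    forall y, (forall i, `|(y - y0) 0 i| <= h) -> I y /\ enorm (sg y) < r &
    forall y y' c, 0 <= c -> (forall i, `|(y - y0) 0 i| <= h) -> (forall i, `|(y' - y0) 0 i| <= h) ->
      (forall i, `|(y - y') 0 i| <= c) -> enorm (sg y - sg y') <= L * c].
Proof.
move=> oI Iy0 sg1 hr.
have sc : {for y0, continuous sg} by apply: continuous_rV => k; exact: C1on_continuous (sg1 k) Iy0.
pose La := 1 + \sum_k \sum_l `|partial l (fun y => sg y 0 k) y0|.
have n1 : \forall y \near y0, enorm (sg y) < r.
  have ec : {for y0, continuous (fun y => enorm (sg y))}.
    by apply: (continuous_comp sc); exact: enorm_continuous.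
  have nb : nbhs (enorm (sg y0)) [set t | t < r] by apply: open_nbhs_nbhs; split; [exact: open_lt|exact: hr].
  exact: (ec _ nb).
have n2 : \forall y \near y0, forall k l, `|partial l (fun y => sg y 0 k) y| <= La.
  apply: (@filter_forall _ _ (fun (k : 'I_n) y => forall l, `|partial l (fun y => sg y 0 k) y| <= La) (nbhs y0) _) => k.
  apply: (@filter_forall _ _ (fun (l : 'I_n) y => `|partial l (fun y => sg y 0 k) y| <= La) (nbhs y0) _) => l.
  have [_ /(_ l) pc] := sg1 k y0 Iy0.
  have nc : {for y0, continuous (fun y => `|partial l (fun y => sg y 0 k) y|)}.
    by apply: (continuous_comp pc); exact: norm_continuous.
  have lt0 : `|partial l (fun y => sg y 0 k) y0| < La.
    apply: (@le_lt_trans _ _ (\sum_k \sum_l `|partial l (fun y => sg y 0 k) y0|)).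
      rewrite (bigD1 k)//= (bigD1 l)//= -addrA lerDl addr_ge0// sumr_ge0// => k' _.
      by rewrite sumr_ge0.
    by rewrite /La ltrDr.
  have : \forall y \near y0, `|partial l (fun y => sg y 0 k) y| < La.
    have nb : nbhs (`|partial l (fun y => sg y 0 k) y0|) [set t | t < La] by apply: open_nbhs_nbhs; split; [exact: open_lt|exact: lt0].
    exact: (nc _ nb).
  by apply: filterS => y /ltW.
have [h0 h00 H0] := nbhs_norm_ball (filterI (filterI n1 n2) (open_nbhs_nbhs (conj oI Iy0))).
have La0 : 0 <= La by rewrite addr_ge0// sumr_ge0// => k _; rewrite sumr_ge0.
pose L := n%:R * (n%:R * La * n%:R) + 1.
have box y : (forall i, `|(y - y0) 0 i| <= h0 / 2) -> `|y - y0| < h0.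
  move=> H; apply: (@le_lt_trans _ _ (h0 / 2)); last by lra.
  by apply: mx_norm_le => [|i j]; [lra|rewrite (ord1 i)].
exists (h0 / 2), L; split; first by lra.
- by rewrite /L ltr_wpDl// !mulr_ge0.
- by move=> y /box /H0 [[]].
move=> y y' c c0 hy hy' hc; pose Q := [set z : 'rV[R]_n | forall i, `|(z - y0) 0 i| <= h0 / 2].
have QI : Q `<=` I by move=> z /box /H0 [].
have inc k : `|sg y 0 k - sg y' 0 k| <= n%:R * La * enorm (y - y').
  apply: (increment_le La0 (C1on_sub QI (sg1 k))) => [t /andP[t0 t1] i|z l /box /H0[[_ +] _]]; last exact.
  have -> : (y' + t *: (y - y') - y0) 0 i = t * (y - y0) 0 i + (1 - t) * (y' - y0) 0 i by rewrite !mxE; ring.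
  apply: le_trans (ler_normD _ _) _; have t1' : 0 <= 1 - t by rewrite subr_ge0.
  rewrite !normrM (ger0_norm t0) (ger0_norm t1').
  have := ler_wpM2l t0 (hy i); have := ler_wpM2l t1' (hy' i).
  by move: (t * _) ((1 - t) * `|_|) => A B; lra.
have ey : enorm (y - y') <= n%:R * c by exact: enorm_entries_le.
have q0 : 0 <= n%:R * La * (n%:R * c) by rewrite !mulr_ge0.
apply: (@le_trans _ _ (n%:R * (n%:R * La * (n%:R * c)))).
  apply: enorm_entries_le => // k; rewrite !mxE; apply: le_trans (inc k) _.
  by rewrite ler_wpM2l// mulr_ge0.
by rewrite /L mulrDl mul1r -!mulrA lerDl.
Qed.

End lipschitz.

Lemma lebesgue_null_sub (R : realType) n (A B : set 'rV[R]_n) : A `<=` B ->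
  lebesgue_null B -> lebesgue_null A.
Proof.
move=> AB nB e e0; have [S [cS lS BS eS]] := nB e e0; exists S; split=> // x /AB; exact: BS.
Qed.

(** * From the trace to few bad points, from essential to pointwise bounds *)

Section boundary_values.
Context {R : realType} {M : topologicalType} {n : nat}.
Variables (X : riemann_data R M n) (p : M) (phi : 'rV[R]_n -> M) (psi : M -> 'rV[R]_n).
Hypotheses (rm : riemannian_manifold X) (fl : flatness X 2 2 p phi)
  (lc : local_coords X (eball 2) phi psi).
Variables (U : M * R -> R) (v : M -> R).
Hypotheses (tr : is_trace X (rball X 2 p) U v) (v0 : forall q, rball X (3 / 2) p q -> v q = 0).

Let Ut Y := U (cyl_phi phi Y).

Lemma rball_sub q : rball X (3 / 2) p q -> rball X 2 p q.
Proof. by move=> h; apply: lt_trans h _; rewrite lte_fin; lra. Qed.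

Lemma few_bad_points_trace (K : R) s a b Mb : 0 < K -> 0 < s < 2 -> 0 < Mb -> coefficients K a b ->
  solution s a b Ut -> (forall Y, half_region n Y -> `|Ut Y| <= Mb) ->
  few_bad_points Ut [set x | enorm x <= 23 / 20].
Proof.
move=> K0 s02 Mb0 co so UM; set A := [set x | _].
have cA : compact A.
  have := @compact_eball_closed R n 0 (23 / 20); congr compact.
  by apply/seteqP; split=> x /=; rewrite subr0.
apply: few_bad_points_compact cA _ => x0 Ax0.
pose c := chart_at X (phi x0); pose tau x := Defs.coord c (phi x).
have E0 (x : 'rV[R]_n) : enorm x <= 116 / 100 -> eball 2 x.
  by move=> h; rewrite /eball /= -/(enorm _); move: h; lra.
have Ex0 : eball 2 x0 by apply: E0; move: Ax0; rewrite /A /=; lra.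
have cx0 : dom c (phi x0) by exact: (lc_dom lc).
pose Ic := coord_image c (phi @` eball 2).
pose sg y := psi (coordV c y); pose y0 := tau x0.
have tauI x : eball 2 x -> dom c (phi x) -> Ic (tau x).
  by move=> Ex cx; exists (phi x) => //; split=> //; exists x.
have sgtau x : eball 2 x -> dom c (phi x) -> sg (tau x) = x.
  by move=> Ex cx; rewrite /sg (lc_coordK lc)// (lc_PsiK lc).
have sg1 k : C1on Ic (fun y => sg y 0 k) by have [] := lc_sigma lc c k.
have e0 : enorm (sg y0) < 116 / 100 by rewrite sgtau//; move: Ax0; rewrite /A /=; lra.
have oI : open Ic by exact: (lc_image_open lc).
have [h [L [h0 L0 hI hL]]] := local_lipschitz oI (tauI _ Ex0 cx0) sg1 e0.
pose W := [set x | [/\ eball 2 x, dom c (phi x) & forall i, `|(tau x - y0) 0 i| < h]].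
exists W; split.
  have n1 : nbhs x0 (eball 2 `&` phi @^-1` dom c).
    apply: open_nbhs_nbhs; split=> //; apply: (lc_preimage_open lc); exact: (lc_dom_open lc).
  have n2 : \forall x \near x0, forall i, `|(tau x - y0) 0 i| < h.
    apply: (@filter_forall _ _ (fun (i : 'I_n) x => `|(tau x - y0) 0 i| < h) (nbhs x0) _) => i.
    have [t1 _] := lc_tau lc c i; have tc := C1on_continuous t1 (conj Ex0 cx0).
    have /cvgrPdist_lt/(_ h h0) := tc; apply: filterS => x.
    by rewrite distrC /y0 !mxE.
  by apply: filterS (filterI n1 n2) => x [[h1 h2] h3].
move=> e eta e_0 eta0; have e20 : 0 < e / 2 by lra.
have [th /andP[th0 th1] osc] := small_oscillation K0 s02 Mb0 co so UM e20.
(* With this [q], two points of a cell have images at distance at most [th / k.+1]: small enough for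
   the oscillation bound at height [k.+1^-1] and, as [th <= 1/2], for balls of radius half the
   height. *)
have [q qL] : exists q : nat, L * (2 * h / q.+1%:R) <= th.
  pose q := Num.truncn (L * (2 * h) / th); exists q.
  have q0 : 0 <= L * (2 * h) / th by rewrite !mulr_ge0 ?invr_ge0 ?ltW.
  have /andP[_ hq] := truncn_itv q0; rewrite ltr_pdivrMr// in hq.
  by rewrite mulrA ler_pdivrMr// [leRHS]mulrC; exact: ltW hq.
pose f (k : nat) y := Ut (pt (sg y) k.+1%:R^-1).
pose N := coord_image c (rball X 2 p `&` [set q' | ~ (U (q', z) @[z --> 0^'+] --> v q')]).
have nN : lebesgue_null N by exact: (tr c).
have step k : 0 < (k.+1%:R^-1 : R) by rewrite invr_gt0.
(* Starting at the index 10 keeps the heights below 1/10, as [small_oscillation] requires. *)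
have := @few_bad_cells R n f [set y | exists2 x, A x & y = tau x] N y0 h e eta q 10 h0 e_0 eta0 nN.
case.
- move=> y hy io; have [Iy sy] := hI y hy.
  have [qq [cq [x Ex xq]] qy] := Iy.
  have sx : sg y = x by rewrite -qy -xq sgtau// xq.
  have hx : rball X (3 / 2) p (phi x) by apply: (rball_phi fl lc); rewrite -sx; move: sy; lra.
  exists qq => //; split=> //; rewrite -xq; split; first exact: rball_sub.
  rewrite /= v0// => /cvgrPdist_lt/(_ _ e20); rewrite near_withinE => /nbhs_ballP[r /= r0 Hr].
  have [k1 _ Hk1] := near_infty_natSinv_lt (PosNum r0).
  have [k kk fk] := io k1.
  have kr : (k.+1%:R^-1 : R) < r by exact: Hk1.
  have := Hr k.+1%:R^-1; rewrite /ball /= sub0r normrN gtr0_norm// => /(_ kr (step k)).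
  rewrite sub0r normrN; move: fk; rewrite /f /Ut sx /cyl_phi row_mxKl row_mxKr mxE eqxx mulr1n.
  by move=> h1 h2; have := le_lt_trans h1 h2; rewrite ltxx.
- move=> k y y' k10 hy hy' hyy; have [_ sy] := hI y hy; have [_ sy'] := hI y' hy'.
  apply: osc; [|exact: ltW|exact: ltW|].
    rewrite step/= div1r lef_pV2 ?posrE// ler_nat; exact: (leq_trans k10).
  have c0 : 0 <= 2 * h / q.+1%:R * k.+1%:R^-1 by rewrite !mulr_ge0 ?invr_ge0 ?ltW.
  apply: le_trans (hL y y' _ c0 hy hy' hyy) _.
  by rewrite mulrA ler_wpM2r// ltW.
move=> k0 _ Hk0; exists k0 => // k kk; have [S [S1 SQ S2]] := Hk0 k kk.
exists [seq sg y | y <- S]; split; first by rewrite size_map.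
move=> x [[Ex cx hx] Ax].
have [xe|xe] := leP `|Ut (pt x k.+1%:R^-1)| e; [by left|right].
have := S2 (tau x) (ex_intro2 _ _ x Ax erefl) hx; rewrite /f sgtau// => /(_ xe)[y' y'S yy].
exists (sg y'); first by apply/mapP; exists y'.
have c0 : 0 <= 2 * h / q.+1%:R * k.+1%:R^-1 by rewrite !mulr_ge0 ?invr_ge0 ?ltW.
have := hL (tau x) y' _ c0 (fun i => ltW (hx i)) (SQ y' y'S) yy; rewrite sgtau// => H.
apply: le_trans H _; rewrite mulrA mulrC ler_wpM2l ?(ltW (step k))//.
by apply: le_trans qL _; move: th1; lra.
Qed.

(** [U] is continuous, so the set where [|U|] exceeds [K] is open in coordinates; if nonempty it
    contains a box and is not null. *)
Lemma Linf_pointwise (K : R) : Ck_on (cylinder X) 2 (half_ball X 2 p) U ->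
  Defs.null_set (cylinder X) (half_ball X (6 / 5) p `&` [set q | K < `|U q|]) ->
  forall Y, half_region n Y -> `|Ut Y| <= K.
Proof.
move=> U2 nK Y hY; rewrite leNgt; apply/negP => KU.
pose c := chart_at X (phi (lsubmx Y)).
have [B] := @box_measure_exists R (n + 1).
have oH := @open_half_region R n.
have lch := local_coords_sub (cyl_coords lc) oH (@half_region_sub R n).
have cY : @dom R _ _ (cylinder X) c (cyl_phi phi Y) := lc_dom lch (cyl_phi phi Y).
pose tY := @Defs.coord R _ _ (cylinder X) c (cyl_phi phi Y).
pose u := U \o @coordV R _ _ (cylinder X) c.
pose D := @coord_image R _ _ (cylinder X) c (cyl_phi phi @` half_region n).
have DtY : D tY by exists (cyl_phi phi Y) => //; split=> //; exists Y.
have nD : nbhs tY D by apply: open_nbhs_nbhs; split=> //; exact: (lc_image_open lch).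
have u2 : C2on D u by eapply eq_u2; eassumption.
have utY : u tY = Ut Y by exact: (congr1 U (lc_coordK lch cY)).
have uc : {for tY, continuous (fun y => `|u y|)}.
  have [u1 _] := u2; apply: (continuous_comp (C1on_continuous u1 DtY)); exact: norm_continuous.
have nu : nbhs tY [set y | K < `|u y|].
  have nb : nbhs (`|u tY|) [set t | K < t].
    by apply: open_nbhs_nbhs; split; [exact: open_gt|rewrite /= utY].
  exact: (uc _ nb).
apply: (open_not_null B (filterI nD nu)).
have := nK c; apply: lebesgue_null_sub => y [[q [cq [Z hZ Zq]] qy] Ky].
exists q => //; split=> //; split; first by rewrite -Zq; exact: (half_ball_phi fl lc hZ).
by rewrite /=; have <- : u y = U q by rewrite -qy; exact: (congr1 U (lc_coordK lch cq)).
Qed.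

End boundary_values.

Theorem lemma3p12 (R : realType) (n : nat) :
  exists C : R, 0 < C /\
  forall (s : R), 0 < s < 2 ->
  forall (M : topologicalType) (X : riemann_data R M n)
         (p : M) (phi : 'rV[R]_n -> M),
    riemannian_manifold X ->
    flatness X 2 2 p phi ->
  forall (U : M * R -> R) (u : M -> R),
    Ck_on (cylinder X) 2 (half_ball X 2 p) U ->
    (forall y, half_ball X 2 p y ->
       div_vf (scale_vf (fun y' : M * R => y'.2 `^ (1 - s))
                        (grad (cylinder X) U)) y = 0) ->
    is_trace X (rball X 2 p) U u ->
    (Linf_norm (cylinder X) (half_ball X 2 p) U < +oo)%E ->
    (forall q, rball X (3 / 2) p q -> u q = 0) ->
  forall y, half_ball X 1 p y ->
    ((y.2 `^ (1 - s) * vnorm (grad (cylinder X) U) y)%:E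
       <= (C / s)%:E * Linf_norm (cylinder X) (half_ball X (6 / 5) p) U)%E.
Proof.
have K0 : 0 < coef_const n :> R.
  by rewrite /coef_const ltr_wpDl// addr_ge0// mulr_ge0// exprn_ge0.
have [C0 C00 HC] := @weighted_gradient R n _ K0.
(* One factor 2 comes from [vnorm_le]; the other turns a bound free of [s] into one with [1 / s], by
   [s < 2]. *)
exists (4 * C0); split; first by rewrite mulr_gt0.
move=> s s02 M X p phi rm fl U u U2 pde tr _ u0 y hy; have /andP[s0 s2] := s02.
have [psi lc] := flat_coords rm fl.
have [Y [Yy z0 hY]] := half_ball_coords rm fl lc hy.
have HY : half_region n Y by split=> //; move: hY; lra.
have so := half_region_solution rm fl lc U2 pde.
have co := coefficients_flat rm fl.
have cs0 : 0 < 4 * C0 / s by rewrite divr_gt0// mulr_gt0.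
set w := y.2 `^ (1 - s) * vnorm (grad (cylinder X) U) y.
have bound (K : R) : 0 <= K ->
    Defs.null_set (cylinder X) (half_ball X (6 / 5) p `&` [set q | K < `|U q|]) -> w <= 4 * C0 / s * K.
  move=> K0' nK; have UK := Linf_pointwise fl lc U2 nK.
  apply: (@le_trans _ _ (2 * C0 * K)); last first.
    by rewrite ler_wpM2r// ler_pdivlMr// (_ : 4 * C0 = 2 * C0 * 2) ?ler_pM2l ?(ltW s2) ?mulr_gt0//; ring.
  (* [K] may be 0, whereas [weighted_gradient] asks for a positive bound: it is applied to [K + d]
     with [d] arbitrarily small. *)
  apply/ler_addgt0Pr => e e0; pose d := e / (2 * C0).
  have d0 : 0 < d by rewrite divr_gt0// mulr_gt0.
  have Kd : 0 < K + d by rewrite ltr_wpDl.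
  have UKd Z : half_region n Z -> `|U (cyl_phi phi Z)| <= K + d.
    by move=> /UK h; apply: le_trans h _; rewrite lerDl ltW.
  have bad := few_bad_points_trace fl lc tr u0 K0 s02 Kd co so UKd.
  have := HC s _ _ _ (K + d) (lsubmx Y) (rsubmx Y 0 0) s02 Kd co so UKd bad z0; rewrite ptK => /(_ hY) H.
  have vY := vnorm_le rm fl lc U2 HY.
  have -> : 2 * C0 * K + e = 2 * (C0 * (K + d)) by rewrite /d; field; rewrite gt_eqF.
  apply: le_trans (ler_wpM2l (ler0n _ 2) H); rewrite mulrCA /w -Yy.
  by apply: ler_wpM2l => //; exact: powR_ge0.
(* The infimum defining the norm is bounded below by bounding each admissible [K]; an empty set of
   such [K] is covered as well. *)
have Lw : ((w / (4 * C0 / s))%:E <= Linf_norm (cylinder X) (half_ball X (6 / 5) p) U)%E.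
  apply: le_ereal_inf_tmp => _ [K [K0' nK] <-]; rewrite lee_fin ler_pdivrMr// mulrC.
  exact: bound.
have -> : w%:E = ((4 * C0 / s)%:E * (w / (4 * C0 / s))%:E)%E.
  by rewrite -EFinM mulrC divfK// gt_eqF.
by apply: lee_wpmul2l => //; rewrite lee_fin ltW.
Qed.
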